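(* Suppose $d$ is a positive integer. For each $n\in\mathbb{N}$, suppose $L_n:=(L_{n1},L_{n2},\ldots,L_{nd})$ is an element of $\mathbb{N}^d$, and suppose $X^{(n)}:=\left(X_k^{(n)},\,k\in B(L_n)\right)$ is an array of (real-valued) random variables such that for each $k\in B(L_n)$, $EX_k^{(n)}=0$ and $E\left(X_k^{(n)}\right)^2<\infty$. Suppose the following mixing assumptions hold: $$\alpha(m):=\sup_{n}\alpha(X^{(n)},m)\to 0\ \text{ as } m\to\infty,\qquad\text{and}\qquad \rho'(1):=\sup_n\rho'(X^{(n)},1)<1.$$ For each $n\in\mathbb{N}$, define the random sum $S(X^{(n)},L_n):=\sum_{k\in B(L_n)}X_k^{(n)}$, define the quantity $\sigma_n^2:=E\left(S(X^{(n)},L_n)\right)^2$ (with $\sigma_n\ge 0$), and assume that $\sigma_n^2>0$. Suppose also that the Lindeberg condition $$\forall\,\varepsilon>0,\quad \lim_{n\to\infty}\frac{1}{\sigma_n^2}\sum_{k\in B(L_n)}E\left[\left(X_k^{(n)}\right)^2 I\left(\left|X_k^{(n)}\right|>\varepsilon\sigma_n\right)\right]=0$$ holds. Then $$\sigma_n^{-1}S(X^{(n)},L_n)\Rightarrow N(0,1)\quad\text{as } n\to\infty .$$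
   Context: $\mathbb{N}=\{1,2,3,\ldots\}$. All random variables are real-valued and defined on a probability space $(\Omega,\mathcal{F},P)$. No stationarity is assumed. $I(\cdot)$ denotes the indicator of an event, $\Rightarrow$ denotes convergence in distribution, and $N(0,1)$ is the standard normal law. Box: for $L=(L_1,\ldots,L_d)\in\mathbb{N}^d$, $B(L):=\{k=(k_1,\ldots,k_d)\in\mathbb{N}^d:\ \forall u\in\{1,\ldots,d\},\ 1\le k_u\le L_u\}$. Dependence coefficients of $\sigma$-fields: for $\sigma$-fields $\mathcal{A},\mathcal{B}\subseteq\mathcal{F}$, $$\alpha(\mathcal{A},\mathcal{B}):=\sup_{A\in\mathcal{A},\,B\in\mathcal{B}}|P(A\cap B)-P(A)P(B)|,$$ $$\rho(\mathcal{A},\mathcal{B}):=\sup|\mathrm{Corr}(f,g)|,\quad f\in L^2_{\mathrm{real}}(\mathcal{A}),\ g\in L^2_{\mathrm{real}}(\mathcal{B}),$$ where $L^2_{\mathrm{real}}(\mathcal{A})$ is the set of real-valued square-integrable $\mathcal{A}$-measurable random variables (and the correlation is taken to be $0$ if $f$ or $g$ is a.s. constant). Dependence coefficients of random fields: for a random field $X=(X_k,\,k\in\mathbb{Z}^d)$ and $n\in\mathbb{N}$: (i) $\alpha(X,n):=\sup\alpha(\sigma(X_k,k\in Q),\sigma(X_k,k\in S))$, the supremum being over all pairs of nonempty, disjoint sets $Q,S\subset\mathbb{Z}^d$ for which there exist $u\in\{1,\ldots,d\}$ and $j\in\mathbb{Z}$ such that $Q\subset\{k\in\mathbb{Z}^d:k_u\le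 j\}$ and $S\subset\{k\in\mathbb{Z}^d:k_u\ge j+n\}$. (ii) $\rho'(X,n):=\sup\rho(\sigma(X_k,k\in Q),\sigma(X_k,k\in S))$, the supremum being over all pairs of nonempty, finite, disjoint sets $Q,S\subset\mathbb{Z}^d$ for which there exist $u\in\{1,\ldots,d\}$ and nonempty disjoint sets $A,B\subset\mathbb{Z}$ with $\min_{a\in A,\,b\in B}|a-b|\ge n$ such that $Q\subset\{k\in\mathbb{Z}^d:k_u\in A\}$ and $S\subset\{k\in\mathbb{Z}^d:k_u\in B\}$. For a finite collection $X=(X_k,\,k\in B(L))$ with $L\in\mathbb{N}^d$, the coefficients $\alpha(X,n)$ and $\rho'(X,n)$ are defined as those of the random field $\widetilde{X}=(X_k,\,k\in\mathbb{Z}^d)$ obtained by setting $X_k:=0$ for $k\in\mathbb{Z}^d\setminus B(L)$. *)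

(* Defs.v *)
From HB Require Import structures.
From mathcomp Require Import all_boot all_order all_algebra.
From mathcomp Require Import all_classical all_reals all_analysis.

Set Implicit Arguments.
Unset Strict Implicit.
Unset Printing Implicit Defensive.

Import Order.TTheory GRing.Theory Num.Theory.
Import numFieldNormedType.Exports.

Local Open Scope classical_set_scope.
Local Open Scope ring_scope.

Definition lattice (d : nat) := {ffun 'I_d -> int}.

Definition box (d : nat) (L : 'I_d -> nat) : set (lattice d) :=
  [set k | forall u : 'I_d, 1 <= k u <= (L u)%:Z].

(* The sums over [box L] below are [fsbigop] sums, which are [0] by convention
   over a set on which the summand has infinite support; this never occurs. *)
Lemma finite_box (d : nat) (L : 'I_d -> nat) : finite_set (box L).
Proof.
pose N := (\max_(u < d) L u).+1.
pose F (f : {ffun 'I_d -> 'I_N}) : lattice d := [ffun u => (f u : nat)%:Z].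
apply: (@sub_finite_set _ _ (F @` setT)); last first.
  exact/finite_image/finite_finset.
move=> k kL; exists [ffun u => inord `|k u|%N] => //.
apply/ffunP => u; rewrite !ffunE.
have /andP[k1 kLu] := kL u.
have k0 : 0 <= k u by exact: le_trans k1.
rewrite inordK ?gez0_abs// ltnS -lez_nat gez0_abs//.
by apply: le_trans kLu _; rewrite lez_nat; exact: leq_bigmax.
Qed.

Section sigma_field_coefficients.
Context (disp : measure_display) (T : measurableType disp) (R : realType).
Variable P : probability T R.

(* Sigma-fields are given as families of events. *)
Definition alpha_coef (A B : set (set T)) : \bar R :=
  ereal_sup [set x | exists E F, [/\ A E, B F &
    x = `| P (E `&` F) - P E * P F |%E ]].

(* Division by zero in [R] yields [0], so the correlation is [0] as soon as one
   of the variances vanishes. *)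
Definition Corr (f g : T -> R) : R :=
  fine (covariance P f g) /
    (Num.sqrt (fine 'V_P[f]) * Num.sqrt (fine 'V_P[g])).

Definition L2real (A : set (set T)) : set (T -> R) :=
  [set f | (forall B : set R, measurable B -> A (f @^-1` B)) /\
           ('E_P[(fun t => (f t ^+ 2)%R)] < +oo)%E].

Definition rho_coef (A B : set (set T)) : \bar R :=
  ereal_sup [set x | exists f g, [/\ L2real A f, L2real B g &
    x = `| Corr f g |%:E ]].

End sigma_field_coefficients.

Section field_coefficients.
Context (disp : measure_display) (T : measurableType disp) (R : realType).
Variables (P : probability T R) (d : nat).
Implicit Types (Q S : set (lattice d)) (X : lattice d -> T -> R).

Definition sigma_field X Q : set (set T) :=
  <<s \bigcup_(k in Q) g_sigma_algebra_preimage (X k) >>.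

Definition halfspace_separated (n : nat) Q S : Prop :=
  exists (u : 'I_d) (j : int),
    Q `<=` [set k | k u <= j] /\ S `<=` [set k | j + n%:Z <= k u].

Definition slab_separated (n : nat) Q S : Prop :=
  exists (u : 'I_d) (A B : set int),
    [/\ A !=set0, B !=set0, A `&` B = set0 &
        (forall a b, A a -> B b -> n%:Z <= `|a - b|)] /\
    (Q `<=` [set k | A (k u)] /\ S `<=` [set k | B (k u)]).

Definition alpha_field X (n : nat) : \bar R :=
  ereal_sup [set x | exists Q S,
    [/\ Q !=set0, S !=set0, Q `&` S = set0, halfspace_separated n Q S &
        x = alpha_coef P (sigma_field X Q) (sigma_field X S) ]].

Definition rho'_field X (n : nat) : \bar R :=
  ereal_sup [set x | exists Q S,
    [/\ Q !=set0 /\ finite_set Q, S !=set0 /\ finite_set S, Q `&` S = set0,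
        slab_separated n Q S &
        x = rho_coef P (sigma_field X Q) (sigma_field X S) ]].

End field_coefficients.

Section arrays.
Context (disp : measure_display) (T : measurableType disp) (R : realType).
Variables (P : probability T R) (d : nat).

(* A finite collection [(X_k, k \in box L)] is represented by a total family;
   every notion below depends only on the values of the family on [box L]. *)
Variables (L : 'I_d -> nat) (X : lattice d -> {RV P >-> R}).

Definition zero_ext (k : lattice d) : T -> R :=
  if k \in box L then X k : T -> R else cst 0.

Definition alpha_array (n : nat) : \bar R := alpha_field P zero_ext n.

Definition rho'_array (n : nat) : \bar R := rho'_field P zero_ext n.

Definition box_sum (t : T) : R := \sum_(k \in box L) X k t.

Definition sigma2 : \bar R := 'E_P[(fun t => box_sum t ^+ 2)].

Definition sigma : R := Num.sqrt (fine sigma2).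

Definition lindeberg_sum (e : R) : \bar R :=
  (\sum_(k \in box L)
    'E_P[(fun t => X k t ^+ 2 * \1_[set t | (e * sigma < `|X k t|)%R] t)%R])%E.

End arrays.

Arguments alpha_array {disp T R} P {d} L X n.
Arguments rho'_array {disp T R} P {d} L X n.
Arguments box_sum {disp T R} P {d} L X t.
Arguments sigma2 {disp T R} P {d} L X.
Arguments sigma {disp T R} P {d} L X.
Arguments lindeberg_sum {disp T R} P {d} L X e.

Definition cvg_in_distribution (disp : measure_display)
    (T : measurableType disp) (R : realType) (P : probability T R)
    (Y : nat -> T -> R) (mu : probability (measurableTypeR R) R) : Prop :=
  forall x : R, {for x, continuous (fun y : R => mu (`]-oo, y]%classic))} ->
    P [set t | Y n t <= x] @[n --> \oo] --> mu (`]-oo, x]%classic).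

(* Main.v *)
(* After truncating at a small multiple of [sigma_n] (Lindeberg), centring and
   normalising, the summands [Y_k] are uniformly small and still adapted.  Call
   [mass p] the sum of [E Y_k^2] over the sites in [p].
   - Maximal correlation below [1] between slabs, averaged over all splittings
     of the values of one coordinate into two classes and iterated over the
     coordinates, makes [E S_p^2] comparable with [mass p] and bounds [E S_p^4]
     by a multiple of [\sum E Y_k^4 + (mass p)^2].
   - Strong mixing lets sums separated by a slab of fixed width be treated as
     independent inside characteristic functions, and as uncorrelated.
   - Cut coordinate by coordinate with periodic gaps whose phase is chosen so
     that their mass is small, and merge neighbouring cells as long as the mass
     of the union is small.  The number of pieces is then bounded uniformly in
     [n]; each has small mass, so that a Taylor expansion and the fourth moment
     apply, or a bounded width in this coordinate.  A piece that is bounded in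
     all coordinates has a bounded number of sites, hence a negligible sum.
   So the characteristic functions converge to [exp (- t^2 / 2)], and they
   determine the limit law.  Complex exponentials are avoided: everything is
   stated for the functions [cos (t x + b)]. *)
Require Import Defs.
From HB Require Import structures.
From mathcomp Require Import all_boot all_order all_algebra.
From mathcomp Require Import all_classical all_reals all_analysis.
From mathcomp Require Import measurable_realfun zify ring lra.
Set Implicit Arguments.
Unset Strict Implicit.
Unset Printing Implicit Defensive.

Import Order.TTheory GRing.Theory Num.Theory.
Import numFieldNormedType.Exports.

Local Open Scope classical_set_scope.
Local Open Scope ring_scope.

(** * Expectations of real random variables *)

(** The two mixing conditions have complementary weaknesses. A maximal correlation that is merely at
    most some [r < 1] never becomes small: it gives two-sided moment comparisons, but no asymptotic
    independence. Strong mixing does become small across wide gaps, but controls bounded functions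
    only; the uniform fourth moments carry it over to products of sums.

    Variances of pieces are not additive and need not converge. Each partial sum is therefore
    compared with the centred normal law of its own second moment ([gauss_factor]), and the
    normalisation enters only at the end, where the full sum has second moment 1.

    The order of the quantifiers shapes the blocking. The error per join must be fixed before the
    gap width, the gap width before the cell width, and the cell width before the bound on the
    summands, all independently of [n]. So the number of joins has to be bounded in advance, by a
    mass threshold alone. This is possible because the Taylor error of a piece of mass at most
    [s ^ 2] is a multiple of [s] times its mass: such errors add up to a multiple of [s], whatever
    the grouping. *)

Section expectation.
Context (disp : measure_display) (T : measurableType disp) (R : realType).
Variable P : probability T R.
Implicit Types f g h : T -> R.

Definition Ex f : R := \int[P]_x f x.

Definition summable_rv f := P.-integrable setT (EFin \o f).

Definition bdd f := measurable_fun setT f /\ exists M, forall t, `|f t| <= M.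

Definition L2 f := measurable_fun setT f /\ summable_rv (fun t => f t ^+ 2).

Lemma bdd_summable f : bdd f -> summable_rv f.
Proof.
move=> [mf [M fM]]; apply: measurable_bounded_integrable => //.
- by rewrite /= probability_setT ltry.
- exists M; split; first exact: num_real.
  by move=> x Mx t _; apply: le_trans (fM t) (ltW Mx).
Qed.

Lemma eq_Ex f g : f =1 g -> Ex f = Ex g.
Proof. by move=> fg; apply: eq_Rintegral => t _; exact: fg. Qed.

Lemma eq_summable f g : f =1 g -> summable_rv f -> summable_rv g.
Proof. by move=> /funext ->. Qed.

Lemma summableD f g :
  summable_rv f -> summable_rv g -> summable_rv (fun t => f t + g t).
Proof. by move=> sf sg; exact: (integrableD _ sf sg). Qed.

Lemma summableZ a f : summable_rv f -> summable_rv (fun t => a * f t).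
Proof. by move=> sf; exact: (integrableZl _ a sf). Qed.

Lemma summable_cst a : summable_rv (fun=> a).
Proof. by apply: bdd_summable; split=> //; exists `|a|. Qed.

Lemma le_summable f g : measurable_fun setT f -> summable_rv g ->
  (forall t, `|f t| <= g t) -> summable_rv f.
Proof.
move=> mf sg fg; apply: (le_integrable _ _ _ sg) => //; first exact/measurable_EFinP.
by move=> t _ /=; rewrite lee_fin (le_trans (fg t))// ler_norm.
Qed.

Lemma summable_norm f : summable_rv f -> summable_rv (fun t => `|f t|).
Proof. exact: integrable_norm. Qed.

Lemma ExD f g : summable_rv f -> summable_rv g ->
  Ex (fun t => f t + g t) = Ex f + Ex g.
Proof. by move=> sf sg; exact: RintegralD. Qed.

Lemma ExZ a f : summable_rv f -> Ex (fun t => a * f t) = a * Ex f.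
Proof. by move=> sf; exact: RintegralZl. Qed.

Lemma ExB f g : summable_rv f -> summable_rv g ->
  Ex (fun t => f t - g t) = Ex f - Ex g.
Proof. by move=> sf sg; exact: RintegralB. Qed.

Lemma Ex_cst a : Ex (fun=> a) = a.
Proof.
rewrite /Ex Rintegral_cst//.
have PT : fine (P setT) = 1 by rewrite probability_setT.
by rewrite [X in a * X]PT mulr1.
Qed.

Lemma le_Ex f g : summable_rv f -> summable_rv g -> (forall t, f t <= g t) ->
  Ex f <= Ex g.
Proof. by move=> sf sg fg; apply: le_Rintegral. Qed.

Lemma Ex_ge0 f : (forall t, 0 <= f t) -> 0 <= Ex f.
Proof. by move=> f0; apply: Rintegral_ge0. Qed.

Lemma ler_norm_Ex f : summable_rv f -> `|Ex f| <= Ex (fun t => `|f t|).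
Proof. by move=> sf; exact: le_normr_Rintegral. Qed.

Lemma le_norm_Ex f g : summable_rv f -> summable_rv g ->
  (forall t, `|f t| <= g t) -> `|Ex f| <= Ex g.
Proof.
move=> sf sg fg; apply: le_trans (ler_norm_Ex sf) _.
by apply: le_Ex => //; exact: summable_norm.
Qed.

Lemma summable_sum (I : Type) (s : seq I) (p : pred I) (F : I -> T -> R) :
  (forall i, p i -> summable_rv (F i)) ->
  summable_rv (fun t => \sum_(i <- s | p i) F i t).
Proof.
move=> sF; elim: s => [|i s IH].
  by apply: eq_summable (summable_cst 0) => t; rewrite big_nil.
have [pi|pi] := boolP (p i).
  by apply: eq_summable (summableD (sF i pi) IH) => t; rewrite big_cons pi.
by apply: eq_summable IH => t; rewrite big_cons (negbTE pi).
Qed.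

Lemma Ex_sum (I : Type) (s : seq I) (p : pred I) (F : I -> T -> R) :
  (forall i, p i -> summable_rv (F i)) ->
  Ex (fun t => \sum_(i <- s | p i) F i t) = \sum_(i <- s | p i) Ex (F i).
Proof.
move=> sF; elim: s => [|i s IH].
  by rewrite big_nil -[RHS]Ex_cst; apply: eq_Ex => t; rewrite big_nil.
rewrite big_cons -IH; case: ifPn => pi.
  rewrite -ExD//; [|exact: sF|exact: summable_sum].
  by apply: eq_Ex => t; rewrite big_cons pi.
by apply: eq_Ex => t; rewrite big_cons (negbTE pi).
Qed.

Lemma bdd_cst a : bdd (fun=> a).
Proof. by split=> //; exists `|a|. Qed.

Lemma bddD f g : bdd f -> bdd g -> bdd (fun t => f t + g t).
Proof.
move=> [mf [M fM]] [mg [N gN]]; split; first exact: measurable_funD.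
by exists (M + N) => t; apply: le_trans (ler_normD _ _) _; exact: lerD.
Qed.

Lemma bddM f g : bdd f -> bdd g -> bdd (fun t => f t * g t).
Proof.
move=> [mf [M fM]] [mg [N gN]]; split; first exact: measurable_funM.
by exists (M * N) => t; rewrite normrM; apply: ler_pM.
Qed.

Lemma bddN f : bdd f -> bdd (fun t => - f t).
Proof.
move=> [mf [M fM]]; split; first exact: measurableT_comp.
by exists M => t; rewrite normrN.
Qed.

Lemma bddB f g : bdd f -> bdd g -> bdd (fun t => f t - g t).
Proof. by move=> bf /bddN; exact: bddD. Qed.

Lemma bddX n f : bdd f -> bdd (fun t => f t ^+ n).
Proof.
move=> bf; elim: n => [|n IH]; first exact: bdd_cst.
by under eq_fun do rewrite exprS; exact: bddM.
Qed.

Lemma bdd_norm f : bdd f -> bdd (fun t => `|f t|).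
Proof.
move=> [mf [M fM]]; split; first exact: measurableT_comp.
by exists M => t; rewrite normr_id.
Qed.

Lemma bdd_sum (I : Type) (s : seq I) (p : pred I) (F : I -> T -> R) :
  (forall i, p i -> bdd (F i)) -> bdd (fun t => \sum_(i <- s | p i) F i t).
Proof.
move=> sF; elim: s => [|i s IH].
  by under eq_fun do rewrite big_nil; exact: bdd_cst.
under eq_fun do rewrite big_cons.
by have [pi|pi] := boolP (p i) => //; apply: bddD => //; exact: sF.
Qed.

Lemma bdd_cos f : measurable_fun setT f -> bdd (fun t => cos (f t)).
Proof.
move=> mf; split.
  by apply: measurableT_comp => //; apply: continuous_measurable_fun; exact: continuous_cos.
by exists 1 => t; rewrite ler_norml cos_geN1 cos_le1.
Qed.

Lemma bdd_sin f : measurable_fun setT f -> bdd (fun t => sin (f t)).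
Proof.
move=> mf; split.
  by apply: measurableT_comp => //; apply: continuous_measurable_fun; exact: continuous_sin.
by exists 1 => t; rewrite ler_norml sin_geN1 sin_le1.
Qed.

Lemma bdd_measurable f : bdd f -> measurable_fun setT f.
Proof. by case. Qed.

Lemma bdd_L2 f : bdd f -> L2 f.
Proof. by move=> bf; split; [case: bf|exact/bdd_summable/bddX]. Qed.

Lemma L2_measurable f : L2 f -> measurable_fun setT f.
Proof. by case. Qed.

Lemma L2_sqr f : L2 f -> summable_rv (fun t => f t ^+ 2).
Proof. by case. Qed.

Lemma L2M f g : L2 f -> L2 g -> summable_rv (fun t => f t * g t).
Proof.
move=> [mf sf] [mg sg].
apply: (@le_summable _ (fun t => f t ^+ 2 + g t ^+ 2)); first exact: measurable_funM.
  exact: summableD.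
move=> t; rewrite normrM -(real_normK (num_real (f t))) -(real_normK (num_real (g t))).
by have := sqr_ge0 (`|f t| - `|g t|); nra.
Qed.

Lemma L2_summable f : L2 f -> summable_rv f.
Proof.
by move=> /L2M /(_ (bdd_L2 (bdd_cst 1))); apply: eq_summable => t; rewrite mulr1.
Qed.

Lemma L2Z a f : L2 f -> L2 (fun t => a * f t).
Proof.
move=> [mf sf]; split; first exact: measurable_funM.
by under [X in summable_rv X]eq_fun do rewrite exprMn; exact: summableZ.
Qed.

Lemma L2D f g : L2 f -> L2 g -> L2 (fun t => f t + g t).
Proof.
move=> Lf Lg; split.
  by apply: measurable_funD; exact: L2_measurable.
have : summable_rv (fun t => f t ^+ 2 + 2 * (f t * g t) + g t ^+ 2).
  apply: summableD; [apply: summableD|exact: L2_sqr]; first exact: L2_sqr.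
  exact/summableZ/L2M.
by apply: eq_summable => t; ring.
Qed.

Lemma L2N f : L2 f -> L2 (fun t => - f t).
Proof. by move=> /(L2Z (-1)); under [X in L2 X]eq_fun do rewrite mulN1r. Qed.

Lemma L2B f g : L2 f -> L2 g -> L2 (fun t => f t - g t).
Proof. by move=> Lf /L2N; exact: L2D. Qed.

Lemma L2_sum (I : Type) (s : seq I) (p : pred I) (F : I -> T -> R) :
  (forall i, p i -> L2 (F i)) -> L2 (fun t => \sum_(i <- s | p i) F i t).
Proof.
move=> sF; elim: s => [|i s IH].
  by under eq_fun do rewrite big_nil; exact/bdd_L2/bdd_cst.
under eq_fun do rewrite big_cons.
by have [pi|pi] := boolP (p i) => //; apply: L2D => //; exact: sF.
Qed.

(** Weighted arithmetic-geometric mean inequality, used in the role of Cauchy-Schwarz: callers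
    choose the weight [s], and no square root of an expectation appears. *)
Lemma Ex_normM_le s f g : 0 < s -> L2 f -> L2 g ->
  Ex (fun t => `|f t * g t|) <=
  (s * Ex (fun t => f t ^+ 2) + s^-1 * Ex (fun t => g t ^+ 2)) / 2.
Proof.
move=> s0 Lf Lg; have sf := L2_sqr Lf; have sg := L2_sqr Lg.
have -> : (s * Ex (fun t => f t ^+ 2) + s^-1 * Ex (fun t => g t ^+ 2)) / 2 =
    Ex (fun t => (s / 2) * f t ^+ 2 + (s^-1 / 2) * g t ^+ 2).
  by rewrite ExD ?ExZ//; [ring|exact: summableZ..].
apply: le_Ex; first exact/summable_norm/L2M.
  by apply: summableD; exact: summableZ.
move=> t; rewrite normrM -(real_normK (num_real (f t))) -(real_normK (num_real (g t))).
have := sqr_ge0 (s * `|f t| - `|g t|) => h.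
rewrite -(ler_pM2l s0).
have -> : s * (s / 2 * `|f t| ^+ 2 + s^-1 / 2 * `|g t| ^+ 2) =
  (s ^+ 2 * `|f t| ^+ 2 + `|g t| ^+ 2) / 2.
  by field; rewrite gt_eqF.
nra.
Qed.

Lemma Ex_indic (A : set T) : measurable A -> Ex (\1_A : T -> R) = fine (P A).
Proof. by move=> mA; rewrite /Ex /Rintegral integral_indic// setIT. Qed.

Lemma bdd_indic (A : set T) : measurable A -> bdd (\1_A : T -> R).
Proof.
move=> mA; split; first exact: measurable_indic.
by exists 1 => t; rewrite indicE; case: (_ \in _); rewrite ?normr1 ?normr0.
Qed.

End expectation.

(** * Random splittings and moment inequalities *)

Section sign_average.
Context (R : realType).
Implicit Types (F G : seq bool -> R) (y : nat -> R) (b : seq bool).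

(** Expectation over [n] independent fair coin flips. Recursion on the first flip allows proofs by
    conditioning on it, without a second probability space. *)
Fixpoint avg n F : R :=
  if n is m.+1 then
    (avg m (fun b => F (true :: b)) + avg m (fun b => F (false :: b))) / 2
  else F [::].

Lemma eq_avg n F G : F =1 G -> avg n F = avg n G.
Proof. by move=> /funext ->. Qed.

Lemma avgD n F G : avg n (fun b => F b + G b) = avg n F + avg n G.
Proof. by elim: n F G => //= n IH F G; rewrite !IH; field. Qed.

Lemma avgZ n a F : avg n (fun b => a * F b) = a * avg n F.
Proof. by elim: n F => //= n IH F; rewrite !IH; field. Qed.

Lemma avg_cst n a : avg n (fun=> a) = a.
Proof. by elim: n => //= n ->; field. Qed.

Lemma le_avg n F G : (forall b, F b <= G b) -> avg n F <= avg n G.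
Proof.
elim: n F G => //= n IH F G FG.
by rewrite ler_pM2r ?invr_gt0 ?ltr0n// lerD// IH.
Qed.

Lemma ler_norm_avg n F : `|avg n F| <= avg n (fun b => `|F b|).
Proof.
elim: n F => //= n IH F; rewrite normrM (@ger0_norm _ 2^-1) ?invr_ge0//.
rewrite ler_pM2r ?invr_gt0 ?ltr0n//.
by apply: le_trans (ler_normD _ _) _; exact: lerD.
Qed.

Lemma avg_sqr_le n F : avg n F ^+ 2 <= avg n (fun b => F b ^+ 2).
Proof.
elim: n F => //= n IH F.
have /= := IH (fun b => F (true :: b)); have /= := IH (fun b => F (false :: b)).
set x := avg _ _; set x2 := avg _ _; set z := avg _ _; set z2 := avg _ _.
by move=> h1 h2; have := sqr_ge0 (x - z); nra.
Qed.

Definition sgn (c : bool) : R := if c then 1 else -1.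

Definition signed_sum n y b := \sum_(j < n) sgn (nth false b j) * y j.

Definition on_sum n y b := \sum_(j < n | nth false b j) y j.

Definition off_sum n y b := \sum_(j < n | ~~ nth false b j) y j.

Lemma on_offD n y b : on_sum n y b + off_sum n y b = \sum_(j < n) y j.
Proof. by rewrite [RHS](bigID (fun j : 'I_n => nth false b j)). Qed.

Lemma on_offB n y b : on_sum n y b - off_sum n y b = signed_sum n y b.
Proof.
rewrite /signed_sum [RHS](bigID (fun j : 'I_n => nth false b j))/= -sumrN.
congr (_ + _); apply: eq_bigr => j bj; first by rewrite bj mul1r.
by rewrite (negbTE bj) mulN1r.
Qed.

Lemma signed_sum_cons n y c b :
  signed_sum n.+1 y (c :: b) = sgn c * y 0%N + signed_sum n (y \o S) b.
Proof. by rewrite /signed_sum big_ord_recl. Qed.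

Lemma avg_signed_sum2 n y :
  avg n (fun b => signed_sum n y b ^+ 2) = \sum_(j < n) y j ^+ 2.
Proof.
elim: n y => [|n IH] y; first by rewrite /signed_sum/= !big_ord0 expr0n.
rewrite /= big_ord_recl -(IH (y \o S)) -avgD.
transitivity (avg n (fun b => y 0%N ^+ 2 + signed_sum n (y \o S) b ^+ 2)).
  rewrite mulrC -avgZ; apply: eq_avg => b.
  by rewrite !signed_sum_cons /=; field.
by rewrite avgD avg_cst.
Qed.

(** Khintchine's inequality for exponent 4. Odd powers of the first sign cancel, and with [z] the
    first square and [q] the sum of the others the induction closes by
    [z ^ 2 + 6 z q + 3 q ^ 2 <= 3 (z + q) ^ 2]. *)
Lemma avg_signed_sum4 n y :
  avg n (fun b => signed_sum n y b ^+ 4) <= 3 * (\sum_(j < n) y j ^+ 2) ^+ 2.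
Proof.
elim: n y => [|n IH] y.
  by rewrite /signed_sum/= !big_ord0 !expr0n/= mulr0.
have -> : avg n.+1 (fun b => signed_sum n.+1 y b ^+ 4) =
    avg n (fun b => y 0%N ^+ 4 + (6 * y 0%N ^+ 2 * signed_sum n (y \o S) b ^+ 2
      + signed_sum n (y \o S) b ^+ 4)).
  rewrite /= -avgD mulrC -avgZ; apply: eq_avg => b.
  by rewrite !signed_sum_cons /=; field.
rewrite avgD avg_cst avgD avgZ avg_signed_sum2 big_ord_recl /=.
have /= := IH (y \o S).
set q := \sum_(i < n) _; set A := avg _ _ => h.
have q0 : 0 <= q by apply: sumr_ge0 => i _; exact: sqr_ge0.
have -> : y 0%N ^+ 4 = (y 0%N ^+ 2) ^+ 2 by rewrite -exprM.
have := sqr_ge0 (y 0%N); set z := y 0%N ^+ 2 => z0; nra.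
Qed.

Lemma avg_on_off n y : 4 * avg n (fun b => on_sum n y b * off_sum n y b) =
  (\sum_(j < n) y j) ^+ 2 - \sum_(j < n) y j ^+ 2.
Proof.
rewrite -avg_signed_sum2 -avgZ -(avg_cst n ((\sum_(j < n) y j) ^+ 2)).
rewrite -[in RHS]mulN1r -avgZ -avgD; apply: eq_avg => b.
by rewrite -(on_offD n y b) -on_offB; ring.
Qed.

Lemma avg_on_off2 n y :
  avg n (fun b => on_sum n y b ^+ 2 + off_sum n y b ^+ 2) =
  ((\sum_(j < n) y j) ^+ 2 + \sum_(j < n) y j ^+ 2) / 2.
Proof.
rewrite -avg_signed_sum2 -(avg_cst n ((\sum_(j < n) y j) ^+ 2)) -avgD mulrC -avgZ.
by apply: eq_avg => b; rewrite -(on_offD n y b) -on_offB; field.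
Qed.

(** With [D = U - V], the identity [8 (U ^ 4 + V ^ 4) = S ^ 4 + 6 S ^ 2 D ^ 2 + D ^ 4] is averaged.
    Splitting the middle term with weight [s] keeps the coefficient of [S ^ 4] close to 1, as the
    absorption of the fourth moment requires. *)
Lemma avg_on_off4 n y s : 0 < s ->
  8 * avg n (fun b => on_sum n y b ^+ 4 + off_sum n y b ^+ 4) <=
  (1 + s) * (\sum_(j < n) y j) ^+ 4 +
  (9 / s + 3) * (\sum_(j < n) y j ^+ 2) ^+ 2.
Proof.
move=> s0; have := avg_signed_sum4 n y; have := avg_signed_sum2 n y.
rewrite -avgZ.
set S := \sum_(j < n) y j; set q := \sum_(j < n) y j ^+ 2.
have -> : avg n (fun b => 8 * (on_sum n y b ^+ 4 + off_sum n y b ^+ 4)) =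
    avg n (fun b => S ^+ 4 + (6 * S ^+ 2 * signed_sum n y b ^+ 2 +
       signed_sum n y b ^+ 4)).
  by apply: eq_avg => b; rewrite /S -(on_offD n y b) -on_offB; ring.
rewrite avgD avg_cst avgD avgZ => -> h.
have h1 : 6 * S ^+ 2 * q <= s * S ^+ 4 + 9 / s * q ^+ 2.
  rewrite -(ler_pM2l s0).
  have -> : s * (s * S ^+ 4 + 9 / s * q ^+ 2) = s ^+ 2 * S ^+ 4 + 9 * q ^+ 2.
    by field; rewrite gt_eqF.
  by have := sqr_ge0 (s * S ^+ 2 - 3 * q); nra.
nra.
Qed.

End sign_average.

(** * Second and fourth moments from averaged splittings *)

Section moments.
Context (disp : measure_display) (T : measurableType disp) (R : realType).
Variable P : probability T R.
Implicit Types (Y : nat -> T -> R) (F : seq bool -> T -> R).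
Local Notation E := (Ex P).
Local Notation L1 := (summable_rv P).

Lemma summable_avg n F : (forall b, L1 (F b)) ->
  L1 (fun t => avg n (fun b => F b t)).
Proof.
elim: n F => [|n IH] F sF; first exact: sF.
rewrite /=; under [X in L1 X]eq_fun do rewrite mulrC.
apply: summableZ. apply: summableD; apply: IH => b; exact: sF.
Qed.

Lemma Ex_avg n F : (forall b, L1 (F b)) ->
  E (fun t => avg n (fun b => F b t)) = avg n (fun b => E (F b)).
Proof.
elim: n F => [|n IH] F sF //=.
rewrite -!IH// -ExD; [|exact: summable_avg..].
rewrite mulrC -ExZ; first by apply: eq_Ex => t; rewrite mulrC.
by apply: summableD; exact: summable_avg.
Qed.

Lemma L2_on n Y b : (forall j, L2 P (Y j)) ->
  L2 P (fun t => on_sum n (Y^~ t) b).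
Proof. by move=> LY; apply: L2_sum => i _; exact: LY. Qed.

Lemma L2_off n Y b : (forall j, L2 P (Y j)) ->
  L2 P (fun t => off_sum n (Y^~ t) b).
Proof. by move=> LY; apply: L2_sum => i _; exact: LY. Qed.

Section second_moment.
Context (r : R) (n : nat) (Y : nat -> T -> R).
Hypotheses (r1 : r < 1) (LY : forall j, L2 P (Y j)).
Let U b t := on_sum n (Y^~ t) b.
Let V b t := off_sum n (Y^~ t) b.
Let S t := \sum_(j < n) Y j t.
Hypothesis UV : forall b, `|E (fun t => U b t * V b t)| <=
  r / 2 * (E (fun t => U b t ^+ 2) + E (fun t => V b t ^+ 2)).
Let Q := \sum_(j < n) E (fun t => Y j t ^+ 2).

Let LU b : L2 P (U b). Proof. exact: L2_on. Qed.
Let LV b : L2 P (V b). Proof. exact: L2_off. Qed.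
Let LS : L2 P S. Proof. by apply: L2_sum => i _; exact: LY. Qed.

Let EQ : E (fun t => \sum_(j < n) Y j t ^+ 2) = Q.
Proof. by apply: Ex_sum => j _; exact: L2_sqr. Qed.

Let SQ : L1 (fun t => \sum_(j < n) Y j t ^+ 2).
Proof. by apply: summable_sum => j _; exact: L2_sqr. Qed.

(* Averaged over all splittings [S = U + V], [4 U V] gives [S^2 - q] and
   [2 (U^2 + V^2)] gives [S^2 + q], where [q] is the sum of squares. *)
Lemma second_moment_diff :
  `|E (fun t => S t ^+ 2) - Q| <= r * (E (fun t => S t ^+ 2) + Q).
Proof.
have -> : E (fun t => S t ^+ 2) - Q = 4 * avg n (fun b => E (fun t => U b t * V b t)).
  rewrite -EQ -Ex_avg; last by move=> b; exact: L2M.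
  rewrite -ExB//; last exact: L2_sqr.
  rewrite -ExZ; last by apply: summable_avg => b; exact: L2M.
  by apply: eq_Ex => t; rewrite avg_on_off.
have -> : E (fun t => S t ^+ 2) + Q =
    2 * avg n (fun b => E (fun t => U b t ^+ 2) + E (fun t => V b t ^+ 2)).
  transitivity (2 * avg n (fun b => E (fun t => U b t ^+ 2 + V b t ^+ 2))).
    rewrite -EQ -Ex_avg; last by move=> b; apply: summableD; exact: L2_sqr.
    rewrite -ExD//; last exact: L2_sqr.
    rewrite -ExZ; last first.
      by apply: summable_avg => b; apply: summableD; exact: L2_sqr.
    by apply: eq_Ex => t; rewrite avg_on_off2 -/(S t); field.
  by congr (2 * _); apply: eq_avg => b; rewrite ExD//; exact: L2_sqr.
rewrite normrM ger0_norm//.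
apply: le_trans (ler_wpM2l _ (ler_norm_avg _ _)) _ => //.
apply: le_trans (ler_wpM2l _ (le_avg n UV)) _ => //.
by rewrite avgZ; lra.
Qed.

Lemma second_moment_le :
  E (fun t => S t ^+ 2) <= (1 + r) / (1 - r) * Q.
Proof.
have r1' : 0 < 1 - r by rewrite subr_gt0.
rewrite mulrAC ler_pdivlMr//.
by have := second_moment_diff; rewrite ler_norml => /andP[_ h]; nra.
Qed.

Lemma second_moment_ge :
  Q <= (1 + r) / (1 - r) * E (fun t => S t ^+ 2).
Proof.
have r1' : 0 < 1 - r by rewrite subr_gt0.
rewrite mulrAC ler_pdivlMr//.
by have := second_moment_diff; rewrite ler_norml => /andP[h _]; nra.
Qed.

(** The cross term takes away at most a fraction [r], so [E S ^ 2 >= (1 - r) (E U ^ 2 + E V ^ 2)],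
    and [E S ^ 2] is already comparable with [Q]. The bound is uniform in the splitting. *)
Lemma on_off_moment_le b :
  E (fun t => U b t ^+ 2) + E (fun t => V b t ^+ 2) <=
  (1 + r) / (1 - r) ^+ 2 * Q.
Proof.
have r1' : 0 < 1 - r by rewrite subr_gt0.
have h := second_moment_le.
have hS : E (fun t => S t ^+ 2) = E (fun t => U b t ^+ 2) +
   E (fun t => V b t ^+ 2) + 2 * E (fun t => U b t * V b t).
  rewrite -ExZ; last exact: L2M.
  rewrite -ExD; [|exact: L2_sqr..]; rewrite -ExD; last 2 first.
  - by apply: summableD; exact: L2_sqr.
  - by apply: summableZ; exact: L2M.
  by apply: eq_Ex => t; rewrite /S -(on_offD n (Y^~ t) b) /U /V; ring.
have hUV : E (fun t => U b t ^+ 2) + E (fun t => V b t ^+ 2) <=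
    E (fun t => S t ^+ 2) / (1 - r).
  rewrite ler_pdivlMr// hS.
  by have := UV b; rewrite ler_norml => /andP[h1 _]; nra.
apply: le_trans hUV _; rewrite ler_pdivrMr//; apply: le_trans h _.
by rewrite le_eqVlt; apply/orP; left; apply/eqP; field; rewrite gt_eqF.
Qed.

End second_moment.

(* Writing [S^2 = q + 4 avg (U V)], the expectation of [16 (avg (U V))^2] is at
   most [r E S^4] up to an arbitrarily small multiple of [E S^4] and lower order
   terms; as [r < 1], the fourth moment can be absorbed on the left. *)
Lemma fourth_moment_le (r : R) : 0 <= r < 1 -> exists2 C : R, 0 <= C &
  forall n Y, (forall j, bdd (Y j)) ->
  (forall b, `|E (fun t => on_sum n (Y^~ t) b * off_sum n (Y^~ t) b)| <=
     r / 2 * (E (fun t => on_sum n (Y^~ t) b ^+ 2) +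
              E (fun t => off_sum n (Y^~ t) b ^+ 2))) ->
  (forall b, E (fun t => on_sum n (Y^~ t) b ^+ 2 * off_sum n (Y^~ t) b ^+ 2) <=
     E (fun t => on_sum n (Y^~ t) b ^+ 2) * E (fun t => off_sum n (Y^~ t) b ^+ 2)
     + r / 2 * (E (fun t => on_sum n (Y^~ t) b ^+ 4) +
                E (fun t => off_sum n (Y^~ t) b ^+ 4))) ->
  (forall b, E (fun t => on_sum n (fun j => Y j t ^+ 2) b *
                         off_sum n (fun j => Y j t ^+ 2) b) <=
     E (fun t => on_sum n (fun j => Y j t ^+ 2) b) *
     E (fun t => off_sum n (fun j => Y j t ^+ 2) b)
     + r / 2 * (E (fun t => on_sum n (fun j => Y j t ^+ 2) b ^+ 2) +
                E (fun t => off_sum n (fun j => Y j t ^+ 2) b ^+ 2))) ->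
  E (fun t => (\sum_(j < n) Y j t) ^+ 4) <=
  C * (\sum_(j < n) E (fun t => Y j t ^+ 4) +
       (\sum_(j < n) E (fun t => Y j t ^+ 2)) ^+ 2).
Proof.
move=> /andP[r0 r1]; have r1' : 0 < 1 - r by rewrite subr_gt0.
(* As [r = 1 - 4 s], one has [r (1 + s) ^ 2 <= 1 - 2 s]: a share [2 s] of the fourth moment survives
   the absorption. *)
pose s : R := (1 - r) / 4; have s0 : 0 < s by rewrite divr_gt0.
have s1 : s < 1 by rewrite /s; lra.
pose K : R := (1 + r) / (1 - r) ^+ 2.
(* [7 + 19 / s] bounds [(1 + 1 / s) + r (1 + s) (9 / s + 3)], the total coefficient of [E q ^ 2];
   [4 / (1 - r)] converts [E q ^ 2] into [f + Q ^ 2]; the term with [K] comes from the products of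
   second moments. *)
pose C : R := ((7 + 19 / s) * (4 / (1 - r)) + 8 * K ^+ 2) / (2 * s).
have si0 : 0 < s^-1 by rewrite invr_gt0.
have C0 : 0 <= C.
  rewrite /C divr_ge0 ?mulr_ge0//; last exact: ltW.
  have h : 0 <= 19 / s by rewrite mulr_ge0// ltW.
  have h' : 0 <= 4 / (1 - r) by rewrite divr_ge0// ltW.
  apply: addr_ge0; last by rewrite mulr_ge0// sqr_ge0.
  by apply: mulr_ge0 => //; exact: addr_ge0.
exists C => // n Y bY h1 h2 h3.
pose S t := \sum_(j < n) Y j t; pose q t := \sum_(j < n) Y j t ^+ 2.
pose U b t := on_sum n (Y^~ t) b; pose V b t := off_sum n (Y^~ t) b.
pose qU b t := on_sum n (fun j => Y j t ^+ 2) b.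
pose qV b t := off_sum n (fun j => Y j t ^+ 2) b.
have bU b : bdd (U b) by apply: bdd_sum => j _; exact: bY.
have bV b : bdd (V b) by apply: bdd_sum => j _; exact: bY.
have bqU b : bdd (qU b) by apply: bdd_sum => j _; exact/bddX/bY.
have bqV b : bdd (qV b) by apply: bdd_sum => j _; exact/bddX/bY.
have bS : bdd S by apply: bdd_sum => j _; exact: bY.
have bq : bdd q by apply: bdd_sum => j _; exact/bddX/bY.
set f := \sum_(j < n) E (fun t => Y j t ^+ 4).
set Q := \sum_(j < n) E (fun t => Y j t ^+ 2).
have f0 : 0 <= f.
  by apply: sumr_ge0 => j _; apply: Ex_ge0 => t; rewrite (exprM _ 2 2) sqr_ge0.
have Q0 : 0 <= Q by apply: sumr_ge0 => j _; apply: Ex_ge0 => t; exact: sqr_ge0.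
have EQ : E q = Q.
  by apply: Ex_sum => j _; exact/bdd_summable/bddX.
pose q2 := E (fun t => q t ^+ 2).
(* The splitting argument applied to the squares [Y j ^ 2]. They are nonnegative, so the product of
   the two partial means is at most [Q ^ 2], and [E q ^ 2] can be absorbed as [r < 1]. *)
have q2_le : (1 - r) * q2 <= 4 * (f + Q ^+ 2).
  have Ef : E (fun t => \sum_(j < n) (Y j t ^+ 2) ^+ 2) = f.
    rewrite Ex_sum; first by apply: eq_bigr => j _; apply: eq_Ex => t; rewrite -exprM.
    by move=> j _; exact/bdd_summable/bddX/bddX.
  have sf : summable_rv P (fun t => \sum_(j < n) (Y j t ^+ 2) ^+ 2).
    by apply: summable_sum => j _; exact/bdd_summable/bddX/bddX.
  have e1 : q2 - f = 4 * avg n (fun b => E (fun t => qU b t * qV b t)).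
    rewrite -Ef -Ex_avg; last by move=> b; by apply: bdd_summable; exact: bddM.
    rewrite -ExB//; last exact/bdd_summable/bddX.
    rewrite -ExZ; last by apply: summable_avg => b; by apply: bdd_summable; exact: bddM.
    by apply: eq_Ex => t; rewrite avg_on_off.
  have e2 : q2 + f =
      2 * avg n (fun b => E (fun t => qU b t ^+ 2) + E (fun t => qV b t ^+ 2)).
    transitivity (2 * avg n (fun b => E (fun t => qU b t ^+ 2 + qV b t ^+ 2))).
      rewrite -Ef -Ex_avg; last by move=> b; apply: bdd_summable; apply: bddD; exact: bddX.
      rewrite -ExD//; last exact/bdd_summable/bddX.
      rewrite -ExZ; last first.
        by apply: summable_avg => b; apply: bdd_summable; apply: bddD; exact: bddX.
      apply: eq_Ex => t; rewrite (avg_on_off2 n (fun j => Y j t ^+ 2)) -/(q t).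
      by field.
    by congr (2 * _); apply: eq_avg => b; rewrite ExD//; exact/bdd_summable/bddX.
  have e3 : avg n (fun b => E (fun t => qU b t * qV b t)) <=
      Q ^+ 2 + r / 2 * avg n (fun b => E (fun t => qU b t ^+ 2) + E (fun t => qV b t ^+ 2)).
    rewrite -avgZ -(avg_cst n (Q ^+ 2)) -avgD; apply: le_avg => b.
    apply: le_trans (h3 b) _; rewrite lerD2r.
    have hQ : E (qU b) + E (qV b) = Q.
      rewrite -ExD -?EQ; [|exact: bdd_summable..].
      by apply: eq_Ex => t; exact: on_offD.
    have u0 : 0 <= E (qU b).
      by apply: Ex_ge0 => t; apply: sumr_ge0 => j _; exact: sqr_ge0.
    have v0 : 0 <= E (qV b).
      by apply: Ex_ge0 => t; apply: sumr_ge0 => j _; exact: sqr_ge0.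
    rewrite -hQ -/(qU b) -/(qV b).
    change (E (qU b) * E (qV b) <= (E (qU b) + E (qV b)) ^+ 2).
    by nra.
  have : avg n (fun b => E (fun t => qU b t ^+ 2) + E (fun t => qV b t ^+ 2)) = (q2 + f) / 2.
    by rewrite e2; field.
  move=> e4; rewrite e4 in e3; have : q2 <= f + 4 * (Q ^+ 2 + r / 2 * ((q2 + f) / 2)).
    by rewrite -lerBlDl e1 ler_pM2l.
  by nra.
pose a := E (fun t => S t ^+ 4).
have q20 : 0 <= q2 by apply: Ex_ge0 => t; exact: sqr_ge0.
have a0 : 0 <= a by apply: Ex_ge0 => t; rewrite (exprM _ 2 2) sqr_ge0.
(* [S ^ 2 = q + 4 avg (U V)] is squared with weights [1 + 1 / s] and [1 + s], and Jensen's
   inequality moves the square inside the average. *)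
have step1 : a <= (1 + s^-1) * q2 +
    (1 + s) * 16 * avg n (fun b => E (fun t => U b t ^+ 2 * V b t ^+ 2)).
  rewrite -Ex_avg; last by move=> b; apply: bdd_summable; apply: bddM; exact: bddX.
  have sa : L1 (fun t => avg n (fun b => U b t ^+ 2 * V b t ^+ 2)).
    by apply: summable_avg => b; apply: bdd_summable; apply: bddM; exact: bddX.
  have sq : L1 (fun t => q t ^+ 2) by exact/bdd_summable/bddX.
  rewrite -ExZ// -ExZ// -ExD; [|exact: summableZ..].
  apply: le_Ex; first exact/bdd_summable/bddX.
    by apply: summableD; exact: summableZ.
  move=> t.
  have := avg_sqr_le n (fun b => U b t * V b t).
  have := avg_on_off n (Y^~ t); rewrite -/(S t) -/(q t) => e.
  under [X in _ <= avg _ X]eq_fun do rewrite exprMn.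
  set A := avg n (fun b => U b t * V b t) in e *; set B := avg _ _ => AB.
  have -> : S t ^+ 4 = (q t + 4 * A) ^+ 2.
    by rewrite /A /U /V e; ring.
  apply: (@le_trans _ _ ((1 + s^-1) * q t ^+ 2 + (1 + s) * 16 * A ^+ 2)); last first.
    by rewrite lerD2l ler_pM2l// mulr_gt0// addr_gt0.
  rewrite -(ler_pM2l s0).
  have -> : s * ((1 + s^-1) * q t ^+ 2 + (1 + s) * 16 * A ^+ 2) =
    (s + 1) * q t ^+ 2 + s * (1 + s) * 16 * A ^+ 2 by field; rewrite gt_eqF.
  by have := sqr_ge0 (q t - s * 4 * A); nra.
(* The product of two second moments is at most a quarter of the square of their sum, whence
   [K ^ 2 * Q ^ 2 / 4]. *)
have step2 : avg n (fun b => E (fun t => U b t ^+ 2 * V b t ^+ 2)) <=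
    K ^+ 2 * Q ^+ 2 / 4 + r / 2 * avg n (fun b => E (fun t => U b t ^+ 4 + V b t ^+ 4)).
  rewrite -avgZ -(avg_cst n (K ^+ 2 * Q ^+ 2 / 4)) -avgD; apply: le_avg => b.
  apply: le_trans (h2 b) _; rewrite ExD; [|exact/bdd_summable/bddX..].
  rewrite lerD2r.
  have := on_off_moment_le r1 (fun j => bdd_L2 P (bY j)) h1 b.
  rewrite -/K -/Q.
  have : 0 <= E (fun t => on_sum n (Y^~ t) b ^+ 2).
    by apply: Ex_ge0 => t; exact: sqr_ge0.
  have : 0 <= E (fun t => off_sum n (Y^~ t) b ^+ 2).
    by apply: Ex_ge0 => t; exact: sqr_ge0.
  set u := E _; set v := E _ => u0 v0 uv; rewrite -exprMn.
  have : (v + u) ^+ 2 <= (K * Q) ^+ 2.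
    by rewrite ler_sqr ?nnegrE ?addr_ge0//; apply: le_trans uv; rewrite addr_ge0.
  by have := sqr_ge0 (u - v); nra.
have step3 : 8 * avg n (fun b => E (fun t => U b t ^+ 4 + V b t ^+ 4)) <=
    (1 + s) * a + (9 / s + 3) * q2.
  have sUV b : L1 (fun t => U b t ^+ 4 + V b t ^+ 4).
    by apply: bdd_summable; apply: bddD; exact: bddX.
  rewrite -Ex_avg//.
  have sS : L1 (fun t => S t ^+ 4) by exact/bdd_summable/bddX.
  have sq : L1 (fun t => q t ^+ 2) by exact/bdd_summable/bddX.
  rewrite /a /q2 -!ExZ//; last exact: summable_avg.
  rewrite -ExD; [|exact: summableZ..].
  apply: le_Ex; first exact/summableZ/summable_avg.
    by apply: summableD; exact: summableZ.
  by move=> t; exact: avg_on_off4.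
have q2' : q2 <= 4 / (1 - r) * (f + Q ^+ 2).
  by rewrite mulrAC ler_pdivlMr// mulrC.
rewrite /C mulrAC ler_pdivlMr ?mulr_gt0//.
move: step1 step2 step3; rewrite /a -/(S _).
rewrite -[E _]/a.
set A := avg _ _; set B := avg _ _ => step1 step2 step3.
have r1e : r = 1 - 4 * s by rewrite /s; lra.
have {}step1 : a <= (1 + s^-1) * q2 + (1 + s) * (4 * (K ^+ 2 * Q ^+ 2) +
    r * ((1 + s) * a + (9 * s^-1 + 3) * q2)).
  apply: le_trans step1 _; rewrite lerD2l -mulrA ler_pM2l ?addr_gt0//.
  have : r * (8 * B) <= r * ((1 + s) * a + (9 / s + 3) * q2) by exact: ler_wpM2l.
  by move: step2; lra.
have e5 : r * (1 + s) ^+ 2 <= 1 - 2 * s by rewrite r1e; nra.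
have e6 : a * (r * (1 + s) ^+ 2) <= a * (1 - 2 * s) by exact: ler_wpM2l.
have r2 : (1 + s) * r <= 2 by nra.
have e7 : (1 + s) * r * ((9 * s^-1 + 3) * q2) <= 2 * ((9 * s^-1 + 3) * q2).
  by apply: ler_wpM2r => //; rewrite mulr_ge0// addr_ge0// mulr_ge0// ltW.
have KQ0 : 0 <= K ^+ 2 * Q ^+ 2 by rewrite mulr_ge0 ?sqr_ge0.
have e8 : (1 + s) * (4 * (K ^+ 2 * Q ^+ 2)) <= 8 * (K ^+ 2 * Q ^+ 2) by nra.
have e9 : 2 * s * a <= (7 + 19 * s^-1) * q2 + 8 * (K ^+ 2 * Q ^+ 2).
  by move: step1 e6 e7 e8; clear; nra.
have e10 : (7 + 19 * s^-1) * q2 <= (7 + 19 * s^-1) * (4 / (1 - r) * (f + Q ^+ 2)).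
  by apply: ler_wpM2l => //; rewrite addr_ge0// mulr_ge0// ltW.
have e11 : K ^+ 2 * Q ^+ 2 <= K ^+ 2 * (f + Q ^+ 2).
  by apply: ler_wpM2l; [exact: sqr_ge0|rewrite lerDr].
by move: e9 e10 e11; clear; lra.
Qed.

End moments.

(** * Covariance of bounded variables under strong mixing *)

Section measurability.
Context (disp : measure_display) (T : measurableType disp) (R : realType).
Implicit Types (G : set (set T)) (f g : T -> R).

(** Going through [g_sigma_algebraType] makes the closure properties of sub-sigma-field
    measurability instances of those of [measurable_fun]. *)
Definition msr G f := measurable_fun
  (setT : set (g_sigma_algebraType G)) (f : g_sigma_algebraType G -> R).

Lemma msr_preimage G f (B : set R) : msr G f -> measurable B ->
  <<s G >> (f @^-1` B).
Proof. by move=> mf mB; have := mf measurableT B mB; rewrite setTI. Qed.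

Lemma preimage_msr G f :
  (forall B : set R, measurable B -> <<s G >> (f @^-1` B)) -> msr G f.
Proof. by move=> h _ B mB; rewrite setTI; exact: h. Qed.

Lemma sub_msr G H f : G `<=` H -> msr G f -> msr H f.
Proof.
move=> GH mf; apply: preimage_msr => B mB.
by apply: (@sub_sigma_algebra2 _ setT H) (msr_preimage mf mB).
Qed.

Lemma msr_measurable G f : G `<=` measurable -> msr G f ->
  measurable_fun setT f.
Proof.
move=> GM mf _ B mB; rewrite setTI.
have := msr_preimage mf mB.
by apply: smallest_sub => //; exact: sigma_algebra_measurable.
Qed.

Lemma msr_cst G a : msr G (fun=> a).
Proof. exact: measurable_cst. Qed.

Lemma msrD G f g : msr G f -> msr G g -> msr G (fun t => f t + g t).
Proof. by move=> mf mg; exact: measurable_funD mf mg. Qed.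

Lemma msrM G f g : msr G f -> msr G g -> msr G (fun t => f t * g t).
Proof. by move=> mf mg; exact: measurable_funM mf mg. Qed.

Lemma msr_comp G f (h : R -> R) : measurable_fun setT h -> msr G f ->
  msr G (fun t => h (f t)).
Proof. by move=> mh mf; exact: measurableT_comp mh mf. Qed.

Lemma msrX G f n : msr G f -> msr G (fun t => f t ^+ n).
Proof. by apply: (@msr_comp G f (fun x => x ^+ n)); exact: exprn_measurable. Qed.

Lemma msr_sum G (I : Type) (s : seq I) (p : pred I) (F : I -> T -> R) :
  (forall i, p i -> msr G (F i)) ->
  msr G (fun t => \sum_(i <- s | p i) F i t).
Proof.
move=> mF; elim: s => [|i s IH].
  by under eq_fun do rewrite big_nil; exact: msr_cst.
under eq_fun do rewrite big_cons.
by have [pi|pi] := boolP (p i) => //; apply: msrD => //; exact: mF.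
Qed.

End measurability.

Section alpha_covariance.
Context (disp : measure_display) (T : measurableType disp) (R : realType).
Variable P : probability T R.
Implicit Types (G H : set (set T)) (f g : T -> R).
Local Notation E := (Ex P).

(* Lower approximation of a [0, 1]-valued [f] by an average of indicators. *)
Definition staircase (N : nat) f t : R :=
  \sum_(i < N) N%:R^-1 * \1_[set u | i.+1%:R <= N%:R * f u] t.

(** The sum counts the integers between 1 and [N] that are at most [y], so it is the integer part of
    [y]. *)
Lemma staircase_count (N : nat) (y : R) : 0 <= y <= N%:R ->
  y - 1 <= \sum_(i < N) (i.+1%:R <= y)%R%:R <= y.
Proof.
elim: N => [|N IH] /andP[y0 yN].
  rewrite big_ord0 y0 andbT.
  by rewrite (le_trans (_ : _ <= y))// ?gerBl//; lra.
rewrite big_ord_recr/=.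
have [yN'|Ny] := lerP y N%:R.
  have -> : (N.+1%:R <= y) = false.
    by apply/negbTE; rewrite -ltNge (le_lt_trans yN')// ltr_nat.
  by rewrite addr0; apply: IH; rewrite y0.
have -> : \sum_(i < N) (i.+1%:R <= y)%R%:R = N%:R :> R.
  rewrite (eq_bigr (fun=> 1)); first by rewrite sumr_const card_ord.
  move=> i _; have -> : i.+1%:R <= y => //.
  by rewrite (le_trans _ (ltW Ny))// ler_nat.
move: yN; rewrite -natr1 => yN.
have [h|h] := lerP (N%:R + 1) y; rewrite /=; apply/andP; split; lra.
Qed.

Lemma staircase_bound (N : nat) f t : (0 < N)%N -> 0 <= f t <= 1 ->
  `|f t - staircase N f t| <= N%:R^-1 /\ 0 <= staircase N f t <= 1.
Proof.
move=> N0 /andP[f0 f1].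
have n0 : (0 : R) < N%:R by rewrite ltr0n.
have -> : staircase N f t =
    N%:R^-1 * \sum_(i < N) (i.+1%:R <= N%:R * f t)%R%:R.
  rewrite /staircase mulr_sumr; apply: eq_bigr => i _.
  by rewrite indicE; congr (_ * (nat_of_bool _)%:R); apply/idP/idP; rewrite inE.
have /staircase_count : 0 <= N%:R * f t <= N%:R.
  by rewrite mulr_ge0 ?ler_piMr// ltW.
set c := \sum_(i < N) _ => /andP[h1 h2].
have c0 : 0 <= c by apply: sumr_ge0 => i _; exact: ler0n.
have e : f t = N%:R^-1 * (N%:R * f t) by rewrite mulKf// gt_eqF.
have ni0 : (0 : R) < N%:R^-1 by rewrite invr_gt0.
have h3 : N%:R^-1 * c <= f t by rewrite [leRHS]e ler_pM2l.
have h4 : f t - N%:R^-1 <= N%:R^-1 * c.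
  by rewrite [X in X - _]e -[X in _ - X]mulr1 -mulrBr ler_pM2l.
split; last by rewrite (le_trans h3 f1) andbT mulr_ge0// ltW.
by rewrite ger0_norm ?subr_ge0// lerBlDr -lerBlDl.
Qed.

Section covariance_bound.
Context (G H : set (set T)) (a : R).
Hypotheses (GM : G `<=` measurable) (HM : H `<=` measurable).
Hypothesis GH : forall A B, <<s G >> A -> <<s H >> B ->
  `|fine (P (A `&` B)) - fine (P A) * fine (P B)| <= a.

(** The covariance is bilinear: for the staircases it is a sum of [N ^ 2] covariances of level sets,
    each of weight [N ^ -2] and at most [a]. Replacing [f] and [g] by their staircases costs [2 / N]
    in the product and [1 / N] in each mean, and [N] is arbitrary. *)
Lemma cov_unit_le f g : msr G f -> msr H g ->
  (forall t, 0 <= f t <= 1) -> (forall t, 0 <= g t <= 1) ->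
  `|E (fun t => f t * g t) - E f * E g| <= a.
Proof.
move=> mf mg f01 g01.
have bf : bdd f.
  split; first exact: msr_measurable GM mf.
  by exists 1 => t; have /andP[f0 f1] := f01 t; rewrite ger0_norm.
have bg : bdd g.
  split; first exact: msr_measurable HM mg.
  by exists 1 => t; have /andP[f0 f1] := g01 t; rewrite ger0_norm.
have sA N i : <<s G >> [set u | i.+1%:R <= N%:R * f u].
  have -> : [set u | i.+1%:R <= N%:R * f u] =
     (fun u => N%:R * f u) @^-1` `[i.+1%:R, +oo[.
    by apply/seteqP; split => u /=; rewrite in_itv/= andbT.
  by apply: msr_preimage => //; apply: msrM => //; exact: msr_cst.
have sB N i : <<s H >> [set u | i.+1%:R <= N%:R * g u].
  have -> : [set u | i.+1%:R <= N%:R * g u] =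
     (fun u => N%:R * g u) @^-1` `[i.+1%:R, +oo[.
    by apply/seteqP; split => u /=; rewrite in_itv/= andbT.
  by apply: msr_preimage => //; apply: msrM => //; exact: msr_cst.
have GmT A : <<s G >> A -> measurable A.
  by apply: smallest_sub => //; exact: sigma_algebra_measurable.
have HmT A : <<s H >> A -> measurable A.
  by apply: smallest_sub => //; exact: sigma_algebra_measurable.
have bfN N : bdd (staircase N f).
  apply: bdd_sum => i _; apply: bddM; first exact: bdd_cst.
  exact: (bdd_indic R (GmT _ (sA N i))).
have bgN N : bdd (staircase N g).
  apply: bdd_sum => i _; apply: bddM; first exact: bdd_cst.
  exact: (bdd_indic R (HmT _ (sB N i))).
have step N : (0 < N)%N -> `|E (fun t => staircase N f t * staircase N g t) -
    E (staircase N f) * E (staircase N g)| <= a.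
  move=> N0; have n0 : (0 : R) < N%:R by rewrite ltr0n.
  pose F i : T -> R := \1_[set u | i.+1%:R <= N%:R * f u].
  pose K i : T -> R := \1_[set u | i.+1%:R <= N%:R * g u].
  have bF i : bdd (F i) by exact: (bdd_indic R (GmT _ (sA N i))).
  have bK i : bdd (K i) by exact: (bdd_indic R (HmT _ (sB N i))).
  have -> : E (staircase N f) = \sum_(i < N) N%:R^-1 * E (F i).
    rewrite Ex_sum; last first.
      by move=> i _; exact: (summableZ _ (bdd_summable P (bF i))).
    by apply: eq_bigr => i _; rewrite -ExZ//; exact: (bdd_summable P (bF i)).
  have -> : E (staircase N g) = \sum_(i < N) N%:R^-1 * E (K i).
    rewrite Ex_sum; last first.
      by move=> i _; exact: (summableZ _ (bdd_summable P (bK i))).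
    by apply: eq_bigr => i _; rewrite -ExZ//; exact: (bdd_summable P (bK i)).
  have bFK i j : summable_rv P (fun t => F i t * K j t).
    by apply: bdd_summable; exact: bddM.
  have -> : E (fun t => staircase N f t * staircase N g t) =
     \sum_(i < N) \sum_(j < N) N%:R^-1 ^+ 2 * E (fun t => F i t * K j t).
    transitivity (\sum_(i < N) E (fun t => \sum_(j < N) N%:R^-1 ^+ 2 * (F i t * K j t))).
      rewrite -Ex_sum; last first.
        by move=> i _; apply: summable_sum => j _; exact: summableZ.
      apply: eq_Ex => t; rewrite mulr_suml; apply: eq_bigr => i _.
      by rewrite mulr_sumr; apply: eq_bigr => j _; rewrite /F /K; ring.
    apply: eq_bigr => i _; rewrite Ex_sum; last by move=> j _; exact: summableZ.
    by apply: eq_bigr => j _; rewrite ExZ.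
  rewrite mulr_suml -sumrB.
  apply: le_trans (ler_norm_sum _ _ _) _.
  apply: (@le_trans _ _ (\sum_(i < N) N%:R^-1 * a)); last first.
    by rewrite sumr_const card_ord -[leLHS]mulr_natr mulrAC mulVf ?mul1r// gt_eqF.
  apply: ler_sum => i _; rewrite mulr_sumr -sumrB.
  apply: le_trans (ler_norm_sum _ _ _) _.
  apply: (@le_trans _ _ (\sum_(j < N) N%:R^-1 ^+ 2 * a)); last first.
    rewrite sumr_const card_ord -[leLHS]mulr_natr mulrAC expr2.
    by rewrite -(mulrA _ _ N%:R) mulVf ?mulr1// gt_eqF.
  apply: ler_sum => j _.
  have -> : N%:R^-1 ^+ 2 * E (fun t => F i t * K j t) -
      N%:R^-1 * E (F i) * (N%:R^-1 * E (K j)) =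
    N%:R^-1 ^+ 2 * (E (fun t => F i t * K j t) - E (F i) * E (K j)) by ring.
  rewrite normrM ger0_norm ?exprn_ge0 ?invr_ge0//.
  rewrite ler_pM2l ?exprn_gt0 ?invr_gt0//.
  have -> : E (fun t => F i t * K j t) = fine (P ([set u | i.+1%:R <= N%:R * f u] `&`
       [set u | j.+1%:R <= N%:R * g u])).
    rewrite -Ex_indic; last by apply: measurableI; [exact: GmT|exact: HmT].
    by rewrite indicI.
  rewrite Ex_indic; last exact: GmT.
  by rewrite Ex_indic; [exact: GH|exact: HmT].
have lim N : (0 < N)%N -> `|E (fun t => f t * g t) - E f * E g| <= a + 4 / N%:R.
  move=> N0; have := step _ N0.
  have hf t := staircase_bound N0 (f01 t); have hg t := staircase_bound N0 (g01 t).
  have sN := summable_cst P (N%:R^-1).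
  have h1 : `|E (fun t => f t * g t) - E (fun t => staircase N f t * staircase N g t)|
      <= 2 / N%:R.
    have b1 := bddM bf bg; have b2 := bddM (bfN N) (bgN N).
    rewrite -ExB; [|exact: bdd_summable..]; rewrite -(Ex_cst P (2 / N%:R)).
    apply: le_norm_Ex; [exact: (bdd_summable P (bddB b1 b2))|exact: summable_cst|].
    move=> t; have [d1 /andP[s0 s1]] := hf t; have [d2 /andP[s2 s3]] := hg t.
    have /andP[f0 f1] := f01 t; have /andP[g0 g1] := g01 t.
    have -> : f t * g t - staircase N f t * staircase N g t =
      (f t - staircase N f t) * g t + staircase N f t * (g t - staircase N g t).
      by ring.
    apply: le_trans (ler_normD _ _) _; rewrite !normrM.
    rewrite (ger0_norm g0) (ger0_norm s0).
    have := normr_ge0 (f t - staircase N f t).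
    have := normr_ge0 (g t - staircase N g t).
    by nra.
  have h2 : `|E f - E (staircase N f)| <= N%:R^-1.
    rewrite -ExB; [|exact: bdd_summable..]; rewrite -(Ex_cst P (N%:R^-1)).
    apply: le_norm_Ex; [exact: (bdd_summable P (bddB bf (bfN N)))|exact: summable_cst|].
    by move=> t; case: (hf t).
  have h3 : `|E g - E (staircase N g)| <= N%:R^-1.
    rewrite -ExB; [|exact: bdd_summable..]; rewrite -(Ex_cst P (N%:R^-1)).
    apply: le_norm_Ex; [exact: (bdd_summable P (bddB bg (bgN N)))|exact: summable_cst|].
    by move=> t; case: (hg t).
  have Eg0 : 0 <= E g by apply: Ex_ge0 => t; case/andP: (g01 t).
  have Eg1 : E g <= 1.
    rewrite -(Ex_cst P 1); apply: le_Ex; [exact: bdd_summable|exact: summable_cst|].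
    by move=> t; case/andP: (g01 t).
  have Ef0 : 0 <= E (staircase N f) by apply: Ex_ge0 => t; case: (hf t) => _ /andP[].
  have Ef1 : E (staircase N f) <= 1.
    rewrite -(Ex_cst P 1); apply: le_Ex; [exact: bdd_summable|exact: summable_cst|].
    by move=> t; case: (hf t) => _ /andP[].
  move: h1 h2 h3; set x := E _; set x' := E _; set y := E f; set y' := E _ in Ef0 Ef1 *.
  set z := E g in Eg0 Eg1 *; set z' := E _; set w := N%:R^-1.
  rewrite !ler_norml => /andP[p1 p2] /andP[q1 q2] /andP[r1 r2] /andP[s1 s2].
  apply/andP; split; nra.
apply/ler_addgt0Pr => e e0.
have [N N0 Ne] : exists2 N, (0 < N)%N & 4 / N%:R <= e.
  exists (Num.bound (4 / e)).+1 => //.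
  rewrite ler_pdivrMr ?ltr0n// mulrC -ler_pdivrMr//.
  have := archi_boundP (ltW (divr_gt0 (ltr0n R 4) e0)).
  by move=> /ltW h; apply: le_trans h _; rewrite ler_nat.
by apply: le_trans (lim _ N0) _; rewrite lerD2l.
Qed.

(** Mapping [[-1, 1]] affinely onto [[0, 1]] halves both functions and divides the covariance by
    4. *)
Lemma cov_bounded_le f g : msr G f -> msr H g ->
  (forall t, `|f t| <= 1) -> (forall t, `|g t| <= 1) ->
  `|E (fun t => f t * g t) - E f * E g| <= 4 * a.
Proof.
move=> mf mg f1 g1.
have sf : bdd f by split; [exact: msr_measurable GM mf|exists 1].
have sg : bdd g by split; [exact: msr_measurable HM mg|exists 1].
pose f' t := 2^-1 * f t + 2^-1; pose g' t := 2^-1 * g t + 2^-1.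
have h01 (x : R) : `|x| <= 1 -> 0 <= 2^-1 * x + 2^-1 <= 1.
  by rewrite ler_norml => /andP[? ?]; apply/andP; split; lra.
have mf' : msr G f'.
  by apply: msrD; [apply: msrM => //|]; exact: msr_cst.
have mg' : msr H g'.
  by apply: msrD; [apply: msrM => //|]; exact: msr_cst.
have := @cov_unit_le f' g' mf' mg' (fun t => h01 _ (f1 t)) (fun t => h01 _ (g1 t)).
have s1 := summable_cst P (2^-1 : R).
have Ef : E f' = 2^-1 * E f + 2^-1.
  rewrite ExD ?Ex_cst ?ExZ//; first exact: bdd_summable.
  exact/summableZ/bdd_summable.
have Eg : E g' = 2^-1 * E g + 2^-1.
  rewrite ExD ?Ex_cst ?ExZ//; first exact: bdd_summable.
  exact/summableZ/bdd_summable.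
have sfg := bdd_summable P (bddM sf sg).
have Efg : E (fun t => f' t * g' t) =
    4^-1 * E (fun t => f t * g t) + (4^-1 * E f + (4^-1 * E g + 4^-1)).
  have e4 := summable_cst P (4^-1 : R).
  have f4 := summableZ 4^-1 (bdd_summable P sf).
  have g4 := summableZ 4^-1 (bdd_summable P sg).
  have fg4 := summableZ 4^-1 sfg.
  rewrite -!ExZ//; [|exact: bdd_summable..].
  rewrite -[X in _ + (_ + (_ + X))](Ex_cst P).
  rewrite -(ExD g4 e4) -(ExD f4 (summableD g4 e4)).
  rewrite -(ExD fg4 (summableD f4 (summableD g4 e4))).
  by apply: eq_Ex => t; rewrite /f' /g'; field.
rewrite Ef Eg Efg !ler_norml => /andP[h1 h2]; apply/andP; split; nra.
Qed.

End covariance_bound.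

End alpha_covariance.

(** * Moments of sums over a random field *)

(* [B n] enumerates the index set of the [n]-th field, whose coordinates lie in
   [[0, Nb n[], and [G n Q] generates the sigma-field of the sites in [Q]. *)
Record field_system (disp : measure_display) (T : measurableType disp)
    (R : realType) (P : probability T R) (d : nat) (r : R)
    (B : nat -> seq (lattice d)) (Nb : nat -> nat)
    (G : nat -> set (lattice d) -> set (set T)) : Prop := FieldSystem {
  fs_rho_ge0 : 0 <= r;
  fs_rho_lt1 : r < 1;
  fs_uniq : forall n, uniq (B n);
  fs_bound : forall n k, k \in B n -> forall u, 0 <= k u < (Nb n)%:Z;
  fs_measurable : forall n Q, G n Q `<=` measurable;
  fs_mono : forall n Q Q', Q `<=` Q' -> G n Q `<=` G n Q';
  fs_rho : forall n (u : 'I_d) (A : set int) (f g : T -> R),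
    L2 P f -> L2 P g ->
    msr (G n [set k | k \in B n /\ A (k u)]) f ->
    msr (G n [set k | k \in B n /\ ~ A (k u)]) g ->
    `|Ex P (fun t => f t * g t) - Ex P f * Ex P g| <=
      r / 2 * (Ex P (fun t => f t ^+ 2) + Ex P (fun t => g t ^+ 2));
  fs_alpha : forall e : R, 0 < e -> exists2 m : nat, (0 < m)%N &
    forall n (u : 'I_d) (j : int) (E F : set T),
    <<s G n [set k | k u <= j] >> E -> <<s G n [set k | j + m%:Z <= k u] >> F ->
    `|fine (P (E `&` F)) - fine (P E) * fine (P F)| <= e }.

Section field_moments.
Context (disp : measure_display) (T : measurableType disp) (R : realType).
Context (P : probability T R) (d : nat) (r : R).
Context (B : nat -> seq (lattice d)) (Nb : nat -> nat).
Context (G : nat -> set (lattice d) -> set (set T)).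
Hypothesis fs : field_system P r B Nb G.
Implicit Types (Y : lattice d -> T -> R) (p : pred (lattice d)).
Local Notation E := (Ex P).

Definition fsum n Y p t := \sum_(k <- B n | p k) Y k t.

Definition mass n Y p := \sum_(k <- B n | p k) E (fun t => Y k t ^+ 2).

Definition adapted n Y := forall k, msr (G n [set k]) (Y k).

Definition centered Y := forall k, E (Y k) = 0.

Lemma sum_slices (V : nmodType) n (u : 'I_d) p (F : lattice d -> V) :
  \sum_(k <- B n | p k) F k =
  \sum_(j < Nb n) \sum_(k <- B n | p k && (k u == (j : nat)%:Z)) F k.
Proof.
under [RHS]eq_bigr do rewrite big_mkcondr.
rewrite exchange_big /= big_seq_cond [RHS]big_seq_cond.
apply: eq_bigr => k /andP[kB _].
have /andP[k0 kN] := fs_bound fs kB u.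
have kN' : (`|k u| < Nb n)%N by rewrite -ltz_nat gez0_abs.
rewrite (bigD1 (Ordinal kN'))//= gez0_abs// eqxx big1 ?addr0// => j jk.
rewrite ifF//; apply: contraNF jk => /eqP kj.
by apply/eqP/val_inj; rewrite /= kj absz_nat.
Qed.

Lemma fsum_slices n Y (u : 'I_d) p t :
  fsum n Y p t = \sum_(j < Nb n) fsum n Y (fun k => p k && (k u == (j : nat)%:Z)) t.
Proof. exact: sum_slices. Qed.

Lemma mass_ge0 n Y p : 0 <= mass n Y p.
Proof. by apply: sumr_ge0 => k _; apply: Ex_ge0 => t; exact: sqr_ge0. Qed.

Lemma fsum_msr n Y p (Q : set (lattice d)) : adapted n Y ->
  (forall k, k \in B n -> p k -> Q k) -> msr (G n Q) (fsum n Y p).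
Proof.
move=> aY pQ; rewrite /fsum; under eq_fun do rewrite big_seq_cond.
apply: msr_sum => k /andP[kB pk].
by apply: sub_msr (aY k); apply: (fs_mono fs) => _ ->; exact: pQ.
Qed.

Lemma fsum_L2 n Y p : (forall k, L2 P (Y k)) -> L2 P (fsum n Y p).
Proof. by move=> LY; apply: L2_sum => k _; exact: LY. Qed.

Lemma fsum_bdd n Y p : (forall k, bdd (Y k)) -> bdd (fsum n Y p).
Proof. by move=> LY; apply: bdd_sum => k _; exact: LY. Qed.

Lemma fsum_centered n Y p : (forall k, L2 P (Y k)) -> centered Y ->
  E (fsum n Y p) = 0.
Proof.
move=> LY cY; rewrite Ex_sum; last by move=> k _; exact: L2_summable.
by rewrite big1.
Qed.

Let D : R := (1 + r) / (1 - r).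

Let D1 : 1 <= D.
Proof.
have := fs_rho_ge0 fs; have := fs_rho_lt1 fs => r1 r0.
by rewrite ler_pdivlMr ?mul1r; lra.
Qed.

Section slices.
Context (n : nat) (u : 'I_d) (p : pred (lattice d)) (Y : lattice d -> T -> R).
Hypotheses (aY : adapted n Y) (LY : forall k, L2 P (Y k)) (cY : centered Y).
Let y (j : nat) := fsum n Y (fun k => p k && (k u == j%:Z)).
(** The coordinate values that the coin flips [b] select. The absolute value is harmless, since
    coordinates of sites in [B n] are nonnegative. *)
Let A b : set int := [set a | nth false b `|a|%N].

Let y_on b (j : nat) : nth false b j ->
  msr (G n [set k | k \in B n /\ A b (k u)]) (y j).
Proof.
move=> bj; apply: fsum_msr => // k kB /andP[_ /eqP kj]; split => //.
by rewrite /A /= kj absz_nat.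
Qed.

Let y_off b (j : nat) : ~~ nth false b j ->
  msr (G n [set k | k \in B n /\ ~ A b (k u)]) (y j).
Proof.
move=> bj; apply: fsum_msr => // k kB /andP[_ /eqP kj]; split => //.
by rewrite /A /= kj absz_nat; exact/negP.
Qed.

Let msr_on b (h : nat -> T -> R) (m : nat) :
  (forall j, nth false b j -> msr (G n [set k | k \in B n /\ A b (k u)]) (h j)) ->
  msr (G n [set k | k \in B n /\ A b (k u)]) (fun t => on_sum m (h^~ t) b).
Proof. by move=> mh; apply: msr_sum => j bj; exact: mh. Qed.

Let msr_off b (h : nat -> T -> R) (m : nat) :
  (forall j, ~~ nth false b j ->
     msr (G n [set k | k \in B n /\ ~ A b (k u)]) (h j)) ->
  msr (G n [set k | k \in B n /\ ~ A b (k u)]) (fun t => off_sum m (h^~ t) b).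
Proof. by move=> mh; apply: msr_sum => j bj; exact: mh. Qed.

Let Ly j : L2 P (y j). Proof. exact: fsum_L2. Qed.

Let on_centered b : E (fun t => on_sum (Nb n) (y^~ t) b) = 0.
Proof.
rewrite Ex_sum; last by move=> j _; exact: L2_summable.
by rewrite big1// => j _; exact: fsum_centered.
Qed.

(** Centring removes the product of the means. The two classes of slices may be adjacent, which is
    why the correlation must be below 1 already at distance 1. *)
Lemma slices_cov b :
  `|E (fun t => on_sum (Nb n) (y^~ t) b * off_sum (Nb n) (y^~ t) b)| <=
     r / 2 * (E (fun t => on_sum (Nb n) (y^~ t) b ^+ 2) +
              E (fun t => off_sum (Nb n) (y^~ t) b ^+ 2)).
Proof.
rewrite -[X in `|X|]subr0 -[X in _ - X](mul0r (E (fun t => off_sum (Nb n) (y^~ t) b))).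
rewrite -{1}(on_centered b).
apply: (fs_rho fs (u := u) (A := A b)); [exact: L2_on|exact: L2_off| |].
- by apply: (@msr_on _ y) => j; exact: y_on.
- by apply: (@msr_off _ y) => j; exact: y_off.
Qed.

Lemma slices_second : E (fun t => fsum n Y p t ^+ 2) <=
     D * \sum_(j < Nb n) E (fun t => y j t ^+ 2) /\
  \sum_(j < Nb n) E (fun t => y j t ^+ 2) <= D * E (fun t => fsum n Y p t ^+ 2).
Proof.
have r1 := fs_rho_lt1 fs.
have e : E (fun t => fsum n Y p t ^+ 2) = E (fun t => (\sum_(j < Nb n) y j t) ^+ 2).
  by apply: eq_Ex => t; rewrite (fsum_slices _ _ u).
rewrite e; split; first exact: second_moment_le r1 Ly slices_cov.
exact: second_moment_ge r1 Ly slices_cov.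
Qed.

Hypothesis bY : forall k, bdd (Y k).

Let bdd_y j : bdd (y j). Proof. exact: fsum_bdd. Qed.

Let covle (x z w : R) : `|x - z| <= w -> x <= z + w.
Proof. by rewrite ler_norml => /andP[_ h]; rewrite -lerBlDl. Qed.

(** Maximal correlation bounds all square-integrable functions of the two blocks, here the squares
    of the block sums. Their means do not vanish, so the product term remains. *)
Lemma slices_cov2 b :
  E (fun t => on_sum (Nb n) (y^~ t) b ^+ 2 * off_sum (Nb n) (y^~ t) b ^+ 2) <=
     E (fun t => on_sum (Nb n) (y^~ t) b ^+ 2) * E (fun t => off_sum (Nb n) (y^~ t) b ^+ 2)
     + r / 2 * (E (fun t => on_sum (Nb n) (y^~ t) b ^+ 4) +
                E (fun t => off_sum (Nb n) (y^~ t) b ^+ 4)).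
Proof.
have e4 (x : R) : x ^+ 4 = (x ^+ 2) ^+ 2 by rewrite -exprM.
under [X in _ <= _ + r / 2 * (E X + _)]eq_fun do rewrite e4.
under [X in _ <= _ + r / 2 * (_ + E X)]eq_fun do rewrite e4.
have bon : bdd (fun t => on_sum (Nb n) (y^~ t) b) by apply: bdd_sum.
have boff : bdd (fun t => off_sum (Nb n) (y^~ t) b) by apply: bdd_sum.
apply: covle; apply: (fs_rho fs (u := u) (A := A b)).
- exact/bdd_L2/bddX.
- exact/bdd_L2/bddX.
- by apply: msrX; apply: (@msr_on _ y) => j; exact: y_on.
- by apply: msrX; apply: (@msr_off _ y) => j; exact: y_off.
Qed.

Lemma slices_cov_sqr b :
  E (fun t => on_sum (Nb n) (fun j => y j t ^+ 2) b *
              off_sum (Nb n) (fun j => y j t ^+ 2) b) <=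
     E (fun t => on_sum (Nb n) (fun j => y j t ^+ 2) b) *
     E (fun t => off_sum (Nb n) (fun j => y j t ^+ 2) b)
     + r / 2 * (E (fun t => on_sum (Nb n) (fun j => y j t ^+ 2) b ^+ 2) +
                E (fun t => off_sum (Nb n) (fun j => y j t ^+ 2) b ^+ 2)).
Proof.
apply: covle; apply: (fs_rho fs (u := u) (A := A b)).
- by apply/bdd_L2/bdd_sum => j _; exact: bddX.
- by apply/bdd_L2/bdd_sum => j _; exact: bddX.
- by apply: (@msr_on _ (fun j t => y j t ^+ 2)) => j /y_on; exact: msrX.
- by apply: (@msr_off _ (fun j t => y j t ^+ 2)) => j /y_off; exact: msrX.
Qed.

End slices.

Let slices_fourth : exists2 C : R, 0 <= C & forall n u p Y, adapted n Y ->
  centered Y -> (forall k, bdd (Y k)) ->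
  E (fun t => fsum n Y p t ^+ 4) <=
  C * (\sum_(j < Nb n)
         E (fun t => fsum n Y (fun k => p k && (k u == (j : nat)%:Z)) t ^+ 4)
       + (\sum_(j < Nb n)
         E (fun t => fsum n Y (fun k => p k && (k u == (j : nat)%:Z)) t ^+ 2)) ^+ 2).
Proof.
have r01 : 0 <= r < 1 by rewrite (fs_rho_ge0 fs) (fs_rho_lt1 fs).
have [C C0 hC] := fourth_moment_le P r01; exists C => // n u p Y aY cY bY.
have LY k : L2 P (Y k) by exact: bdd_L2.
have e : E (fun t => fsum n Y p t ^+ 4) = E (fun t => (\sum_(j < Nb n)
    fsum n Y (fun k => p k && (k u == (j : nat)%:Z)) t) ^+ 4).
  by apply: eq_Ex => t; rewrite (fsum_slices _ _ u).
rewrite e; apply: (hC _ (fun j : nat => fsum n Y (fun k => p k && (k u == j%:Z)))).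
- by move=> j; exact: fsum_bdd.
- by move=> b; exact: slices_cov.
- by move=> b; exact: slices_cov2.
- by move=> b; exact: slices_cov_sqr.
Qed.

(** Induction parameter of the slicing: only the coordinates below [m] are still free. At [m = 0] at
    most one site is left, at [m = d] nothing is required. *)
Definition constant_from n m p := forall k k', k \in B n -> k' \in B n ->
  p k -> p k' -> forall u : 'I_d, (m <= u)%N -> k u = k' u.

Lemma constant_from0 n p : constant_from n 0 p ->
  exists s : seq (lattice d), (size s <= 1)%N /\
    forall (V : nmodType) (F : lattice d -> V),
      \sum_(k <- B n | p k) F k = \sum_(k <- s) F k.
Proof.
move=> c; exists [seq k <- B n | p k]; split; last first.
  by move=> V F; rewrite big_filter.
have := filter_uniq p (fs_uniq fs n).
have h k : k \in [seq k <- B n | p k] -> k \in B n /\ p k.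
  by rewrite mem_filter => /andP[].
move: h; case: [seq k <- B n | p k] => [//|k [//|k' s]] h /=.
have [kB pk] := h k (mem_head _ _).
have [kB' pk'] : k' \in B n /\ p k' by apply: h; rewrite !inE eqxx orbT.
rewrite inE negb_or; have -> : k = k' by apply/ffunP => u; exact: c.
by rewrite eqxx.
Qed.

Lemma constant_from_slice n m (u : 'I_d) p (j : nat) : u = m :> nat ->
  constant_from n m.+1 p ->
  constant_from n m (fun k => p k && (k u == j%:Z)).
Proof.
move=> um c k k' kB kB' /andP[pk /eqP ku] /andP[pk' /eqP ku'] v.
rewrite leq_eqVlt => /orP[/eqP mv|mv]; last exact: c.
by have -> : v = u; [apply: val_inj; rewrite /= -mv um|rewrite ku ku'].
Qed.

(** Slicing in coordinate [m] costs one factor [D] in either direction and fixes that coordinate, so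
    [m] slicings reduce the claim to single sites. *)
Let field_second_aux n Y m p : (m <= d)%N -> adapted n Y ->
  (forall k, L2 P (Y k)) -> centered Y -> constant_from n m p ->
  E (fun t => fsum n Y p t ^+ 2) <= D ^+ m * mass n Y p /\
  mass n Y p <= D ^+ m * E (fun t => fsum n Y p t ^+ 2).
Proof.
move=> + aY LY cY; elim: m p => [|m IH] p md c.
  have [s [s1 hs]] := constant_from0 c.
  rewrite !expr0 !mul1r.
  have -> : E (fun t => fsum n Y p t ^+ 2) = mass n Y p; last by [].
  rewrite /mass hs; move: s1 hs; case: s => [|k [|//]] _ hs.
    rewrite big_nil -(Ex_cst P 0); apply: eq_Ex => t.
    by rewrite /fsum hs big_nil expr0n.
  by rewrite big_seq1; apply: eq_Ex => t; rewrite /fsum hs big_seq1.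
pose u := Ordinal md.
have Dm : 0 <= D ^+ m by rewrite exprn_ge0// (le_trans _ D1).
have D0 : 0 <= D by rewrite (le_trans _ D1).
have [h1 h2] := slices_second u p aY LY cY.
have IHj j := IH (fun k => p k && (k u == j%:Z)) (ltnW md)
  (@constant_from_slice n m u p j erefl c).
have -> : mass n Y p =
    \sum_(j < Nb n) mass n Y (fun k => p k && (k u == (j : nat)%:Z)).
  by rewrite /mass (sum_slices _ u).
split.
  apply: le_trans h1 _; rewrite exprS -mulrA ler_wpM2l// mulr_sumr.
  by apply: ler_sum => j _; case: (IHj j).
rewrite exprSr -mulrA; apply: (@le_trans _ _ (D ^+ m * \sum_(j < Nb n)
    E (fun t => fsum n Y (fun k => p k && (k u == (j : nat)%:Z)) t ^+ 2))).
  by rewrite mulr_sumr; apply: ler_sum => j _; case: (IHj j).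
by rewrite ler_wpM2l.
Qed.

Lemma field_second_moment : exists2 D : R, 1 <= D & forall n Y p, adapted n Y ->
  (forall k, L2 P (Y k)) -> centered Y ->
  E (fun t => fsum n Y p t ^+ 2) <= D * mass n Y p /\
  mass n Y p <= D * E (fun t => fsum n Y p t ^+ 2).
Proof.
exists (D ^+ d); first by rewrite exprn_ege1.
move=> n Y p aY LY cY; apply: field_second_aux => //.
by move=> k k' _ _ _ _ u; rewrite leqNgt ltn_ord.
Qed.

(** Induction over the coordinates: [slices_fourth] reduces to slices, whose fourth moments come
    from the induction hypothesis and whose second moments come from [field_second_aux]. The
    constants do not grow with the number of slices because the squares of the slice masses sum to
    at most the square of the total mass. *)
Lemma field_fourth_moment : exists2 C : R, 0 <= C & forall n Y p, adapted n Y ->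
  centered Y -> (forall k, bdd (Y k)) ->
  E (fun t => fsum n Y p t ^+ 4) <=
  C * (\sum_(k <- B n | p k) E (fun t => Y k t ^+ 4) + mass n Y p ^+ 2).
Proof.
suff H m : (m <= d)%N -> exists2 C : R, 0 <= C & forall n Y p, adapted n Y ->
  centered Y -> (forall k, bdd (Y k)) -> constant_from n m p ->
  E (fun t => fsum n Y p t ^+ 4) <=
  C * (\sum_(k <- B n | p k) E (fun t => Y k t ^+ 4) + mass n Y p ^+ 2).
  have [C C0 hC] := H d (leqnn d); exists C => // n Y p aY cY bY.
  by apply: hC => // k k' _ _ _ _ u; rewrite leqNgt ltn_ord.
elim: m => [_|m IH md].
  exists 1 => // n Y p aY cY bY /constant_from0[s [s1 hs]].
  apply: (@le_trans _ _ (\sum_(k <- B n | p k) E (fun t => Y k t ^+ 4))); last first.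
    by rewrite mul1r lerDl sqr_ge0.
  rewrite le_eqVlt; apply/orP; left; apply/eqP.
  rewrite hs; move: s1 hs; case: s => [|k [|//]] _ hs.
    rewrite big_nil -[RHS](Ex_cst P); apply: eq_Ex => t.
    by rewrite /fsum hs big_nil expr0n.
  by rewrite big_seq1; apply: eq_Ex => t; rewrite /fsum hs big_seq1.
have [Cm Cm0 hCm] := IH (ltnW md); have [C C0 hC] := slices_fourth.
have Dm : 0 <= (D ^+ m) ^+ 2 by exact: sqr_ge0.
exists (C * (Cm + (D ^+ m) ^+ 2)); first by rewrite mulr_ge0// addr_ge0.
move=> n Y p aY cY bY c; pose u := Ordinal md.
apply: le_trans (hC n u p Y aY cY bY) _; rewrite -mulrA ler_wpM2l//.
pose q j k := p k && (k u == j%:Z).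
have cq j : constant_from n m (q j) by exact: constant_from_slice c.
have eM : mass n Y p = \sum_(j < Nb n) mass n Y (q j).
  by rewrite /mass (sum_slices _ u).
have e4 : \sum_(k <- B n | p k) E (fun t => Y k t ^+ 4) =
    \sum_(j < Nb n) \sum_(k <- B n | q j k) E (fun t => Y k t ^+ 4).
  exact: sum_slices.
set f := \sum_(k <- B n | p k) _ in e4 *.
have f0 : 0 <= f.
  by apply: sumr_ge0 => k _; apply: Ex_ge0 => t; rewrite (exprM _ 2 2) sqr_ge0.
have M2 : \sum_(j < Nb n) mass n Y (q j) ^+ 2 <= mass n Y p ^+ 2.
  rewrite eM expr2 mulr_suml; apply: ler_sum => j _; rewrite expr2.
  rewrite ler_wpM2l ?mass_ge0// (bigD1 j)//= lerDl.
  by apply: sumr_ge0 => i _; exact: mass_ge0.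
rewrite mulrDl; apply: lerD.
  apply: (@le_trans _ _ (Cm * \sum_(j < Nb n) (\sum_(k <- B n | q j k)
      E (fun t => Y k t ^+ 4) + mass n Y (q j) ^+ 2))).
    by rewrite mulr_sumr; apply: ler_sum => j _; apply: hCm => //; exact: (cq j).
  by rewrite ler_wpM2l// big_split/= -e4 lerD2l.
apply: (@le_trans _ _ ((D ^+ m * mass n Y p) ^+ 2)); last first.
  by rewrite exprMn ler_wpM2l// lerDr.
rewrite ler_sqr ?nnegrE; last 2 first.
- by apply: sumr_ge0 => j _; apply: Ex_ge0 => t; exact: sqr_ge0.
- by rewrite mulr_ge0 ?mass_ge0// exprn_ge0// (le_trans _ D1).
rewrite eM mulr_sumr; apply: ler_sum => j _.
have LY k : L2 P (Y k) by exact: bdd_L2.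
by have [] := @field_second_aux n Y m (q j) (ltnW md) aY LY cY (cq j).
Qed.

End field_moments.

(** * Errors of characteristic functions *)

Section trigonometric_bounds.
Context (R : realType).
Implicit Types x y b : R.

(** Bounding the derivative uniformly loses a numerical factor, but derives each Taylor bound below
    from the one of lower order. *)
Lemma MVT_norm_le (f df : R -> R) (x c : R) :
  (forall y, is_derive y (1 : R) f (df y)) ->
  (forall y, `|y| <= `|x| -> `|df y| <= c) ->
  `|f x - f 0| <= c * `|x|.
Proof.
move=> hd hc.
have cf a b : {within `[a, b], continuous f}.
  apply: continuous_subspaceT => y; apply: differentiable_continuous.
  by apply/derivable1_diffP; have [] := hd y.
have [x0|x0] := leP 0 x.
  have [z /itvP zx ->] := MVT_segment x0 (fun y _ => hd y) (cf _ _).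
  rewrite subr0 normrM ler_wpM2r//; apply: hc.
  by rewrite !ger0_norm ?zx.
have [z /itvP zx e] := MVT_segment (ltW x0) (fun y _ => hd y) (cf _ _).
rewrite distrC e normrM sub0r normrN ler_wpM2r//; apply: hc.
by rewrite (ler0_norm (ltW x0)) ler0_norm ?lerN2 ?zx.
Qed.

Lemma is_derive_sinD b y :
  is_derive y (1 : R) (fun z => sin (z + b)) (cos (y + b)).
Proof.
have h : is_derive y (1 : R) (fun z => z + b) 1.
  rewrite -[X in is_derive _ _ _ X]addr0.
  exact: is_deriveD (is_derive_id y 1) (is_derive_cst b y 1).
by have := @is_derive1_comp R sin (+%R^~ b) y _ _ (is_derive_sin (y + b)) h; rewrite mulr1.
Qed.

Lemma is_derive_cosD b y :
  is_derive y (1 : R) (fun z => cos (z + b)) (- sin (y + b)).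
Proof.
have h : is_derive y (1 : R) (fun z => z + b) 1.
  rewrite -[X in is_derive _ _ _ X]addr0.
  exact: is_deriveD (is_derive_id y 1) (is_derive_cst b y 1).
by have := @is_derive1_comp R cos (+%R^~ b) y _ _ (is_derive_cos (y + b)) h; rewrite mulr1.
Qed.

Lemma is_derive_mulr (c y : R) : is_derive y (1 : R) (fun z => z * c) c.
Proof.
have h : is_derive y (1 : R) (fun z => z) 1 by exact: is_derive_id.
apply: (is_derive_eq (is_deriveM h (is_derive_cst c y 1))).
by rewrite /GRing.scale /= mulr0 add0r mulr1.
Qed.

Lemma is_derive_sqr_mulr (c y : R) :
  is_derive y (1 : R) (fun z => z ^+ 2 * c) (2 * y * c).
Proof.
have h : is_derive y (1 : R) (fun z => z) 1 by exact: is_derive_id.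
apply: (is_derive_eq (is_deriveM (is_deriveM h h) (is_derive_cst c y 1))).
by rewrite /GRing.scale /=; ring.
Qed.

Lemma sinD_le x b : `|sin (x + b) - sin b| <= `|x|.
Proof.
have := @MVT_norm_le _ _ x 1 (is_derive_sinD b); rewrite add0r mul1r; apply.
by move=> y _; rewrite ler_norml cos_geN1 cos_le1.
Qed.

Lemma cosD_le x b : `|cos (x + b) - cos b| <= `|x|.
Proof.
have := @MVT_norm_le _ _ x 1 (is_derive_cosD b); rewrite add0r mul1r; apply.
by move=> y _; rewrite normrN ler_norml sin_geN1 sin_le1.
Qed.

Lemma cosD_taylor1 x b : `|cos (x + b) - cos b + x * sin b| <= x ^+ 2.
Proof.
have hd y : is_derive y (1 : R) (fun z => cos (z + b) + z * sin b)
    (- sin (y + b) + sin b).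
  exact: is_deriveD (is_derive_cosD b y) (is_derive_mulr (sin b) y).
have := @MVT_norm_le _ _ x `|x| hd.
rewrite add0r mul0r addr0 -expr2 real_normK ?num_real// addrAC; apply.
move=> y yx; apply: le_trans yx; rewrite addrC.
by apply: le_trans (sinD_le y b); rewrite distrC.
Qed.

Lemma sinD_taylor1 x b : `|sin (x + b) - sin b - x * cos b| <= x ^+ 2.
Proof.
have hd y : is_derive y (1 : R) (fun z => sin (z + b) - z * cos b)
    (cos (y + b) - cos b).
  exact: is_deriveB (is_derive_sinD b y) (is_derive_mulr (cos b) y).
have := @MVT_norm_le _ _ x `|x| hd.
rewrite add0r mul0r subr0 -expr2 real_normK ?num_real// addrAC; apply.
by move=> y yx; apply: le_trans yx; exact: cosD_le.
Qed.

Lemma cosD_taylor2 x b :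
  `|cos (x + b) - cos b + x * sin b + x ^+ 2 / 2 * cos b| <= `|x| ^+ 3.
Proof.
have hd y : is_derive y (1 : R)
    (fun z => cos (z + b) + z * sin b + z ^+ 2 * (cos b / 2))
    (- (sin (y + b) - sin b - y * cos b)).
  have -> : - (sin (y + b) - sin b - y * cos b) =
    - sin (y + b) + sin b + 2 * y * (cos b / 2) by field.
  apply: is_deriveD (is_derive_sqr_mulr _ y).
  exact: is_deriveD (is_derive_cosD b y) (is_derive_mulr (sin b) y).
have := @MVT_norm_le _ _ x (x ^+ 2) hd.
rewrite add0r mul0r addr0 expr0n/= mul0r addr0.
rewrite -(real_normK (num_real x)) -exprSr real_normK ?num_real//.
have -> : cos (x + b) + x * sin b + x ^+ 2 * (cos b / 2) - cos b =
  cos (x + b) - cos b + x * sin b + x ^+ 2 / 2 * cos b by field.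
apply => y yx; rewrite normrN; apply: le_trans (sinD_taylor1 _ _) _.
rewrite -(real_normK (num_real y)) -[leRHS](real_normK (num_real x)).
by rewrite ler_sqr ?nnegrE.
Qed.

Lemma expRN_taylor1 x : 0 <= x -> `|expR (- x) - 1 + x| <= x ^+ 2.
Proof.
move=> x0; have h1 := expR_ge1Dx (- x); have h2 := expR_ge1Dx x.
rewrite ger0_norm; last by lra.
suff : expR (- x) * (1 + x) <= 1.
  have : 0 < expR (- x) by exact: expR_gt0.
  by nra.
rewrite expRN ler_pdivrMl ?expR_gt0// mulr1//.
Qed.

Lemma expRN_le x y : 0 <= x -> 0 <= y -> `|expR (- x) - expR (- y)| <= `|x - y|.
Proof.
wlog xy : x y / x <= y.
  move=> h x0 y0; have [/h|/ltW/h] := leP x y; first exact.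
  by rewrite distrC [in X in _ -> _ <= X]distrC; apply.
move=> x0 y0; rewrite ger0_norm; last by rewrite subr_ge0 ler_expR lerN2.
rewrite distrC ger0_norm ?subr_ge0//.
have -> : expR (- y) = expR (- x) * expR (- (y - x)).
  by rewrite -expRD; congr expR; ring.
have := expR_ge1Dx (- (y - x)).
have : expR (- x) <= 1 by rewrite expR_le1 oppr_le0.
have : 0 < expR (- x) by exact: expR_gt0.
nra.
Qed.

End trigonometric_bounds.

(** * Continuous truncation *)

Section clip.
Context (R : realType).
Implicit Types x M : R.

Definition clip M x := Num.max (- M) (Num.min M x).

Lemma clip_bound M x : 0 <= M -> `|clip M x| <= M.
Proof.
move=> M0; rewrite /clip ler_norml le_max lexx/= ge_max ge_min lexx/=.
by rewrite andbT (le_trans _ M0)// oppr_le0.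
Qed.

Lemma clip_id M x : `|x| <= M -> clip M x = x.
Proof.
by rewrite ler_norml /clip => /andP[? ?]; rewrite min_r// max_r.
Qed.

Lemma clip_le M x : 0 <= M -> `|clip M x| <= `|x|.
Proof.
move=> M0; have [/clip_id-> //|h] := leP `|x| M.
by apply: le_trans (clip_bound _ M0) (ltW h).
Qed.

Lemma clip_diff M x : 0 <= M -> `|x - clip M x| <= `|x|.
Proof.
move=> M0; rewrite /clip; have [x0|x0] := leP 0 x.
  rewrite max_r ?le_min ?(le_trans _ M0) ?(le_trans _ x0) ?oppr_le0//.
  by have [h|h] := leP M x; rewrite ?ger0_norm//; lra.
rewrite min_r; last by rewrite (le_trans (ltW x0)).
by have [h|h] := leP (- M) x; rewrite !ler0_norm//; lra.
Qed.

(** The difference vanishes unless [|x| > M], and then [(|x| / M) ^ n >= 1]. *)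
Lemma clip_diffX n M x : 0 < M -> `|x - clip M x| <= `|x| ^+ n.+1 / M ^+ n.
Proof.
move=> M0; have [h|h] := leP `|x| M.
  by rewrite clip_id// subrr normr0 divr_ge0 ?exprn_ge0// ltW.
apply: le_trans (clip_diff _ (ltW M0)) _.
rewrite ler_pdivlMr ?exprn_gt0// exprS ler_wpM2l//.
by apply: lerXn2r; rewrite ?nnegrE ?normr_ge0// ltW.
Qed.

Lemma measurable_clip M : measurable_fun setT (clip M).
Proof. by apply: measurable_maxr => //; exact: measurable_minr. Qed.

End clip.

(** * Distance to the normal law with the same second moment *)

Section gaussian_error.
Context (disp : measure_display) (T : measurableType disp) (R : realType).
Context (P : probability T R) (tau : R).
Implicit Types f g : T -> R.
Local Notation E := (Ex P).

(** Characteristic function at [tau] of the centred normal law whose variance is the second moment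
    of [f]. *)
Definition gauss_factor f := expR (- (tau ^+ 2 / 2 * E (fun t => f t ^+ 2))).

(** All phases [b] are included: [b = 0] gives the real part of the characteristic function and
    [b = - pi / 2] the imaginary part. A family closed under phase shifts is what the addition
    formulas need. *)
Definition gerr f (e : R) := forall b : R,
  `|E (fun t => cos (tau * f t + b)) - gauss_factor f * cos b| <= e.

Lemma gerr_le f e e' : e <= e' -> gerr f e -> gerr f e'.
Proof. by move=> ee h b; apply: le_trans (h b) ee. Qed.

Lemma variance_arg_ge0 f : 0 <= tau ^+ 2 / 2 * E (fun t => f t ^+ 2).
Proof.
apply: mulr_ge0; first by rewrite divr_ge0// sqr_ge0.
by apply: Ex_ge0 => t; exact: sqr_ge0.
Qed.

Lemma gauss_factor_le f g : `|gauss_factor f - gauss_factor g| <=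
  tau ^+ 2 / 2 * `|E (fun t => f t ^+ 2) - E (fun t => g t ^+ 2)|.
Proof.
apply: le_trans (expRN_le (variance_arg_ge0 _) (variance_arg_ge0 _)) _.
by rewrite -mulrBr normrM ger0_norm// divr_ge0// sqr_ge0.
Qed.

Lemma gauss_factor_ge0 f : 0 <= gauss_factor f.
Proof. exact: expR_ge0. Qed.

Lemma gauss_factor_le1 f : gauss_factor f <= 1.
Proof. by rewrite expR_le1 oppr_le0 variance_arg_ge0. Qed.

Lemma measurable_affine f b : measurable_fun setT f ->
  measurable_fun setT (fun t => tau * f t + b).
Proof.
by move=> mf; apply: measurable_funD => //; exact: measurable_funM.
Qed.

Lemma bdd_cosD f b : measurable_fun setT f -> bdd (fun t => cos (tau * f t + b)).
Proof. by move=> /measurable_affine mf; exact: bdd_cos. Qed.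

(** The cosine is 1-Lipschitz, so the first extra term is [|tau|] times an L1 distance. The second
    is the change of variance, from [f ^ 2 - g ^ 2 = (f - g) (f + g)] and the weight [1 / th] in
    [Ex_normM_le]. *)
Lemma gerr_perturb f g th W e : 0 < th -> L2 P f -> L2 P g ->
  E (fun t => (f t - g t) ^+ 2) <= th ^+ 2 ->
  E (fun t => (f t + g t) ^+ 2) <= W ->
  gerr g e -> gerr f (e + `|tau| * th + tau ^+ 2 * th * (1 + W)).
Proof.
move=> th0 Lf Lg hB hD hg b.
have LB : L2 P (fun t => f t - g t) by exact: L2B.
have LD : L2 P (fun t => f t + g t) by exact: L2D.
have thi0 : 0 < th^-1 by rewrite invr_gt0.
have eth : th^-1 * th ^+ 2 = th by rewrite expr2 mulKf// gt_eqF.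
have W0 : 0 <= W by apply: le_trans hD; apply: Ex_ge0 => t; exact: sqr_ge0.
have h1 : E (fun t => `|f t - g t|) <= th.
  have := Ex_normM_le thi0 LB (bdd_L2 P (bdd_cst T (1 : R))).
  under [X in E X <= _]eq_fun do rewrite mulr1.
  move=> /le_trans; apply.
  rewrite expr1n Ex_cst mulr1 invrK.
  have : th^-1 * E (fun t => (f t - g t) ^+ 2) <= th by rewrite -[leRHS]eth ler_pM2l.
  by lra.
have h2 : `|E (fun t => f t ^+ 2) - E (fun t => g t ^+ 2)| <= th * (1 + W).
  rewrite -ExB; [|exact: L2_sqr..].
  have e1 : E (fun t => f t ^+ 2 - g t ^+ 2) = E (fun t => (f t - g t) * (f t + g t)).
    by apply: eq_Ex => t; rewrite subr_sqr.
  rewrite e1; apply: le_trans (ler_norm_Ex (L2M LB LD)) _.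
  apply: le_trans (Ex_normM_le thi0 LB LD) _; rewrite invrK.
  have : th^-1 * E (fun t => (f t - g t) ^+ 2) <= th by rewrite -[leRHS]eth ler_pM2l.
  have : th * E (fun t => (f t + g t) ^+ 2) <= th * W by rewrite ler_pM2l.
  have : 0 <= th * W by rewrite mulr_ge0// ltW.
  by lra.
have h3 : `|E (fun t => cos (tau * f t + b)) - E (fun t => cos (tau * g t + b))|
    <= `|tau| * th.
  have cf := bdd_cosD b (L2_measurable Lf).
  have cg := bdd_cosD b (L2_measurable Lg).
  rewrite -ExB; [|exact: bdd_summable..].
  apply: (@le_trans _ _ (E (fun t => `|tau| * `|f t - g t|))); last first.
    by rewrite ExZ ?ler_wpM2l//; exact/summable_norm/L2_summable.
  apply: le_norm_Ex; first exact: (bdd_summable P (bddB cf cg)).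
    exact/summableZ/summable_norm/L2_summable.
  move=> t; rewrite -normrM.
  have := cosD_le (tau * (f t - g t)) (tau * g t + b).
  by have -> : tau * (f t - g t) + (tau * g t + b) = tau * f t + b by ring.
have h4 : `|gauss_factor f * cos b - gauss_factor g * cos b| <=
    tau ^+ 2 * th * (1 + W).
  rewrite -mulrBl normrM.
  have c1 : `|cos b| <= 1 by rewrite ler_norml cos_geN1 cos_le1.
  apply: (@le_trans _ _ `|gauss_factor f - gauss_factor g|).
    by rewrite ler_piMr.
  apply: le_trans (gauss_factor_le f g) _.
  rewrite -[leRHS]mulrA; apply: ler_pM => //; last first.
  - by rewrite ler_pdivrMr// ler_peMr ?sqr_ge0// ler1n.
  - by rewrite divr_ge0// sqr_ge0.
have := hg b; move: h3 h4; rewrite !ler_norml.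
by move=> /andP[? ?] /andP[? ?] /andP[? ?]; apply/andP; split; lra.
Qed.

Lemma gerr0 : gerr (fun=> 0) 0.
Proof.
move=> b; rewrite mulr0 add0r Ex_cst /gauss_factor expr0n/= Ex_cst mulr0 oppr0.
by rewrite expR0 mul1r subrr normr0.
Qed.

(** The cosine and the Gaussian factor agree up to the quadratic term once the mean is 0; the two
    summands are their remainders. *)
Lemma gerr_taylor f : bdd f -> E f = 0 ->
  gerr f (`|tau| ^+ 3 * E (fun t => `|f t| ^+ 3) +
          (tau ^+ 2 / 2 * E (fun t => f t ^+ 2)) ^+ 2).
Proof.
move=> bf f0 b.
have c1 : `|cos b| <= 1 by rewrite ler_norml cos_geN1 cos_le1.
set v := E (fun t => f t ^+ 2).
have h1 : `|E (fun t => cos (tau * f t + b)) - cos b + tau ^+ 2 / 2 * v * cos b| <=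
    `|tau| ^+ 3 * E (fun t => `|f t| ^+ 3).
  have cf := bdd_summable P (bdd_cosD b (bdd_measurable bf)).
  have sf := bdd_summable P bf.
  have s2 := bdd_summable P (bddX 2 bf).
  have sc := summable_cst P (- cos b).
  have sv := summableZ (tau ^+ 2 / 2 * cos b) s2.
  have ss := summableZ (tau * sin b) sf.
  have -> : E (fun t => cos (tau * f t + b)) - cos b + tau ^+ 2 / 2 * v * cos b =
      E (fun t => (cos (tau * f t + b) + - cos b) +
        (tau * sin b * f t + tau ^+ 2 / 2 * cos b * f t ^+ 2)).
    rewrite (ExD (summableD cf sc) (summableD ss sv)) (ExD cf sc) (ExD ss sv).
    by rewrite Ex_cst !ExZ// f0 /v; ring.
  rewrite -ExZ; last exact/bdd_summable/bddX/bdd_norm.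
  apply: le_norm_Ex.
  - exact: (summableD (summableD cf sc) (summableD ss sv)).
  - exact/summableZ/bdd_summable/bddX/bdd_norm.
  move=> t; have := cosD_taylor2 (tau * f t) b.
  have -> : cos (tau * f t + b) - cos b + tau * f t * sin b +
     (tau * f t) ^+ 2 / 2 * cos b = cos (tau * f t + b) - cos b +
     (tau * sin b * f t + tau ^+ 2 / 2 * cos b * f t ^+ 2) by ring.
  by rewrite normrM exprMn.
have h2 : `|(gauss_factor f - 1 + tau ^+ 2 / 2 * v) * cos b| <= (tau ^+ 2 / 2 * v) ^+ 2.
  rewrite normrM; apply: (le_trans (ler_piMr _ c1)) => //.
  exact: expRN_taylor1 (variance_arg_ge0 f).
move: h1 h2; rewrite !ler_norml => /andP[? ?] /andP[? ?]; apply/andP; split; lra.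
Qed.

Section join.
Context (G H : set (set T)) (a : R).
Hypotheses (GM : G `<=` measurable) (HM : H `<=` measurable).
Hypothesis GH : forall A B, <<s G >> A -> <<s H >> B ->
  `|fine (P (A `&` B)) - fine (P A) * fine (P B)| <= a.

(** From [cos (x + y) = cos x cos y - sin x sin y]: decoupling the two products costs [4 * a] each,
    [e2] enters once through the cosine and once through the sine of [tau * g], and [tau ^ 2 * kap]
    pays for the non-additivity of the variance. The coefficient 1 of [e1] is essential: when pieces
    are appended one by one, the accumulated error is not multiplied. *)
Lemma gerr_join f g e1 e2 kap : msr G f -> msr H g -> bdd f -> bdd g ->
  `|E (fun t => f t * g t)| <= kap -> gerr f e1 -> gerr g e2 ->
  gerr (fun t => f t + g t) (e1 + 2 * e2 + 8 * a + tau ^+ 2 * kap).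
Proof.
move=> mf mg bf bg hk hf hg b.
have c1 (x : R) : `|cos x| <= 1 by rewrite ler_norml cos_geN1 cos_le1.
have s1 (x : R) : `|sin x| <= 1 by rewrite ler_norml sin_geN1 sin_le1.
have mcos : measurable_fun setT (@cos R).
  by apply: continuous_measurable_fun; exact: continuous_cos.
have msin : measurable_fun setT (@sin R).
  by apply: continuous_measurable_fun; exact: continuous_sin.
have ma : msr G (fun t => tau * f t + b).
  by apply: msrD; [apply: msrM => //|]; exact: msr_cst.
have mb : msr H (fun t => tau * g t) by apply: msrM => //; exact: msr_cst.
have cc := cov_bounded_le GM HM GH (msr_comp mcos ma) (msr_comp mcos mb)
  (fun t => c1 _) (fun t => c1 _).
have ss := cov_bounded_le GM HM GH (msr_comp msin ma) (msr_comp msin mb)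
  (fun t => s1 _) (fun t => s1 _).
have ba := measurable_affine b (bdd_measurable bf).
have bb : measurable_fun setT (fun t => tau * g t).
  by apply: measurable_funM => //; exact: bdd_measurable.
have bca := bdd_cos ba; have bsa := bdd_sin ba.
have bcb := bdd_cos bb; have bsb := bdd_sin bb.
have e0 : E (fun t => cos (tau * (f t + g t) + b)) =
    E (fun t => cos (tau * f t + b) * cos (tau * g t)) -
    E (fun t => sin (tau * f t + b) * sin (tau * g t)).
  rewrite -ExB; [|by apply: bdd_summable; exact: bddM..].
  apply: eq_Ex => t; rewrite -cosD; congr cos; ring.
have hg1 : `|E (fun t => cos (tau * g t)) - gauss_factor g| <= e2.
  have := hg 0; rewrite cos0 mulr1; under eq_Ex do rewrite addr0.
  by [].
have hg2 : `|E (fun t => sin (tau * g t))| <= e2.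
  (* This phase turns the cosine into the sine, and the Gaussian term vanishes there. *)
  have := hg (- (pi / 2)); rewrite cosN cos_pihalf mulr0 subr0.
  have -> // : E (fun t => cos (tau * g t - pi / 2)) = E (fun t => sin (tau * g t)).
  by apply: eq_Ex => t; rewrite cosB cos_pihalf sin_pihalf mulr0 add0r mulr1.
have gj : `|gauss_factor (fun t => f t + g t) - gauss_factor f * gauss_factor g| <=
    tau ^+ 2 * kap.
  have -> : gauss_factor f * gauss_factor g =
     expR (- (tau ^+ 2 / 2 * (E (fun t => f t ^+ 2) + E (fun t => g t ^+ 2)))).
    by rewrite /gauss_factor -expRD; congr expR; ring.
  apply: le_trans (expRN_le (variance_arg_ge0 _) _) _.
    by rewrite mulrDr addr_ge0 ?variance_arg_ge0.
  rewrite -mulrBr normrM ger0_norm; last by rewrite divr_ge0// sqr_ge0.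
  have -> : E (fun t => (f t + g t) ^+ 2) - (E (fun t => f t ^+ 2) +
      E (fun t => g t ^+ 2)) = 2 * E (fun t => f t * g t).
    have f2 := bdd_summable P (bddX 2 bf); have g2 := bdd_summable P (bddX 2 bg).
    have fg := bdd_summable P (bddM bf bg).
    rewrite -ExD// -ExB//; last 2 first.
    - exact: (bdd_summable P (bddX 2 (bddD bf bg))).
    - exact: summableD.
    by rewrite -ExZ//; apply: eq_Ex => t; ring.
  rewrite normrM (@ger0_norm _ 2)// mulrA divfK//.
  by rewrite ler_wpM2l// sqr_ge0.
move: cc ss; rewrite e0.
set X := E (fun t => cos (tau * f t + b) * _).
set Z := E (fun t => sin (tau * f t + b) * _).
set x := E (fun t => cos (tau * f t + b)).
set z := E (fun t => sin (tau * f t + b)).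
set y := E (fun t => cos (tau * g t)) in hg1 *.
set w := E (fun t => sin (tau * g t)) in hg2 *.
move=> cc ss.
have x1 : `|x| <= 1.
  rewrite -(Ex_cst P 1); apply: le_norm_Ex => //; first exact: bdd_summable.
  exact: summable_cst.
have z1 : `|z| <= 1.
  rewrite -(Ex_cst P 1); apply: le_norm_Ex => //; first exact: bdd_summable.
  exact: summable_cst.
have g0 := gauss_factor_ge0 g; have g1 := gauss_factor_le1 g.
have t1 : `|x * (y - gauss_factor g)| <= e2.
  by rewrite normrM; apply: le_trans hg1; rewrite ler_piMl.
have t2 : `|z * w| <= e2.
  by rewrite normrM; apply: le_trans hg2; rewrite ler_piMl.
have t3 : `|gauss_factor g * (x - gauss_factor f * cos b)| <= e1.
  by rewrite normrM ger0_norm//; apply: le_trans (hf b); rewrite ler_piMl.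
have t4 : `|(gauss_factor (fun t => f t + g t) - gauss_factor f * gauss_factor g)
    * cos b| <= tau ^+ 2 * kap.
  by rewrite normrM; apply: le_trans gj; rewrite ler_piMr.
move: cc ss t1 t2 t3 t4; rewrite !ler_norml.
move=> /andP[? ?] /andP[? ?] /andP[? ?] /andP[? ?] /andP[? ?] /andP[? ?].
by apply/andP; split; lra.
Qed.

(** Mixing applies to the variables clipped at [M], giving [4 * a * M ^ 2]. The clipped means need
    not vanish, but are at most [V / M]; what is clipped away is controlled by the fourth moments
    and gives [(V + W) / M]. *)
Lemma cov_moment_le f g V W M : 0 < M -> msr G f -> msr H g -> bdd f -> bdd g ->
  E f = 0 -> E g = 0 ->
  E (fun t => f t ^+ 2) <= V -> E (fun t => g t ^+ 2) <= V ->
  E (fun t => f t ^+ 4) <= W -> E (fun t => g t ^+ 4) <= W ->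
  `|E (fun t => f t * g t)| <= 4 * a * M ^+ 2 + (V / M) ^+ 2 + (V + W) / M.
Proof.
move=> M0 mf mg bf bg f0 g0 f2 g2 f4 g4.
have M0' := ltW M0; have Mi0 : 0 < M^-1 by rewrite invr_gt0.
pose F t := clip M (f t); pose K t := clip M (g t).
have bF : bdd F.
  split; last by exists M => t; exact: clip_bound.
  by apply: measurableT_comp; [exact: measurable_clip|exact: bdd_measurable].
have bK : bdd K.
  split; last by exists M => t; exact: clip_bound.
  by apply: measurableT_comp; [exact: measurable_clip|exact: bdd_measurable].
have FK : `|E (fun t => F t * K t) - E F * E K| <= 4 * a * M ^+ 2.
  pose F' t := M^-1 * F t; pose K' t := M^-1 * K t.
  have mF' : msr G F'.
    by apply: msrM; [exact: msr_cst|exact: msr_comp (measurable_clip M) mf].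
  have mK' : msr H K'.
    by apply: msrM; [exact: msr_cst|exact: msr_comp (measurable_clip M) mg].
  have F1 t : `|F' t| <= 1.
    rewrite normrM gtr0_norm// -[leRHS](mulVf (lt0r_neq0 M0)) ler_pM2l//.
    exact: clip_bound.
  have K1 t : `|K' t| <= 1.
    rewrite normrM gtr0_norm// -[leRHS](mulVf (lt0r_neq0 M0)) ler_pM2l//.
    exact: clip_bound.
  have := cov_bounded_le GM HM GH mF' mK' F1 K1.
  rewrite (ExZ _ (bdd_summable P bF)) (ExZ _ (bdd_summable P bK)).
  have -> : E (fun t => F' t * K' t) = M^-1 ^+ 2 * E (fun t => F t * K t).
    rewrite -ExZ; last exact: (bdd_summable P (bddM bF bK)).
    by apply: eq_Ex => t; rewrite /F' /K'; ring.
  have -> : M^-1 ^+ 2 * E (fun t => F t * K t) - M^-1 * E F * (M^-1 * E K) =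
    M^-1 ^+ 2 * (E (fun t => F t * K t) - E F * E K) by ring.
  rewrite normrM gtr0_norm ?exprn_gt0// mulrC exprVn ler_pdivrMr ?exprn_gt0//.
have mean h : bdd h -> E h = 0 -> E (fun t => h t ^+ 2) <= V ->
    `|E (fun t => clip M (h t))| <= V / M.
  move=> bh h0 hV.
  have bc : bdd (fun t => clip M (h t)).
    split; last by exists M => t; exact: clip_bound.
    by apply: measurableT_comp; [exact: measurable_clip|exact: bdd_measurable].
  rewrite -normrN -[X in `|X|]add0r -h0 -ExB; [|exact: bdd_summable..].
  apply: (@le_trans _ _ (M^-1 * E (fun t => h t ^+ 2))); last first.
    by rewrite mulrC ler_pM2r.
  have s2 := bdd_summable P (bddX 2 bh).
  rewrite -ExZ//; apply: le_norm_Ex; first exact: (bdd_summable P (bddB bh bc)).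
    exact: summableZ.
  move=> t; have := clip_diffX 1 (h t) M0.
  by rewrite expr1 real_normK ?num_real// mulrC.
have cut h k : bdd h -> bdd k -> E (fun t => h t ^+ 4) <= W ->
    E (fun t => k t ^+ 2) <= V ->
    E (fun t => `|(h t - clip M (h t)) * k t|) <= (V + W) / (2 * M).
  move=> bh bk hW kV.
  have bc : bdd (fun t => clip M (h t)).
    split; last by exists M => t; exact: clip_bound.
    by apply: measurableT_comp; [exact: measurable_clip|exact: bdd_measurable].
  have bd := bddB bh bc.
  (* Pointwise [|h - clip M h| <= h ^ 2 / M], so a fourth moment bounds the square of the
     remainder. *)
  have h1 : E (fun t => (h t - clip M (h t)) ^+ 2) <= M^-1 ^+ 2 * W.
    apply: (@le_trans _ _ (M^-1 ^+ 2 * E (fun t => h t ^+ 4))); last first.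
      by rewrite ler_pM2l ?exprn_gt0.
    rewrite -ExZ; last exact/bdd_summable/bddX.
    apply: le_Ex.
    - exact: (bdd_summable P (bddX 2 bd)).
    - exact/summableZ/bdd_summable/bddX.
    move=> t; have := clip_diffX 1 (h t) M0; rewrite expr1 => hh.
    rewrite -(real_normK (num_real (_ - _))) (exprM (h t) 2 2).
    rewrite -(real_normK (num_real (h t))) -exprMn mulrC.
    by rewrite ler_sqr ?nnegrE// divr_ge0 ?sqr_ge0.
  apply: le_trans (Ex_normM_le M0 (bdd_L2 P bd) (bdd_L2 P bk)) _.
  have -> : (V + W) / (2 * M) = (M * (M^-1 ^+ 2 * W) + M^-1 * V) / 2.
    by field; rewrite gt_eqF.
  by rewrite ler_pM2r// lerD// ler_pM2l.
have r1 := cut _ _ bf bK f4 (_ : E (fun t => K t ^+ 2) <= V).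
have r2 := cut _ _ bg bf g4 f2.
have {}r1 : E (fun t => `|(f t - F t) * K t|) <= (V + W) / (2 * M).
  apply: r1; apply: le_trans g2; apply: le_Ex.
  - exact/bdd_summable/bddX.
  - exact/bdd_summable/bddX.
  move=> t; rewrite -(real_normK (num_real (K t))) -(real_normK (num_real (g t))).
  by rewrite ler_sqr ?nnegrE//; exact: clip_le.
have b1 := bddM (bddB bf bF) bK; have b2 := bddM (bddB bg bK) bf.
have e : E (fun t => f t * g t) = E (fun t => F t * K t) +
    (E (fun t => (f t - F t) * K t) + E (fun t => (g t - K t) * f t)).
  have s1 := bdd_summable P b1; have s2 := bdd_summable P b2.
  rewrite -(ExD s1 s2) -(ExD (bdd_summable P (bddM bF bK)) (summableD s1 s2)).
  by apply: eq_Ex => t; ring.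
have d1 := le_trans (ler_norm_Ex (bdd_summable P b1)) r1.
have d2 := le_trans (ler_norm_Ex (bdd_summable P b2)) r2.
have hF : `|E F * E K| <= (V / M) ^+ 2.
  rewrite normrM expr2; apply: ler_pM => //; exact: mean.
have hVW : (V + W) / M = (V + W) / (2 * M) + (V + W) / (2 * M).
  by field; rewrite gt_eqF.
rewrite e hVW; move: FK d1 d2 hF; rewrite !ler_norml.
move=> /andP[? ?] /andP[? ?] /andP[? ?] /andP[? ?]; apply/andP; split; lra.
Qed.

End join.

End gaussian_error.

(** * The blocking argument *)

(** A cell starting at [y] in coordinates shifted by [z] lies in a window starting at the truncated
    difference [y - z]; if [y < z], the window starts at 0 and its length still suffices. *)
Lemma window_bound (x y z w K : nat) : (w <= K)%N -> (y <= x + z)%N ->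
  (x + z < w + y)%N -> (y - z)%N%:Z <= x%:Z < ((y - z)%N + K)%:Z.
Proof. by move=> *; lia. Qed.

Section field_clt.
Context (disp : measure_display) (T : measurableType disp) (R : realType).
Context (P : probability T R) (d : nat) (r : R).
Context (B : nat -> seq (lattice d)) (Nb : nat -> nat).
Context (G : nat -> set (lattice d) -> set (set T)).
Hypothesis fs : field_system P r B Nb G.
Variables tau C0 : R.
Hypothesis C00 : 0 <= C0.
Implicit Types (Y : lattice d -> T -> R) (p q : pred (lattice d)).
Local Notation E := (Ex P).
Local Notation fsum := (fsum B).
Local Notation mass := (mass P B).
Local Notation adapted := (adapted G).

Definition bounded_by Y (s : R) := forall k t, `|Y k t| <= s.

Lemma bounded_bdd n Y s : adapted n Y -> bounded_by Y s -> forall k, bdd (Y k).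
Proof.
move=> aY bY k; split; last by exists s.
by apply: msr_measurable (aY k); exact: (fs_measurable fs).
Qed.

Lemma fsum_fourth_le : exists2 C : R, 0 <= C & forall s n Y p, adapted n Y ->
  centered P Y -> bounded_by Y s ->
  E (fun t => fsum n Y p t ^+ 4) <= C * (s ^+ 2 * mass n Y p + mass n Y p ^+ 2).
Proof.
have [C C_ge0 hC] := field_fourth_moment fs; exists C => // s n Y p aY cY sY.
have bY := bounded_bdd aY sY.
apply: le_trans (hC n Y p aY cY bY) _; rewrite ler_wpM2l// lerD2r mulr_sumr.
apply: ler_sum => k _; rewrite -ExZ; last exact/bdd_summable/bddX.
apply: le_Ex; [exact/bdd_summable/bddX|exact/summableZ/bdd_summable/bddX|].
move=> t; rewrite (exprM (Y k t) 2 2) expr2 ler_wpM2r ?sqr_ge0//.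
rewrite -(real_normK (num_real (Y k t))) ler_sqr ?nnegrE//.
by rewrite (le_trans _ (sY k t)).
Qed.

(** The error is linear in the mass with a small factor [s], so errors of many groups can be added.
    Boundedness by [s] and mass at most [s ^ 2] make the fourth moment of order [s ^ 2] times the
    mass; interpolation with the second moment makes the third of order [s] times the mass. *)
Lemma small_mass_gerr : exists2 K : R, 0 <= K & forall s n Y p, 0 < s -> s <= 1 ->
  adapted n Y -> centered P Y -> bounded_by Y s -> mass n Y p <= s ^+ 2 ->
  gerr P tau (fsum n Y p) (K * s * mass n Y p).
Proof.
have [D D1 hD] := field_second_moment fs; have [C C_ge0 hC] := fsum_fourth_le.
pose K := `|tau| ^+ 3 * (D + 2 * C) / 2 + (tau ^+ 2 / 2 * D) ^+ 2.
have D0 : 0 <= D by exact: le_trans D1.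
have K0 : 0 <= K.
  rewrite addr_ge0 ?sqr_ge0// divr_ge0// mulr_ge0 ?exprn_ge0//.
  by rewrite addr_ge0// mulr_ge0.
exists K => // s n Y p s0 s1 aY cY sY ms.
have bY := bounded_bdd aY sY; have LY k := bdd_L2 P (bY k).
set S := fsum n Y p; set m := mass n Y p in ms *.
have m0 : 0 <= m by exact: mass_ge0.
have bS : bdd S by exact: fsum_bdd.
have S2 : E (fun t => S t ^+ 2) <= D * m by case: (hD n Y p aY LY cY).
have S4 : E (fun t => S t ^+ 4) <= 2 * C * s ^+ 2 * m.
  apply: le_trans (hC s n Y p aY cY sY) _.
  rewrite -/m (mulrC 2) -!mulrA ler_wpM2l//.
  by have : m ^+ 2 <= s ^+ 2 * m; [rewrite expr2 ler_wpM2r|lra].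
have S3 : E (fun t => `|S t| ^+ 3) <= s * m * (D + 2 * C) / 2.
  have := Ex_normM_le s0 (bdd_L2 P bS) (bdd_L2 P (bddX 2 bS)).
  have -> : E (fun t => `|S t * S t ^+ 2|) = E (fun t => `|S t| ^+ 3).
    by apply: eq_Ex => t; rewrite -exprS normrX.
  have -> : E (fun t => (S t ^+ 2) ^+ 2) = E (fun t => S t ^+ 4).
    by apply: eq_Ex => t; rewrite -exprM.
  move=> /le_trans; apply; rewrite ler_pM2r ?invr_gt0//.
  have h1 : s * E (fun t => S t ^+ 2) <= s * (D * m) by rewrite ler_pM2l.
  have h2 : s^-1 * E (fun t => S t ^+ 4) <= s * (2 * C * m).
    have -> : s * (2 * C * m) = s^-1 * (2 * C * s ^+ 2 * m).
      by field; rewrite gt_eqF.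
    by rewrite ler_pM2l// invr_gt0.
  by lra.
have S0 : E S = 0 by exact: fsum_centered.
apply: gerr_le (gerr_taylor tau bS S0).
rewrite /K mulrDl mulrDl; apply: lerD.
  have -> : `|tau| ^+ 3 * (D + 2 * C) / 2 * s * m =
    `|tau| ^+ 3 * (s * m * (D + 2 * C) / 2) by field.
  by rewrite ler_wpM2l// exprn_ge0.
have t0 : 0 <= tau ^+ 2 / 2 by rewrite divr_ge0// sqr_ge0.
apply: (@le_trans _ _ ((tau ^+ 2 / 2 * (D * m)) ^+ 2)).
  have h : 0 <= tau ^+ 2 / 2 * (D * m) by apply: mulr_ge0 => //; exact: mulr_ge0.
  by rewrite ler_sqr ?nnegrE ?variance_arg_ge0//; exact: ler_wpM2l.
have -> : (tau ^+ 2 / 2 * (D * m)) ^+ 2 = (tau ^+ 2 / 2 * D) ^+ 2 * (m * m) by ring.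
rewrite -[leRHS]mulrA ler_wpM2l ?sqr_ge0// ler_wpM2r//.
by apply: le_trans ms _; rewrite expr2 ler_piMr// ltW.
Qed.

Lemma fsum_bigID n Y p q t : fsum n Y p t =
  fsum n Y (fun k => p k && q k) t + fsum n Y (fun k => p k && ~~ q k) t.
Proof. exact: bigID. Qed.

Lemma mass_bigID n Y p q : mass n Y p =
  mass n Y (fun k => p k && q k) + mass n Y (fun k => p k && ~~ q k).
Proof. exact: bigID. Qed.

Lemma mass_le n Y p q : (forall k, p k -> q k) -> mass n Y p <= mass n Y q.
Proof.
move=> pq; rewrite (mass_bigID n Y q p).
have -> : mass n Y p = mass n Y (fun k => q k && p k).
  by apply: eq_bigl => k; case pk : (p k); rewrite ?andbF// (pq _ pk).
by rewrite lerDl mass_ge0.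
Qed.

(** The gap width depends on [kap] and the fixed data, but not on [n] or [Y]. The clipping level [M]
    is chosen first, from uniform moment bounds, and only then the mixing level [a]. *)
Lemma fsum_join kap : 0 < kap -> exists2 m : nat, (0 < m)%N &
  forall n Y (u : 'I_d) (j : int) p q e1 e2, adapted n Y -> centered P Y ->
    bounded_by Y 1 -> mass n Y p <= C0 -> mass n Y q <= C0 ->
    (forall k, p k -> k \in B n -> k u <= j) ->
    (forall k, q k -> k \in B n -> j + m%:Z <= k u) ->
    gerr P tau (fsum n Y p) e1 -> gerr P tau (fsum n Y q) e2 ->
    gerr P tau (fun t => fsum n Y p t + fsum n Y q t) (e1 + 2 * e2 + kap).
Proof.
move=> kap0; have [D D1 hD] := field_second_moment fs.
have [C C_ge0 hC] := fsum_fourth_le.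
have D0 : 0 <= D by exact: le_trans D1.
pose V := D * C0; pose W := C * (C0 + C0 ^+ 2).
have V0 : 0 <= V by rewrite mulr_ge0.
have W0 : 0 <= W by rewrite mulr_ge0// addr_ge0// sqr_ge0.
pose x := kap / (4 * (tau ^+ 2 + 1)).
have t1 : 0 < tau ^+ 2 + 1 by rewrite ltr_wpDl// sqr_ge0.
have x0 : 0 < x by rewrite divr_gt0// mulr_gt0.
have tx : tau ^+ 2 * x <= kap / 4.
  have -> : kap / 4 = (tau ^+ 2 + 1) * x by rewrite /x; field; rewrite gt_eqF.
  by rewrite ler_pM2r// lerDl.
pose M := 1 + (V ^+ 2 + (V + W)) / x.
have M1 : 1 <= M.
  rewrite lerDl; apply: divr_ge0; last exact: ltW.
  by apply: addr_ge0; [exact: sqr_ge0|exact: addr_ge0].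
have M0 : 0 < M by exact: lt_le_trans M1.
have hM : (V / M) ^+ 2 + (V + W) / M <= x.
  have h1 : (V / M) ^+ 2 <= V ^+ 2 / M.
    rewrite exprMn ler_wpM2l ?sqr_ge0// exprVn lef_pV2 ?posrE ?exprn_gt0//.
    by rewrite expr2 ler_peMr// ltW.
  apply: le_trans (lerD h1 (lexx _)) _.
  rewrite -mulrDl ler_pdivrMr// /M mulrDr mulrC mul1r [x * _]mulrC divfK ?gt_eqF//.
  by rewrite lerDr ltW.
(* The first bound makes [8 * a] at most [kap / 2]; the second makes the clipped covariance at most
   [x], even after the factor [M ^ 2]. *)
pose a := Num.min (kap / 16) (x / (4 * M ^+ 2)).
have a0 : 0 < a by rewrite lt_min !divr_gt0// mulr_gt0// exprn_gt0.
have a1 : 8 * a <= kap / 2.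
  by have : a <= kap / 16; [rewrite ge_min lexx|lra].
have a2 : 4 * a * M ^+ 2 <= x.
  have : a <= x / (4 * M ^+ 2) by rewrite ge_min lexx orbT.
  by rewrite ler_pdivlMr ?mulr_gt0 ?exprn_gt0//; lra.
have [m m0 hm] := fs_alpha fs a0; exists m => //.
move=> n Y u j p q e1 e2 aY cY bY1 mp mq pj qj hp hq.
have bY := bounded_bdd aY bY1; have LY k := bdd_L2 P (bY k).
have m2 p' : mass n Y p' <= C0 -> E (fun t => fsum n Y p' t ^+ 2) <= V.
  by move=> h; have [/le_trans->//] := hD n Y p' aY LY cY; rewrite ler_wpM2l.
have m4 p' : mass n Y p' <= C0 -> E (fun t => fsum n Y p' t ^+ 4) <= W.
  move=> h; apply: le_trans (hC 1 n Y p' aY cY bY1) _; rewrite ler_wpM2l//.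
  have := mass_ge0 P B n Y p'; rewrite expr1n mul1r => h0.
  by rewrite lerD// ler_sqr ?nnegrE.
have Gm Q : G n Q `<=` measurable by exact: (fs_measurable fs).
have mfp : msr (G n [set k | k u <= j]) (fsum n Y p).
  by apply: (fsum_msr fs) => // k kB pk /=; exact: pj.
have mfq : msr (G n [set k | j + m%:Z <= k u]) (fsum n Y q).
  by apply: (fsum_msr fs) => // k kB qk /=; exact: qj.
have GH := hm n u j.
have bp : bdd (fsum n Y p) by exact: fsum_bdd.
have bq : bdd (fsum n Y q) by exact: fsum_bdd.
have c0 p' : E (fsum n Y p') = 0 by exact: fsum_centered.
have cov := cov_moment_le (Gm _) (Gm _) GH M0 mfp mfq bp bq (c0 _) (c0 _)
  (m2 _ mp) (m2 _ mq) (m4 _ mp) (m4 _ mq).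
apply: gerr_le (gerr_join (Gm _) (Gm _) GH mfp mfq bp bq cov hp hq).
have : tau ^+ 2 * (4 * a * M ^+ 2 + (V / M) ^+ 2 + (V + W) / M) <= tau ^+ 2 * (2 * x).
  by rewrite ler_wpM2l ?sqr_ge0//; lra.
by lra.
Qed.

Definition width_from n m (K : nat) p := forall u : 'I_d, (m <= u)%N ->
  exists a : nat, forall k, k \in B n -> p k -> a%:Z <= k u < (a + K)%:Z.

(** Subtracting the window origins embeds the sites into functions with values below [K]. The
    codomain ['I_K.+1] keeps [inord] available when [K = 0]. *)
Lemma count_width n K p : width_from n 0 K p ->
  (size [seq k <- B n | p k] <= K.+1 ^ d)%N.
Proof.
move=> hw; have [a ha] := boolp.choice (fun u : 'I_d => hw u (leq0n u)).
pose f (k : lattice d) : {ffun 'I_d -> 'I_K.+1} :=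
  [ffun u => inord (`|k u| - a u)%N].
have -> : (K.+1 ^ d)%N = size (enum {: {ffun 'I_d -> 'I_K.+1}}).
  by rewrite -cardE card_ffun !card_ord.
rewrite -(size_map f); apply: uniq_leq_size; last by move=> g _; rewrite mem_enum.
rewrite map_inj_in_uniq ?filter_uniq ?(fs_uniq fs)// => k k'.
rewrite !mem_filter => /andP[pk kB] /andP[pk' kB'] /ffunP ff; apply/ffunP => u.
have := ff u; rewrite !ffunE => /(congr1 val) /=.
have /andP[h1 h2] := ha u k kB pk; have /andP[h1' h2'] := ha u k' kB' pk'.
have k0 : 0 <= k u by exact: le_trans h1.
have k0' : 0 <= k' u by exact: le_trans h1'.
move: h1 h2 h1' h2'; rewrite -(gez0_abs k0) -(gez0_abs k0').
move: `|k u|%N `|k' u|%N => x x'; rewrite !lez_nat !ltz_nat => h1 h2 h1' h2'.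
have s1 : (x - a u < K.+1)%N by rewrite ltn_subLR// addnS ltnS ltnW.
have s2 : (x' - a u < K.+1)%N by rewrite ltn_subLR// addnS ltnS ltnW.
by rewrite !inordK// => e; rewrite -(subnK h1) -(subnK h1') e.
Qed.

(** The induction statement: coordinates from [m] on are confined to windows of length [K], and [e0]
    depends on [K] and [e] only. At [m = d] the confinement is vacuous. *)
Let clt_claim m := forall (K : nat) (e : R), 0 < e -> exists2 e0 : R, 0 < e0 &
  forall n Y p, adapted n Y -> centered P Y -> bounded_by Y e0 ->
    mass n Y p <= C0 -> width_from n m K p -> gerr P tau (fsum n Y p) e.

(** At most [N] sites remain, each bounded by [th / N]; the sum is bounded by [th] and is compared
    with 0. *)
Lemma clt_claim0 : clt_claim 0.
Proof.
move=> K e e_gt0; pose c := `|tau| + tau ^+ 2 * 2 + 1.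
have c0 : 0 < c by rewrite ltr_wpDl// addr_ge0// mulr_ge0// sqr_ge0.
pose th := Num.min 1 (e / c).
have th0 : 0 < th by rewrite lt_min ltr01 divr_gt0.
have th1 : th <= 1 by rewrite ge_min lexx.
have the : th * c <= e by rewrite -ler_pdivlMr// ge_min lexx orbT.
pose N : R := (K.+1 ^ d)%:R.
have N0 : 0 < N by rewrite ltr0n expn_gt0.
exists (th / N); first by rewrite divr_gt0.
move=> n Y p aY cY bY _ hw.
have bS : bdd (fsum n Y p) by apply: fsum_bdd; exact: bounded_bdd bY.
have Sth t : `|fsum n Y p t| <= th.
  apply: le_trans (ler_norm_sum _ _ _) _; rewrite -big_filter.
  apply: (@le_trans _ _ (\sum_(k <- [seq k <- B n | p k]) th / N)).
    by apply: ler_sum => k _; exact: bY.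
  rewrite big_const_seq count_predT iter_addr_0 -mulr_natr -mulrA ler_piMr ?(ltW th0)//.
  by rewrite mulrC ler_pdivrMr// mul1r ler_nat count_width.
have S2 t : fsum n Y p t ^+ 2 <= th ^+ 2.
  by rewrite -(real_normK (num_real (fsum n Y p t))) ler_sqr ?nnegrE// ltW.
have ES2 : E (fun t => fsum n Y p t ^+ 2) <= th ^+ 2.
  rewrite -[leRHS](Ex_cst P); apply: le_Ex => //; last exact: summable_cst.
  exact/bdd_summable/bddX.
have L0 := bdd_L2 P (bdd_cst T (0 : R)).
apply: gerr_le (gerr_perturb (W := 1) th0 (bdd_L2 P bS) L0 _ _ (gerr0 P tau)).
- apply: le_trans the; rewrite /c; have := sqr_ge0 tau; nra.
- by under eq_Ex do rewrite subr0.
- under eq_Ex do rewrite addr0.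
  by apply: le_trans ES2 _; rewrite expr_le1// ltW.
Qed.

(** * Periodic gaps and the choice of their phase *)

Section periodic_gaps.
Context (n : nat) (u : 'I_d) (g H : nat).
Hypotheses (g0 : (0 < g)%N) (H0 : (0 < H)%N).

Definition shifted (o : nat) (k : lattice d) := (`|k u| + o * g)%N.

(** In shifted coordinates each period of length [H * g] begins with a gap of length [g]; changing
    the phase [o] moves the gaps by multiples of [g]. *)
Definition in_gap o k := (shifted o k %% (H * g) < g)%N.

(** Being in the gap of phase [i] means that [|k u| %/ g + i] is 0 modulo [H], which determines [i]
    among the residues. *)
Lemma in_gap_uniq k o o' : (o < H)%N -> (o' < H)%N ->
  in_gap o k -> in_gap o' k -> o = o'.
Proof.
move=> oH o'H.
have gE i : in_gap i k = (`|k u| %/ g + i == 0 %[mod H])%N.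
  rewrite /in_gap -[ltnRHS]mul1n -ltn_divLR// -modn_divl /shifted.
  rewrite [X in (X %/ g)%N]addnC divnMDl// [X in (X %% H)%N]addnC.
  by rewrite mod0n; case: (_ %% _)%N.
rewrite !gE => /eqP h1 /eqP h2; apply/eqP.
by rewrite -(modn_small oH) -(modn_small o'H) -(eqn_modDl (`|k u| %/ g)) h1 h2.
Qed.


(** Pigeonhole: the gap sets of the [H] phases are disjoint, so their masses sum to at most [C0] and
    one of them is at most the average. *)
Lemma light_gap Y p : mass n Y p <= C0 -> exists2 o, (o < H)%N &
  H%:R * mass n Y (fun k => p k && in_gap o k) <= C0.
Proof.
move=> mp; pose m o := mass n Y (fun k => p k && in_gap o k).
have sm : \sum_(o < H) m o <= C0.
  apply: le_trans mp; rewrite /m /mass.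
  under eq_bigr do rewrite big_mkcondr.
  rewrite exchange_big /=; apply: ler_sum => k _.
  have v0 : 0 <= E (fun t => Y k t ^+ 2) by apply: Ex_ge0 => t; exact: sqr_ge0.
  have [/existsP[i ko]|/existsPn ko] := boolP [exists i : 'I_H, in_gap i k].
    rewrite (bigD1 i)//= ko big1 ?addr0// => j ji.
    rewrite ifF//; apply: contraNF ji => ko'; apply/eqP/val_inj.
    exact: in_gap_uniq ko' ko.
  by rewrite big1// => o _; rewrite (negbTE (ko o)).
have [ho|ho] := pselect (exists o : 'I_H, H%:R * m o <= C0).
  by case: ho => o mo; exists o => //; exact: ltn_ord.
have no o : (o < H)%N -> 0 < H%:R * m o - C0.
  by move=> oH; rewrite subr_gt0 ltNge; apply/negP => mo; apply: ho; exists (Ordinal oH).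
have : \sum_(o < H) (H%:R * m o - C0) <= 0.
  rewrite sumrB -mulr_sumr sumr_const card_ord -[C0 *+ H]mulr_natl subr_le0.
  by rewrite ler_wpM2l.
rewrite leNgt => /negP[]; rewrite (bigD1 (Ordinal H0))//=.
apply: ltr_wpDr; last exact: no.
by apply: sumr_ge0 => o _; rewrite ltW// no.
Qed.

End periodic_gaps.

(** * Merging consecutive cells into light groups *)

Section merge.
Context (n : nat) (u : 'I_d) (g H o : nat) (kap de s L : R).
Context (Y : lattice d -> T -> R) (p : pred (lattice d)).
Hypotheses (g0 : (0 < g)%N) (H0 : (0 < H)%N).
Hypotheses (kap0 : 0 <= kap) (de0 : 0 <= de) (s0 : 0 < s) (L0 : 0 <= L).
Hypotheses (aY : adapted n Y) (cY : centered P Y) (bY : bounded_by Y 1).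
Hypothesis mp : mass n Y p <= C0.
Let w := (H * g)%N.
Let cell k := (shifted u g o k %/ w)%N.
Let open k := p k && ~~ in_gap u g H o k.
Let pre e k := open k && (cell k < e)%N.
Let seg c e k := open k && ((c <= cell k) && (cell k < e))%N.

Hypothesis join : forall (j : int) p1 p2 e1 e2,
  mass n Y p1 <= C0 -> mass n Y p2 <= C0 ->
  (forall k, p1 k -> k \in B n -> k u <= j) ->
  (forall k, p2 k -> k \in B n -> j + g%:Z <= k u) ->
  gerr P tau (fsum n Y p1) e1 -> gerr P tau (fsum n Y p2) e2 ->
  gerr P tau (fun t => fsum n Y p1 t + fsum n Y p2 t) (e1 + 2 * e2 + kap).
Hypothesis light : forall q, mass n Y q <= s -> gerr P tau (fsum n Y q) (L * mass n Y q).
Hypothesis thin : forall c, gerr P tau (fsum n Y (seg c c.+1)) de.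

Let w0 : (0 < w)%N. Proof. by rewrite muln_gt0 H0. Qed.

Let pre_cat c e t : (c <= e)%N ->
  fsum n Y (pre e) t = fsum n Y (pre c) t + fsum n Y (seg c e) t.
Proof.
move=> ce; rewrite (fsum_bigID _ _ _ (fun k => (cell k < c)%N)); congr (_ + _).
  congr (fsum n Y _ t); apply/funext => k; rewrite /pre -andbA; congr (_ && _).
  by apply/andP/idP => [[]//|h]; split => //; exact: leq_trans h ce.
congr (fsum n Y _ t); apply/funext => k; rewrite /pre /seg -andbA -leqNgt.
by rewrite [X in _ && X]andbC.
Qed.

Let mass_pre_cat c e : (c <= e)%N ->
  mass n Y (pre e) = mass n Y (pre c) + mass n Y (seg c e).
Proof.
move=> ce; rewrite (mass_bigID _ _ _ (fun k => (cell k < c)%N)); congr (_ + _).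
  congr (mass n Y _); apply/funext => k; rewrite /pre -andbA; congr (_ && _).
  by apply/andP/idP => [[]//|h]; split => //; exact: leq_trans h ce.
congr (mass n Y _); apply/funext => k; rewrite /pre /seg -andbA -leqNgt.
by rewrite [X in _ && X]andbC.
Qed.

Let pre_mass e : mass n Y (pre e) <= C0.
Proof. by apply: le_trans mp; apply: mass_le => k /andP[/andP[]]. Qed.

Let seg_mass c e : mass n Y (seg c e) <= C0.
Proof. by apply: le_trans mp; apply: mass_le => k /andP[/andP[]]. Qed.

Let join_pre c e e1 e2 : (c <= e)%N -> gerr P tau (fsum n Y (pre c)) e1 ->
  gerr P tau (fsum n Y (seg c e)) e2 ->
  gerr P tau (fsum n Y (pre e)) (e1 + 2 * e2 + kap).
Proof.
move=> ce h1 h2; have -> : fsum n Y (pre e) =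
    (fun t => fsum n Y (pre c) t + fsum n Y (seg c e) t).
  by apply/funext => t; exact: pre_cat.
(* Original coordinate of the last position before cell [c]. Cell [c] begins with its gap, so the
   open sites from there on have shifted coordinate at least [c * w + g]. *)
apply: (join (j := (c * w)%N%:Z - 1 - (o * g)%N%:Z)) => //.
- move=> k /andP[_ kc] kB; have /andP[k0 _] := fs_bound fs kB u.
  move: kc; rewrite /cell ltn_divLR// /shifted => kc.
  rewrite -(gez0_abs k0); move: kc.
  by move: (c * w)%N (o * g)%N `|k u|%N => x y z; lia.
- move=> k /andP[/andP[_ kg] /andP[kc _]] kB.
  have /andP[k0 _] := fs_bound fs kB u.
  move: kg; rewrite /in_gap -leqNgt -/w => kg.
  have : (c * w + g <= shifted u g o k)%N.
    by rewrite (divn_eq (shifted u g o k) w) leq_add// leq_mul2r kc orbT.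
  rewrite /shifted -(gez0_abs k0).
  by move: (c * w)%N (o * g)%N `|k u|%N => x y z; lia.
Qed.

(** Price of one heavy step: [2 * de + kap] for appending a thin cell and [kap] for appending the
    light group, whose own error is charged to its mass. *)
Let cost := 2 * de + 2 * kap.

(* Induction on [c]: extend the last group [seg c e] to the left while it stays
   light; when cell [c] makes it heavy, pay for the two joins with the mass
   [> s] that is consumed. *)
Lemma merge_gerr c e : (c <= e)%N -> mass n Y (seg c e) <= s ->
  gerr P tau (fsum n Y (pre e))
    (cost * (mass n Y (pre e) / s + 1) + 2 * L * mass n Y (pre e)).
Proof.
have cost0 : 0 <= cost by rewrite addr_ge0// mulr_ge0.
elim: c e => [|c IH] e ce hs.
  have e0 : seg 0 e = pre e by apply/funext => k; rewrite /seg /pre leq0n.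
  rewrite e0 in hs; apply: gerr_le (light hs).
  have m0 := mass_ge0 P B n Y (pre e).
  have : 0 <= cost * (mass n Y (pre e) / s + 1).
    by rewrite mulr_ge0// addr_ge0// divr_ge0// ltW.
  have : 0 <= L * mass n Y (pre e) by rewrite mulr_ge0.
  by lra.
have [hs'|hs'] := leP (mass n Y (seg c e)) s; first exact: IH (ltnW ce) hs'.
have m0 : mass n Y (seg c c) <= s.
  rewrite /mass big_pred0 ?ltW// => k; rewrite /seg.
  by case: leqP; rewrite ?andbF.
have h1 := IH c (leqnn c) m0.
have h2 := join_pre (leqnSn c) h1 (thin c).
have h3 := join_pre ce h2 (light hs).
apply: gerr_le h3.
have M1 := mass_pre_cat (ltnW ce); have M2 := mass_pre_cat ce.
have M3 := mass_pre_cat (leqnSn c).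
(* Passing from [pre c] to [pre e] consumes mass above [s], hence at least one unit of [mass / s]:
   exactly one [cost]. *)
have k1 : mass n Y (pre c) / s + 1 <= mass n Y (pre e) / s.
  rewrite M1 mulrDl lerD2l ler_pdivlMr// mul1r; exact: ltW.
have k2 : cost * (mass n Y (pre c) / s + 1) <= cost * (mass n Y (pre e) / s).
  exact: ler_wpM2l.
have k3 : L * (mass n Y (pre c) + mass n Y (seg c.+1 e)) <= L * mass n Y (pre e).
  by apply: ler_wpM2l => //; rewrite M2 lerD2r M3 lerDl mass_ge0.
rewrite /cost in k2 *; lra.
Qed.

Lemma merged_gerr : gerr P tau (fsum n Y open)
  (cost * (C0 / s + 1) + 2 * L * C0).
Proof.
(* Larger than every cell index, since a cell index is at most the shifted coordinate. *)
pose e := (Nb n + o * g)%N.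
have eo : fsum n Y open = fsum n Y (pre e).
  rewrite /fsum; apply/funext => t; rewrite big_seq_cond [RHS]big_seq_cond.
  apply: eq_bigl => k; rewrite /pre; case kB : (k \in B n) => //=.
  have /andP[k0 kN] := fs_bound fs kB u.
  have -> : (cell k < e)%N; last by rewrite andbT.
  apply: leq_ltn_trans (leq_div _ _) _; rewrite /shifted /e ltn_add2r.
  by rewrite -ltz_nat gez0_abs.
have cost0 : 0 <= cost by rewrite addr_ge0// mulr_ge0.
have m0 : mass n Y (seg e e) <= s.
  rewrite /mass big_pred0 ?ltW// => k; rewrite /seg.
  by case: leqP; rewrite ?andbF.
rewrite eo; apply: gerr_le (merge_gerr (leqnn e) m0).
apply: lerD; last by rewrite ler_wpM2l// mulr_ge0.
by rewrite ler_wpM2l// lerD2r ler_pM2r// invr_gt0.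
Qed.

End merge.

(** Cells are thin in coordinate [m] and fall under the induction hypothesis. The budget is [e / 4]
    each for the light groups, for the joins together with the thin cells, and for deleting the
    gaps. *)
Lemma clt_claimS m : (m < d)%N -> clt_claim m -> clt_claim m.+1.
Proof.
move=> md IH K e e_gt0; pose u := Ordinal md.
have [D D1 hD] := field_second_moment fs.
have D0 : 0 < D by exact: lt_le_trans D1.
have [L L0 hL] := small_mass_gerr.
pose s := Num.min 1 (e / (8 * (L * C0 + 1))).
have LC : 0 < L * C0 + 1 by rewrite ltr_wpDl// mulr_ge0.
have s0 : 0 < s by rewrite lt_min ltr01 divr_gt0// mulr_gt0.
have s1 : s <= 1 by rewrite ge_min lexx.
have hs : 2 * (L * s) * C0 <= e / 4.
  have : s <= e / (8 * (L * C0 + 1)) by rewrite ge_min lexx orbT.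
  rewrite ler_pdivlMr ?mulr_gt0//.
  have := ltW s0; lra.
(* Bounds the number of times that [cost] is paid, the mass threshold being [s ^ 2]; [x] is then the
   tolerance for each join and each thin cell. *)
pose N := C0 / s ^+ 2 + 1.
have N1 : 1 <= N by rewrite lerDr divr_ge0// exprn_ge0// ltW.
have N0 : 0 < N by exact: lt_le_trans N1.
pose x := e / (16 * N).
have x0 : 0 < x by rewrite divr_gt0// mulr_gt0.
have hx : (2 * x + 2 * x) * N <= e / 4.
  by rewrite /x le_eqVlt; apply/orP; left; apply/eqP; field; rewrite gt_eqF.
have [g g0 hg] := fsum_join x0.
pose W := 4 * (D * C0).
have DC : 0 <= D * C0 by rewrite mulr_ge0// ltW.
have W0 : 0 <= W by rewrite mulr_ge0.
pose c := `|tau| + tau ^+ 2 * (1 + W) + 1.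
have c0 : 0 < c.
  by rewrite ltr_wpDl// addr_ge0// mulr_ge0 ?sqr_ge0// addr_ge0.
pose th := e / (4 * c).
have th0 : 0 < th by rewrite divr_gt0// mulr_gt0.
have hth : `|tau| * th + tau ^+ 2 * th * (1 + W) <= e / 4.
  have : th * c = e / 4 by rewrite /th; field; rewrite gt_eqF.
  by rewrite /c; lra.
(* With [H] phases the lightest gap has mass at most [C0 / H], so the deleted sum has second moment
   at most [th ^ 2]. *)
pose H := (Num.bound (D * C0 / th ^+ 2)).+1.
have hH : D * (C0 / H%:R) <= th ^+ 2.
  rewrite mulrA ler_pdivrMr ?ltr0n// [leRHS]mulrC -ler_pdivrMr ?exprn_gt0//.
  have : 0 <= D * C0 / th ^+ 2 by rewrite divr_ge0// sqr_ge0.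
  move=> /archi_boundP /ltW h; apply: le_trans h _.
  by rewrite ler_nat.
(* A cell has width at most [H * g] in coordinate [m] and [K] in the later ones; one common bound is
   passed on. *)
have [e1 e10 he1] := IH (maxn K (H * g)) x x0.
exists (Num.min e1 s); first by rewrite lt_min e10.
move=> n Y p aY cY bY mp hw.
have bYs : bounded_by Y s by move=> k t; apply: le_trans (bY k t) _; rewrite ge_min lexx orbT.
have bYe : bounded_by Y e1 by move=> k t; apply: le_trans (bY k t) _; rewrite ge_min lexx.
have bY1 : bounded_by Y 1 by move=> k t; apply: le_trans (bYs k t) s1.
have H0 : (0 < H)%N by [].
have [i iH hi] := @light_gap n u g H g0 H0 Y p mp.
pose q k := p k && ~~ in_gap u g H i k.
have bdY := bounded_bdd aY bYs; have LY k := bdd_L2 P (bdY k).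
have hq : gerr P tau (fsum n Y q) ((2 * x + 2 * x) * N + 2 * (L * s) * C0).
  apply: (@merged_gerr n u g H i x x (s ^+ 2) (L * s) Y p) => //.
  - exact: ltW.
  - exact: ltW.
  - by rewrite exprn_gt0.
  - by rewrite mulr_ge0// ltW.
  - by move=> j p1 p2 f1 f2; exact: hg.
  - by move=> q' hq'; exact: hL.
  move=> c'; apply: he1 => //.
    by apply: le_trans mp; apply: mass_le => k /andP[/andP[]].
  move=> v; rewrite leq_eqVlt => /orP[/eqP mv|mv].
    have -> : v = u by apply: val_inj.
    exists (c' * (H * g) - i * g)%N => k kB /andP[_ /andP[h1 h2]].
    have /andP[k0 _] := fs_bound fs kB u.
    have w0 : (0 < H * g)%N by rewrite muln_gt0.
    move: h1 h2; rewrite leq_divRL// ltn_divLR// /shifted mulSn -(gez0_abs k0).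
    by move=> h1 h2; apply: window_bound (leq_maxr _ _) h1 h2.
  have [a ha] := hw v mv; exists a => k kB /andP[/andP[pk _] _].
  have /andP[-> h] := ha k kB pk; apply: lt_le_trans h _.
  by rewrite lez_nat leq_add2l leq_maxl.
have mg : mass n Y (fun k => p k && in_gap u g H i k) <= C0 / H%:R.
  by rewrite ler_pdivlMr ?ltr0n// mulrC.
have Eg : E (fun t => (fsum n Y p t - fsum n Y q t) ^+ 2) <= th ^+ 2.
  have -> : E (fun t => (fsum n Y p t - fsum n Y q t) ^+ 2) =
      E (fun t => fsum n Y (fun k => p k && in_gap u g H i k) t ^+ 2).
    by apply: eq_Ex => t; rewrite (fsum_bigID _ _ p (in_gap u g H i)) addrK.
  have [h _] := hD n Y (fun k => p k && in_gap u g H i k) aY LY cY.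
  by apply: le_trans h (le_trans _ hH); rewrite ler_pM2l.
have m2 p' : mass n Y p' <= C0 -> E (fun t => fsum n Y p' t ^+ 2) <= D * C0.
  by move=> h; have [/le_trans->//] := hD n Y p' aY LY cY; rewrite ler_pM2l.
have mq : mass n Y q <= C0 by apply: le_trans mp; apply: mass_le => k /andP[].
have Lp := fsum_L2 B n p LY; have Lq := fsum_L2 B n q LY.
have Es : E (fun t => (fsum n Y p t + fsum n Y q t) ^+ 2) <= W.
  apply: (@le_trans _ _ (E (fun t => 2 * fsum n Y p t ^+ 2 + 2 * fsum n Y q t ^+ 2))).
    apply: le_Ex; first exact/L2_sqr/L2D.
      by apply: summableD; exact/summableZ/L2_sqr.
    by move=> t; have := sqr_ge0 (fsum n Y p t - fsum n Y q t); lra.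
  rewrite ExD; [|exact/summableZ/L2_sqr..].
  rewrite !ExZ; [|exact/L2_sqr..].
  by have := m2 p mp; have := m2 q mq; rewrite /W; lra.
apply: gerr_le (gerr_perturb th0 Lp Lq Eg Es hq).
lra.
Qed.

Lemma field_clt (e : R) : 0 < e -> exists2 e0 : R, 0 < e0 &
  forall n Y, adapted n Y -> centered P Y -> bounded_by Y e0 ->
    mass n Y xpredT <= C0 -> gerr P tau (fsum n Y xpredT) e.
Proof.
move=> e_gt0; have H m : (m <= d)%N -> clt_claim m.
  elim: m => [_|m IH md]; first exact: clt_claim0.
  exact: clt_claimS (IH (ltnW md)).
have [e0 e00 he0] := H d (leqnn d) 0%N e e_gt0; exists e0 => // n Y aY cY bY mY.
by apply: he0 => // u; rewrite leqNgt ltn_ord.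
Qed.

End field_clt.

(** * The Gaussian characteristic function *)

Section gaussian_characteristic_function.
Context (R : realType).
Local Notation mu := (@lebesgue_measure R).
Local Notation psi := (@normal_pdf R 0 1).
Implicit Types (h k : R -> R).

Let psi_ge0 (x : R) : 0 <= psi x. Proof. exact: normal_pdf_ge0. Qed.

Let psiE (x : R) : psi x = normal_peak 1 * expR (- (x ^+ 2 / 2)).
Proof.
rewrite normal_pdfE ?oner_neq0// /normal_fun subr0 expr1n.
by rewrite mulNr mulr2n.
Qed.

(** A class integrable against the normal density that contains both sides of Stein's identity and
    the remainders of differentiation in the frequency. *)
Definition quadratic_growth h := measurable_fun setT h /\
  exists2 C : R, 0 <= C & forall x, `|h x| <= C * (1 + x ^+ 2).

(** Domination by a multiple of the normal density of variance 2, because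
    [x ^ 2 * expR (- (x ^ 2 / 4)) <= 4]. *)
Let sqr_pdf_integrable : mu.-integrable setT (EFin \o (fun x => x ^+ 2 * psi x)).
Proof.
pose s : R := Num.sqrt 2.
have s2 : s ^+ 2 = 2 by rewrite sqr_sqrtr.
have s0 : s != 0 by rewrite gt_eqF// sqrtr_gt0.
have p0 : 0 < normal_peak s by exact: normal_peak_gt0.
pose c : R := 4 * normal_peak 1 / normal_peak s.
have c0 : 0 <= c.
  by apply: divr_ge0; [rewrite mulr_ge0// normal_peak_ge0|exact: ltW].
have := integrableZl measurableT c (integrable_normal_pdf 0 s).
apply: le_integrable => //.
  apply/measurable_EFinP; apply: measurable_funM; first exact: exprn_measurable.
  exact: measurable_normal_pdf.
move=> x _ /=; rewrite lee_fin.
rewrite normrM (ger0_norm (sqr_ge0 x)) (ger0_norm (psi_ge0 x)).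
rewrite ger0_norm; last by rewrite mulr_ge0// normal_pdf_ge0.
rewrite psiE (normal_pdfE _ s0) /normal_fun subr0 s2.
have -> : c * (normal_peak s * expR (- x ^+ 2 / (2 *+ 2))) =
    normal_peak 1 * (4 * expR (- x ^+ 2 / (2 *+ 2))).
  by rewrite /c; field; rewrite gt_eqF.
rewrite mulrCA ler_wpM2l ?normal_peak_ge0//.
have -> : expR (- (x ^+ 2 / 2)) = expR (- x ^+ 2 / (2 *+ 2)) * expR (- (x ^+ 2 / 4)).
  by rewrite -expRD; congr expR; rewrite -mulr_natr; field.
rewrite (mulrC 4) mulrCA ler_wpM2l ?expR_ge0// expRN ler_pdivrMr ?expR_gt0//.
by have := expR_ge1Dx (x ^+ 2 / 4); lra.
Qed.

Lemma quadratic_pdf_integrable h : quadratic_growth h ->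
  mu.-integrable setT (EFin \o (fun x => h x * psi x)).
Proof.
move=> [mh [C C0 hC]].
have i0 := integrable_normal_pdf (0 : R) 1.
have := integrableZl measurableT C (integrableD measurableT i0 sqr_pdf_integrable).
apply: le_integrable => //.
  by apply/measurable_EFinP; apply: measurable_funM => //; exact: measurable_normal_pdf.
move=> x _ /=; rewrite lee_fin normrM (ger0_norm (psi_ge0 x)).
rewrite [leRHS]ger0_norm; last by rewrite mulr_ge0// addr_ge0// mulr_ge0// sqr_ge0.
have -> : C * (psi x + x ^+ 2 * psi x) = C * (1 + x ^+ 2) * psi x by ring.
by rewrite ler_wpM2r.
Qed.

Let J h := \int[mu]_x (h x * psi x).

Let J_eq h k : h =1 k -> J h = J k.
Proof. by move=> /funext ->. Qed.

Let JD h k : quadratic_growth h -> quadratic_growth k ->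
  J (fun x => h x + k x) = J h + J k.
Proof.
move=> qh qk; rewrite /J -RintegralD//; [|exact: quadratic_pdf_integrable..].
by apply: eq_Rintegral => x _; rewrite mulrDl.
Qed.

Let JZ c h : quadratic_growth h -> J (fun x => c * h x) = c * J h.
Proof.
move=> qh; rewrite /J -RintegralZl//; last exact: quadratic_pdf_integrable.
by apply: eq_Rintegral => x _; rewrite mulrA.
Qed.

Let qD h k : quadratic_growth h -> quadratic_growth k ->
  quadratic_growth (fun x => h x + k x).
Proof.
move=> [mh [C C0 hC]] [mk [C' C0' hC']]; split; first exact: measurable_funD.
exists (C + C') => [|x]; first exact: addr_ge0.
by rewrite mulrDl; apply: le_trans (ler_normD _ _) _; exact: lerD.
Qed.

Let qZ c h : quadratic_growth h -> quadratic_growth (fun x => c * h x).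
Proof.
move=> [mh [C C0 hC]]; split; first exact: measurable_funM.
exists (`|c| * C) => [|x]; first exact: mulr_ge0.
by rewrite normrM -mulrA ler_wpM2l.
Qed.

Let q_bounded h (C : R) : measurable_fun setT h -> (forall x, `|h x| <= C) ->
  quadratic_growth h.
Proof.
move=> mh hC; have C0 : 0 <= C by apply: le_trans (hC 0).
split => //; exists C => // x; apply: le_trans (hC x) _.
by rewrite ler_peMr// lerDl sqr_ge0.
Qed.

Let J_le h k : quadratic_growth h -> quadratic_growth k ->
  (forall x, `|h x| <= k x) -> `|J h| <= J k.
Proof.
move=> qh qk hk; have ih := quadratic_pdf_integrable qh.
apply: le_trans (le_normr_Rintegral _ ih) _ => //.
apply: le_Rintegral => //.
- exact: (integrable_norm ih).
- exact: quadratic_pdf_integrable.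
- by move=> x _; rewrite normrM (ger0_norm (psi_ge0 x)) ler_wpM2r.
Qed.

Let q2 : quadratic_growth (fun x => 1 + x ^+ 2).
Proof.
split; first by apply: measurable_funD => //; exact: exprn_measurable.
by exists 1 => // x; rewrite mul1r ger0_norm// addr_ge0// sqr_ge0.
Qed.

Let K := J (fun x => 1 + x ^+ 2).

Let K0 : 0 <= K.
Proof.
by apply: Rintegral_ge0 => x _; rewrite mulr_ge0// addr_ge0// sqr_ge0.
Qed.

Section stein.
Variables (tau b : R).

Let measurable_trig (f : R -> R) : continuous f ->
  measurable_fun setT (fun x => f (tau * x + b)).
Proof.
move=> cf; apply: measurableT_comp; first exact: continuous_measurable_fun.
by apply: measurable_funD => //; exact: measurable_funM.
Qed.

Let ms := measurable_trig (@continuous_sin R).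
Let mc := measurable_trig (@continuous_cos R).

Let sin1 x : `|sin (tau * x + b)| <= 1.
Proof. by rewrite ler_norml sin_geN1 sin_le1. Qed.
Let cos1 x : `|cos (tau * x + b)| <= 1.
Proof. by rewrite ler_norml cos_geN1 cos_le1. Qed.

Let qc : quadratic_growth (fun x => cos (tau * x + b)).
Proof. exact: q_bounded cos1. Qed.

Let qxs : quadratic_growth (fun x => x * sin (tau * x + b)).
Proof.
split; first exact: measurable_funM.
exists 1 => // x; rewrite mul1r normrM.
have := real_normK (num_real x); have := sin1 x; have := normr_ge0 x.
set y := `|x|; set z := `|sin _| => y0 z1 <-.
have z0 : 0 <= z by exact: normr_ge0.
have := sqr_ge0 (y - 1); nra.
Qed.

Let k x := tau * cos (tau * x + b) + (-1) * (x * sin (tau * x + b)).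

Let qk : quadratic_growth k. Proof. by apply: qD; exact: qZ. Qed.

Let F x := sin (tau * x + b) * psi x.

Let psi_derive (x : R) : is_derive x (1 : R) psi (- x * psi x).
Proof.
have -> : psi = (fun x => normal_peak 1 * expR (- (x ^+ 2 / 2))).
  by apply/funext => y; exact: psiE.
have h1 : is_derive x (1 : R) (fun y => - (y ^+ 2 / 2)) (- (2 * x * 2^-1)).
  exact: is_deriveN (is_derive_sqr_mulr 2^-1 x).
have h2 := @is_derive1_comp R expR (fun y => - (y ^+ 2 / 2)) x _ _
  (is_derive_expR (- (x ^+ 2 / 2))) h1.
apply: (is_derive_eq (is_deriveZ (normal_peak 1) h2)).
by rewrite /GRing.scale /=; field.
Qed.

Let F_derive (x : R) : is_derive x (1 : R) F (k x * psi x).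
Proof.
have h1 : is_derive x (1 : R) (fun y => tau * y + b) tau.
  rewrite -[X in is_derive _ _ _ X]addr0.
  apply: (is_deriveD _ (is_derive_cst b x 1)).
  apply: (is_derive_eq (is_deriveZ tau (is_derive_id x 1))).
  by rewrite /GRing.scale /= mulr1.
have h2 := @is_derive1_comp R sin (fun y => tau * y + b) x _ _
  (is_derive_sin (tau * x + b)) h1.
apply: (is_derive_eq (is_deriveM h2 (psi_derive x))).
by rewrite /GRing.scale /k /=; ring.
Qed.

Let continuous_kpsi : continuous (fun x => k x * psi x).
Proof.
have ca : continuous (fun x : R => tau * x + b).
  move=> x; apply: continuousD; last exact: cst_continuous.
  by apply: continuousM; [exact: cst_continuous|exact: cvg_id].
move=> x; apply: continuousM; last exact: continuous_normal_pdf (oner_neq0 R) x.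
apply: continuousD; (apply: continuousM; first exact: cst_continuous).
  by apply: continuous_comp; [exact: ca|exact: continuous_cos].
apply: continuousM; first exact: cvg_id.
by apply: continuous_comp; [exact: ca|exact: continuous_sin].
Qed.

Let J_truncated (n : R) : 0 < n ->
  \int[mu]_(x in `[- n, n]) (k x * psi x) = F n - F (- n).
Proof.
move=> n0; have nn : - n < n by rewrite (lt_trans _ n0)// oppr_lt0.
have cF : continuous F.
  by move=> x; apply: differentiable_continuous; apply/derivable1_diffP; have [] := F_derive x.
rewrite /Rintegral (@continuous_FTC2 _ _ F)//.
- exact: continuous_subspaceT.
- split.
  + by move=> x _; have [] := F_derive x.
  + by apply: cvg_at_right_filter; exact: cF.
  + by apply: cvg_at_left_filter; exact: cF.
- by move=> x _; rewrite derive1E; have [_] := F_derive x.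
Qed.

Let psi_decay (x : R) : 0 < x -> psi x <= normal_peak 1 * x^-1.
Proof.
move=> x0; rewrite psiE ler_wpM2l ?normal_peak_ge0//.
rewrite expRN lef_pV2 ?posrE ?expR_gt0//.
by have := expR_ge1Dx (x ^+ 2 / 2); have := sqr_ge0 (x - 1); lra.
Qed.

(** Integration by parts: [k * psi] is the derivative of [F]. On [[-n, n]] its integral is a
    boundary term of order [psi n]; outside, [n <= |x|] gives
    [n * |k x| <= (|tau| + 1) (1 + x ^ 2)]. Both are of order [1 / n]. *)
Lemma gaussian_stein : J (fun x => x * sin (tau * x + b)) =
  tau * J (fun x => cos (tau * x + b)).
Proof.
suff : J k = 0.
  rewrite /k JD; [|exact: qZ..]; rewrite !JZ//; lra.
pose C := 2 * normal_peak 1 + (`|tau| + 1) * K.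
have C0 : 0 <= C.
  by apply: addr_ge0; apply: mulr_ge0; rewrite ?normal_peak_ge0// addr_ge0.
have bound (n : R) : 0 < n -> `|J k| <= C / n.
  move=> n0; have ni0 : 0 < n^-1 by rewrite invr_gt0.
  pose k1 x := k x * \1_`[- n, n] x; pose k2 x := k x * \1_(~` `[- n, n]) x.
  have qi (A : set R) : measurable A -> quadratic_growth (fun x => k x * \1_A x).
    move=> mA; case: qk => mk [C' C'0 hC']; split.
      by apply: measurable_funM => //; exact: measurable_indic.
    exists C' => // x; rewrite normrM; apply: le_trans (hC' x).
    by rewrite indicE; case: (_ \in _); rewrite ?normr1 ?normr0 ?mulr1 ?mulr0.
  have qk1 : quadratic_growth k1 by exact: qi.
  have qk2 : quadratic_growth k2 by apply: qi; exact: measurableC.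
  have -> : J k = J k1 + J k2.
    rewrite -JD//; apply: J_eq => x; rewrite /k1 /k2 -mulrDr !indicE in_setC.
    by case: (_ \in _); rewrite /= ?addr0 ?add0r mulr1.
  have e1 : J k1 = F n - F (- n).
    rewrite -J_truncated// Rintegral_mkcond; apply: eq_Rintegral => x _.
    by rewrite /k1 patchE indicE; case: (_ \in _); rewrite ?mulr1// mulr0 mul0r.
  have psiN (x : R) : psi (- x) = psi x by rewrite !psiE sqrrN.
  have F1 x : `|F x| <= psi x.
    by rewrite /F normrM (ger0_norm (psi_ge0 x)) ler_piMl.
  have h1 : `|J k1| <= 2 * normal_peak 1 / n.
    rewrite e1; apply: le_trans (ler_normB _ _) _.
    have := F1 n; have := F1 (- n); rewrite psiN; have := psi_decay n0; lra.
  have h2 : `|J k2| <= (`|tau| + 1) * K / n.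
    rewrite mulrC mulrA -JZ//; apply: J_le => //; first exact: qZ.
    move=> x; rewrite /k2 indicE; case: (boolP (x \in _)) => xn; last first.
      by rewrite mulr0 normr0 mulr_ge0 ?mulr_ge0 ?addr_ge0 ?sqr_ge0// ltW.
    rewrite mulr1 -(ler_pM2l n0) !mulrA divff ?gt_eqF// mul1r.
    have nx : n <= `|x|.
      move: xn; rewrite inE /= in_itv /= => /negP; rewrite -ler_norml -ltNge.
      exact: ltW.
    have := real_normK (num_real x); have := normr_ge0 x; set y := `|x| in nx *.
    move=> y0 <-; apply: (@le_trans _ _ (y * (`|tau| + y))).
      apply: ler_pM => //; first exact: ltW.
      apply: le_trans (ler_normD _ _) _.
      rewrite mulN1r normrN !normrM lerD//.
        by rewrite ler_piMr.
      by rewrite ler_piMr.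
    have := normr_ge0 tau; have := sqr_ge0 (y - 1); nra.
  by apply: le_trans (ler_normD _ _) _; rewrite /C mulrDl lerD.
apply/eqP; rewrite -normr_eq0 eq_le normr_ge0 andbT.
apply/ler_addgt0Pr => e e0; rewrite add0r.
have n0 : 0 < (C + 1) / e by rewrite divr_gt0// ltr_wpDl.
apply: le_trans (bound _ n0) _.
rewrite invf_div mulrCA ger_pMr// ler_pdivrMr ?mul1r ?lerDl//.
exact: ltr_wpDl.
Qed.

End stein.

(** Permits differentiation under the integral sign by integrating a pointwise quadratic Taylor
    bound. *)
Lemma quadratic_is_derive (f : R -> R) (x a C : R) :
  (forall y, `|f (x + y) - f x - y * a| <= C * y ^+ 2) ->
  is_derive x (1 : R) f a.
Proof.
move=> hf.
have cv : (fun h : R => h^-1 *: ((f \o shift x) (h *: 1) - f x)) @ 0^' --> a.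
  apply/cvgrPdist_le => e e0.
  have C1 : 0 < `|C| + 1 by rewrite ltr_wpDl.
  near=> h.
  have h0 : h != 0 by near: h; exact: nbhs_dnbhs_neq.
  have hp : 0 < `|h| by rewrite normr_gt0.
  have he : `|h| <= e / (`|C| + 1).
    near: h; apply: dnbhs0_le; exact: divr_gt0.
  rewrite distrC -(ler_pM2l hp) -normrM mulrBr /= [h *: 1]mulr1 -[h^-1 *: _]/(h^-1 * _).
  rewrite mulVKf// (addrC h x); apply: le_trans (hf h) _.
  rewrite -(real_normK (num_real h)) expr2 mulrCA ler_pM2l//.
  apply: (@le_trans _ _ (`|C| * `|h|)); first by rewrite ler_wpM2r// ler_norm.
  move: he; rewrite ler_pdivlMr//; lra.
by split; [apply/cvg_ex; exists a|exact: cvg_lim].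
Unshelve. all: by end_near. Qed.

(** As a function of the frequency the integral satisfies [f' = - t f] by Stein's identity, so
    [f t * expR (t ^ 2 / 2)] is constant. *)
Lemma gaussian_cos_pdf (tau b : R) :
  J (fun x => cos (tau * x + b)) = expR (- (tau ^+ 2 / 2)) * cos b.
Proof.
pose f t := J (fun x => cos (t * x + b)).
have mt (g : R -> R) t : continuous g -> measurable_fun setT (fun x : R => g (t * x + b)).
  move=> cg; apply: measurableT_comp; first exact: continuous_measurable_fun.
  by apply: measurable_funD => //; exact: measurable_funM.
have qcos t : quadratic_growth (fun x => cos (t * x + b)).
  apply: (@q_bounded _ 1); first exact: (mt _ t (@continuous_cos R)).
  by move=> x; rewrite ler_norml cos_geN1 cos_le1.
have qxsin t : quadratic_growth (fun x => x * sin (t * x + b)).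
  split; first by apply: measurable_funM => //; exact: (mt _ t (@continuous_sin R)).
  exists 1 => // x; rewrite mul1r normrM.
  have : `|sin (t * x + b)| <= 1 by rewrite ler_norml sin_geN1 sin_le1.
  have := real_normK (num_real x); have := normr_ge0 x.
  set y := `|x|; set z := `|sin _| => y0 <- z1.
  have z0 : 0 <= z by exact: normr_ge0.
  have := sqr_ge0 (y - 1); nra.
have df t : is_derive t (1 : R) f (- (t * f t)).
  apply: (@quadratic_is_derive _ _ _ K) => h.
  have -> : f (t + h) - f t - h * - (t * f t) =
      J (fun x => cos ((t + h) * x + b) + (-1 * cos (t * x + b) + h * (x * sin (t * x + b)))).
    rewrite (JD (qcos _)); last by apply: qD; exact: qZ.
    rewrite JD; [|exact: qZ..]; rewrite !JZ// gaussian_stein /f; ring.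
  rewrite mulrC -JZ//; apply: J_le; last 1 first.
  - move=> x; have := cosD_taylor1 (h * x) (t * x + b).
    have -> : h * x + (t * x + b) = (t + h) * x + b by ring.
    have -> : cos ((t + h) * x + b) - cos (t * x + b) + h * x * sin (t * x + b) =
      cos ((t + h) * x + b) + (-1 * cos (t * x + b) + h * (x * sin (t * x + b))) by ring.
    by move=> /le_trans; apply; rewrite exprMn ler_wpM2l ?sqr_ge0// lerDr.
  - by apply: qD => //; apply: qD; exact: qZ.
  - exact: qZ.
pose g t := f t * expR (t ^+ 2 / 2).
have dg t : is_derive t (1 : R) g 0.
  have h2 := @is_derive1_comp R expR (fun t => t ^+ 2 / 2) t _ _
    (is_derive_expR (t ^+ 2 / 2)) (is_derive_sqr_mulr 2^-1 t).
  apply: (is_derive_eq (is_deriveM (df t) h2)).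
  by rewrite /GRing.scale /=; field.
have : `|g tau - g 0| <= 0 * `|tau|.
  by apply: (@MVT_norm_le R g (fun=> 0) tau 0 dg) => y _; rewrite normr0.
rewrite mul0r normr_le0 subr_eq0 /g => /eqP.
have -> : f 0 = cos b.
  rewrite /f; have -> : J (fun x => cos (0 * x + b)) = J (fun=> cos b * 1).
    by apply: J_eq => x; rewrite mul0r add0r mulr1.
  rewrite JZ; last by apply: (@q_bounded _ 1) => // x; rewrite normr1.
  have -> : J (fun=> 1) = 1; last by rewrite mulr1.
  rewrite /J; under eq_Rintegral do rewrite mul1r.
  by rewrite /Rintegral integral_normal_pdf ?oner_neq0.
rewrite expr0n/= mul0r expR0 mulr1 -/(f tau) => <-.
by rewrite mulrCA -expRD addNr expR0 mulr1.
Qed.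

Lemma gaussian_tail : exists2 C : R, 0 <= C & forall M : R, 0 < M ->
  (@normal_prob R 0 1 [set x : R | (M < `|x|)%R] <= (C / M ^+ 2)%:E)%E.
Proof.
exists K => // M M0; have mM : measurable [set x : R | M < `|x|].
  rewrite (_ : mkset _ = (fun x : R => `|x|) @^-1` `]M, +oo[); last first.
    by apply/seteqP; split => x /=; rewrite in_itv/= andbT.
  by rewrite -[X in measurable X]setTI; exact: normr_measurable.
have q' : quadratic_growth (fun x => (M ^+ 2)^-1 * (1 + x ^+ 2)) by exact: qZ.
have i' := quadratic_pdf_integrable q'.
rewrite mulrC -JZ// /J /Rintegral fineK; last exact: integrable_fin_num.
rewrite /normal_prob [leLHS]integral_mkcond. apply: ge0_le_integral => //.
- by move=> x _; rewrite patchE; case: ifP => _ //; rewrite lee_fin.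
- apply/(measurable_restrictT _ _).1 => //; apply: measurable_funTS.
  by apply/measurable_EFinP; exact: measurable_normal_pdf.
- by case/integrableP : i'.
move=> x _; rewrite patchE; case: ifPn => [|_]; last first.
  rewrite lee_fin mulr_ge0// mulr_ge0 ?invr_ge0 ?sqr_ge0//.
  by rewrite addr_ge0// sqr_ge0.
rewrite inE /= => Mx; rewrite lee_fin ler_peMl// mulrC ler_pdivlMr ?exprn_gt0//.
rewrite mul1r -(real_normK (num_real x)).
apply: (@le_trans _ _ (`|x| ^+ 2)); last by rewrite lerDr.
by rewrite ler_sqr ?nnegrE// ltW.
Qed.

(** The Radon-Nikodym derivative of the normal law agrees almost everywhere with its density
    [psi]. *)
Lemma integral_normal_prob (f : R -> \bar R) :
  (@normal_prob R 0 1).-integrable setT f ->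
  (\int[@normal_prob R 0 1]_x f x = \int[mu]_x (f x * (psi x)%:E))%E.
Proof.
move=> fint; have mf := measurable_int _ fint.
rewrite -(Radon_Nikodym_change_of_variables (normal_prob_dominates 0 1))//=.
apply: ae_eq_integral => //.
- apply: emeasurable_funM => //; apply: (measurable_int mu).
  by apply: Radon_Nikodym_integrable; exact: normal_prob_dominates.
- apply: emeasurable_funM => //=; apply/measurableT_comp => //=.
  exact: measurable_normal_pdf.
- apply: ae_eqe_mul2l => /=.
  rewrite Radon_NikodymE//=; first exact: normal_prob_dominates.
  move=> abmu; case: cid => /= h [h1 h2 h3].
  apply: integral_ae_eq => //=.
  + by apply/measurableT_comp => //; exact: measurable_normal_pdf.
  + by move=> E _ mE; rewrite -h3.
Qed.

Lemma gaussian_cos (tau b : R) :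
  Ex (@normal_prob R 0 1) (fun x => cos (tau * x + b)) =
  expR (- (tau ^+ 2 / 2)) * cos b.
Proof.
rewrite -gaussian_cos_pdf /Ex /Rintegral integral_normal_prob//.
apply: bdd_summable; apply: bdd_cos.
by apply: measurable_funD => //; exact: measurable_funM.
Qed.

End gaussian_characteristic_function.

(** * From characteristic functions to distribution functions *)

Section trigonometric_polynomials.
Context (R : realType).
Implicit Types (f g h : R -> R).

(** Real trigonometric polynomials with arbitrary frequencies; phases supply sines, and frequency 0
    the constants. Convergence passes to this span by linearity, and product formulas make it an
    algebra. *)
Inductive trig : (R -> R) -> Prop :=
| trig_cos a b : trig (fun x => cos (a * x + b))
| trigD f g : trig f -> trig g -> trig (fun x => f x + g x)
| trigZ c f : trig f -> trig (fun x => c * f x).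

Lemma eq_trig f g : f =1 g -> trig f -> trig g.
Proof. by move=> /funext ->. Qed.

Lemma trigM f g : trig f -> trig g -> trig (fun x => f x * g x).
Proof.
move=> tf; elim: tf g => [a b|f1 f2 _ IH1 _ IH2|c f1 _ IH] g tg.
- elim: tg => [a' b'|g1 g2 _ IH1 _ IH2|c g1 _ IH].
  + have := trigZ 2^-1 (trigD (trig_cos (a + a') (b + b')) (trig_cos (a - a') (b - b'))).
    apply: eq_trig => x.
    have -> : (a + a') * x + (b + b') = (a * x + b) + (a' * x + b') by ring.
    have -> : (a - a') * x + (b - b') = (a * x + b) - (a' * x + b') by ring.
    by rewrite cosD cosB; field.
  + by apply: eq_trig (trigD IH1 IH2) => x; rewrite mulrDr.
  + by apply: eq_trig (trigZ c IH) => x; rewrite mulrCA.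
- by apply: eq_trig (trigD (IH1 _ tg) (IH2 _ tg)) => x; rewrite mulrDl.
- by apply: eq_trig (trigZ c (IH _ tg)) => x; rewrite mulrA.
Qed.

Lemma trig_cst c : trig (fun=> c).
Proof.
apply: eq_trig (trigZ c (trig_cos 0 0)) => x.
by rewrite mul0r addr0 cos0 mulr1.
Qed.

Lemma trigX n f : trig f -> trig (fun x => f x ^+ n).
Proof.
move=> tf; elim: n => [|n IH]; first exact: trig_cst.
by apply: eq_trig (trigM tf IH) => x; rewrite exprS.
Qed.

Lemma bernoulli_le (x : R) n : 0 <= x <= 1 -> 1 - n%:R * x <= (1 - x) ^+ n.
Proof.
move=> /andP[x0 x1]; elim: n => [|n IH]; first by rewrite mul0r subr0.
rewrite exprS; apply: (@le_trans _ _ ((1 - x) * (1 - n%:R * x))); last first.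
  by rewrite ler_wpM2l// subr_ge0.
by rewrite -natr1; have := ler0n R n; nra.
Qed.

Lemma bernoulli_ge (x : R) n : 0 <= x <= 1 -> (1 - x) ^+ n * (1 + n%:R * x) <= 1.
Proof.
move=> /andP[x0 x1]; elim: n => [|n IH]; first by rewrite mul0r addr0 mulr1.
rewrite exprS -natr1.
have p0 : 0 <= (1 - x) ^+ n by rewrite exprn_ge0// subr_ge0.
apply: le_trans IH; rewrite -mulrA mulrCA ler_wpM2l//.
have := ler0n R n; nra.
Qed.

(* The Stone-Weierstrass kernel [(1 - s ^ N) ^ (2 ^ N)] tends to the step at
   [s = 1/2]; with [s = (1 - sin (l (x - x0))) / 2] it is a trigonometric
   polynomial close to the step at [x0] on an interval of length [pi / l]. *)
Lemma trig_step (x0 M de e : R) : 0 < de -> de <= M -> 0 < e ->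
  exists2 h : R -> R, trig h & forall x, [/\ 0 <= h x, h x <= 1,
    `|x - x0| <= M -> x0 + de <= x -> h x <= e &
    `|x - x0| <= M -> x <= x0 - de -> 1 - e <= h x].
Proof.
move=> de0 deM e0; have M0 : 0 < M by exact: lt_le_trans deM.
(* A quarter period is then [M], so the sine increases on the whole window [[-M, M]]. *)
pose l := pi / 2 / M.
have pi2 : 0 < pi / 2 :> R by rewrite divr_gt0// pi_gt0.
have l0 : 0 < l by rewrite divr_gt0.
have lM : l * M = pi / 2 by rewrite /l divfK// gt_eqF.
pose eta := sin (l * de).
have eta0 : 0 < eta.
  apply: sin_gt0_pi; rewrite mulr_gt0//=.
  apply: (@le_lt_trans _ _ (l * M)); first by rewrite ler_pM2l.
  by rewrite lM; have := pi_gt0 R; lra.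
have eta1 : eta <= 1 by exact: sin_le1.
pose N := Num.bound (e^-1 / eta).
have N1 : e^-1 <= N%:R * eta.
  rewrite -ler_pdivrMr//; apply/ltW/archi_boundP.
  by rewrite divr_ge0 ?invr_ge0// ltW.
have up : e^-1 <= (1 + eta) ^+ N.
  apply: le_trans N1 _; elim: N => [|k IH]; first by rewrite mul0r.
  have p1 : 1 <= (1 + eta) ^+ k by rewrite exprn_ege1// lerDl ltW.
  by rewrite exprS -natr1; nra.
have up' : ((1 + eta) ^+ N)^-1 <= e.
  by rewrite -[leRHS]invrK lef_pV2 ?posrE ?invr_gt0// exprn_gt0// addr_gt0.
have down : (1 - eta) ^+ N <= e.
  apply: le_trans up'; rewrite -exprVn; apply: lerXn2r.
  - by rewrite nnegrE subr_ge0.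
  - by rewrite nnegrE invr_ge0 addr_ge0// ltW.
  rewrite -[leRHS]mul1r ler_pdivlMr ?addr_gt0//.
  have := sqr_ge0 eta; lra.
pose s x := (1 - sin (l * (x - x0))) / 2.
pose h x := 1 - (1 - s x ^+ N) ^+ (2 ^ N).
have s01 x : 0 <= s x <= 1.
  have := sin_geN1 (l * (x - x0)); have := sin_le1 (l * (x - x0)).
  by rewrite /s => ? ?; apply/andP; split; lra.
have sN01 x : 0 <= s x ^+ N <= 1.
  by have /andP[a b] := s01 x; rewrite exprn_ge0//= exprn_ile1.
have w01 x : 0 <= (1 - s x ^+ N) ^+ (2 ^ N) <= 1.
  have /andP[a b] := sN01 x.
  by rewrite exprn_ge0 ?subr_ge0//= exprn_ile1 ?subr_ge0// gerBl.
have ts : trig s.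
  have := trigD (trig_cst 2^-1) (trigZ (- 2^-1) (trig_cos l (- (l * x0) - pi / 2))).
  apply: eq_trig => x; rewrite addrA cosBpihalf /s.
  by rewrite (mulrBr l) mulrBl mulNr mul1r (mulrC (sin _)).
exists h.
  have := trigX (2 ^ N) (trigD (trig_cst 1) (trigZ (-1) (trigX N ts))).
  move=> /(trigZ (-1)) /(trigD (trig_cst 1)); apply: eq_trig => x.
  by rewrite /h !mulN1r.
(* The exponent [2 ^ N] cancels the denominator of [s]. To the right of the step this quantity is at
   most [(1 - eta) ^ N <= e], to the left at least [(1 + eta) ^ N >= 1 / e]; Bernoulli's
   inequalities translate this into bounds on [h]. *)
have two x : (2 ^ N)%:R * s x ^+ N = (1 - sin (l * (x - x0))) ^+ N.
  by rewrite natrX -exprMn /s mulrCA divff// mulr1.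
have itv y : `|y| <= M -> l * y \in `[- (pi / 2), pi / 2].
  by rewrite ler_norml in_itv/= -lM -mulrN !ler_pM2l.
have sin_mono (y z : R) : `|y| <= M -> `|z| <= M -> y <= z -> sin (l * y) <= sin (l * z).
  move=> yM zM; rewrite le_eqVlt => /orP[/eqP->//|yz].
  by rewrite ltW// ltr_sin ?itv// ltr_pM2l.
have deM' : `|de| <= M by rewrite gtr0_norm.
move=> x; have /andP[w0 w1] := w01 x; split.
- by rewrite subr_ge0.
- by rewrite gerBl.
- move=> xM hx; have hs : eta <= sin (l * (x - x0)).
    by apply: sin_mono => //; rewrite lerBrDl.
  have := bernoulli_le (2 ^ N) (sN01 x); rewrite two => hb.
  have : (1 - sin (l * (x - x0))) ^+ N <= (1 - eta) ^+ N.
    by apply: lerXn2r; rewrite ?nnegrE ?subr_ge0 ?sin_le1// lerD2l lerN2.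
  by rewrite /h; lra.
- move=> xM hx; have hs : sin (l * (x - x0)) <= - eta.
    rewrite /eta -sinN -mulrN; apply: sin_mono => //; first by rewrite normrN.
    by rewrite lerBlDl.
  have := bernoulli_ge (2 ^ N) (sN01 x); rewrite two => hb.
  have h1 : (1 + eta) ^+ N <= (1 - sin (l * (x - x0))) ^+ N.
    by apply: lerXn2r; rewrite ?nnegrE ?subr_ge0 ?sin_le1 ?addr_ge0 ?(ltW eta0)//; lra.
  have e1 : e * e^-1 = 1 by rewrite divff// gt_eqF.
  rewrite /h; have : (1 - s x ^+ N) ^+ (2 ^ N) <= e; last by lra.
  have : (1 - s x ^+ N) ^+ (2 ^ N) * e^-1 <= 1.
    by apply: le_trans hb; rewrite ler_wpM2l//; lra.
  by rewrite -ler_pdivlMr ?invr_gt0// mul1r invrK.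
Qed.

End trigonometric_polynomials.

(** * Sandwiching distribution functions *)

Section smoothing.
Context (disp : measure_display) (T : measurableType disp) (R : realType).
Context (P : probability T R) (W : T -> R).
Hypothesis mW : measurable_fun setT W.
Local Notation E := (Ex P).

Lemma measurable_ray y : measurable [set t | W t <= y].
Proof.
rewrite (_ : mkset _ = W @^-1` `]-oo, y]); last first.
  by apply/seteqP; split => x /=; rewrite in_itv.
by rewrite -[X in measurable X]setTI; exact: mW.
Qed.

Lemma measurable_outside x0 M : measurable [set t | M < `|W t - x0|].
Proof.
have mf : measurable_fun setT (fun t => `|W t - x0|).
  by apply: measurableT_comp => //; exact: measurable_funB.
rewrite (_ : mkset _ = (fun t => `|W t - x0|) @^-1` `]M, +oo[); last first.
  by apply/seteqP; split => x /=; rewrite in_itv/= andbT.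
by rewrite -[X in measurable X]setTI; exact: mf.
Qed.

Lemma bdd_trig f : trig f -> bdd (fun t => f (W t)).
Proof.
elim=> [a b|f1 f2 _ m1 _ m2|c f1 _ m1].
- apply: bdd_cos; apply: measurable_funD => //.
  exact: measurable_funM.
- exact: bddD.
- by apply: bddM => //; exact: bdd_cst.
Qed.

Variables (x0 M de e : R) (h : R -> R).
Hypotheses (th : trig h) (e0 : 0 < e).
Hypothesis hh : forall x, [/\ 0 <= h x, h x <= 1,
    `|x - x0| <= M -> x0 + de <= x -> h x <= e &
    `|x - x0| <= M -> x <= x0 - de -> 1 - e <= h x].

Let ind y := bdd_summable P (bdd_indic R (measurable_ray y)).
Let out := bdd_summable P (bdd_indic R (measurable_outside x0 M)).

(** Outside the window of radius [M] the polynomial [h] is only known to lie in [[0, 1]], hence the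
    tail probability. *)
Lemma smoothing_le : E (fun t => h (W t)) <=
  fine (P [set t | W t <= x0 + de]) + e + fine (P [set t | M < `|W t - x0|]).
Proof.
rewrite -(Ex_indic P (measurable_ray _)) -(Ex_indic P (measurable_outside _ _)).
have se := summable_cst P e.
rewrite -[X in _ + X + _](Ex_cst P) -(ExD (ind _) se) -(ExD (summableD (ind _) se) out).
apply: le_Ex.
- exact: (bdd_summable P (bdd_trig th)).
- exact: (summableD (summableD (ind _) se) out).
move=> t; have [h0 h1 h2 _] := hh (W t).
rewrite !indicE; case: (boolP (t \in [set t | M < `|W t - x0|])) => out_t.
  by apply: le_trans h1 _; rewrite lerDr addr_ge0// ltW.
have in_t : `|W t - x0| <= M.
  by rewrite leNgt; apply/negP => ?; move/negP: out_t; apply; rewrite inE.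
case: (boolP (t \in _)) => ray_t /=.
  by rewrite addr0; apply: le_trans h1 _; rewrite lerDl ltW.
rewrite addr0 add0r; apply: h2 => //.
by rewrite leNgt; apply/negP => ?; move/negP: ray_t; apply; rewrite inE /= ltW.
Qed.

Lemma smoothing_ge : fine (P [set t | W t <= x0 - de]) <=
  E (fun t => h (W t)) + e + fine (P [set t | M < `|W t - x0|]).
Proof.
rewrite -(Ex_indic P (measurable_ray _)) -(Ex_indic P (measurable_outside _ _)).
have se := summable_cst P e; have sh := bdd_summable P (bdd_trig th).
rewrite -[X in _ + X + _](Ex_cst P) -(ExD sh se) -(ExD (summableD sh se) out).
apply: le_Ex; first exact: ind.
  exact: (summableD (summableD sh se) out).
move=> t; have [h0 h1 _ h2] := hh (W t).
rewrite !indicE; case: (boolP (t \in [set t | M < `|W t - x0|])) => out_t /=.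
  have b1 : (t \in [set t | W t <= x0 - de])%:R <= 1 :> R by case: (_ \in _).
  by apply: le_trans b1 _; rewrite lerDr addr_ge0// ltW.
have in_t : `|W t - x0| <= M.
  by rewrite leNgt; apply/negP => ?; move/negP: out_t; apply; rewrite inE.
rewrite addr0; case: (boolP (t \in _)) => ray_t /=; last by rewrite addr_ge0// ltW.
rewrite -lerBlDr; apply: h2 => //; by move: ray_t; rewrite inE.
Qed.

End smoothing.

(** * Levy continuity for the standard normal limit *)

Section levy.
Context (disp : measure_display) (T : measurableType disp) (R : realType).
Context (P : probability T R) (W : nat -> T -> R).
Hypothesis LW : forall n, L2 P (W n).
Hypothesis W2 : forall n, Ex P (fun t => W n t ^+ 2) <= 1.
Hypothesis Wcos : forall a b : R,
  Ex P (fun t => cos (a * W n t + b)) @[n --> \oo] --> expR (- (a ^+ 2 / 2)) * cos b.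
Local Notation N01 := (@normal_prob R 0 1).

Let id_measurable : measurable_fun setT (fun x : R => x). Proof. by []. Qed.

Lemma trig_cvg h : trig h ->
  Ex P (fun t => h (W n t)) @[n --> \oo] --> Ex N01 h.
Proof.
have s f n : trig f -> summable_rv P (fun t => f (W n t)).
  move=> tf; apply: bdd_summable; apply: (bdd_trig _ tf).
  exact: L2_measurable (LW n).
have s' f : trig f -> summable_rv N01 f.
  by move=> tf; apply: bdd_summable; exact: (bdd_trig id_measurable tf).
elim=> [a b|f g tf IHf tg IHg|c f tf IH].
- by rewrite gaussian_cos; exact: Wcos.
- rewrite (ExD (s' _ tf) (s' _ tg)).
  under eq_fun do rewrite (ExD (s _ _ tf) (s _ _ tg)).
  exact: cvgD.
- rewrite (ExZ _ (s' _ tf)); under eq_fun do rewrite (ExZ _ (s _ _ tf)).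
  by apply: cvgM => //; exact: cvg_cst.
Qed.

Lemma W_tail n x0 (M : R) : `|x0| < M ->
  fine (P [set t | M < `|W n t - x0|]) <= ((M - `|x0|) ^+ 2)^-1.
Proof.
move=> x0M; set r := M - `|x0|; have r0 : 0 < r by rewrite subr_gt0.
have mW := L2_measurable (LW n).
rewrite -(Ex_indic P (measurable_outside mW x0 M)).
apply: (@le_trans _ _ ((r ^+ 2)^-1 * Ex P (fun t => W n t ^+ 2))); last first.
  by rewrite ler_piMr// invr_ge0 sqr_ge0.
rewrite -(ExZ _ (L2_sqr (LW n))); apply: le_Ex.
- exact: (bdd_summable P (bdd_indic R (measurable_outside mW x0 M))).
- exact/summableZ/L2_sqr.
move=> t; rewrite indicE; case: (boolP (t \in _)) => [|_]; last first.
  by rewrite mulr_ge0 ?invr_ge0 ?sqr_ge0.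
rewrite inE /= => Mt; rewrite mulrC ler_pdivlMr ?exprn_gt0// mul1r.
rewrite -(real_normK (num_real (W n t))) ler_sqr ?nnegrE ?(ltW r0)//.
by have := ler_normB (W n t) x0; rewrite /r; lra.
Qed.

Lemma normal_tail x0 (M C : R) :
  (forall M : R, 0 < M -> (N01 [set x : R | (M < `|x|)%R] <= (C / M ^+ 2)%:E)%E) ->
  `|x0| < M ->
  fine (N01 [set x : R | M < `|x - x0|]) <= C / (M - `|x0|) ^+ 2.
Proof.
move=> hC x0M; have r0 : 0 < M - `|x0| by rewrite subr_gt0.
rewrite -lee_fin fineK; last first.
  by apply: fin_num_measure; exact: (measurable_outside id_measurable).
apply: le_trans (hC _ r0); apply: le_measure; rewrite ?inE.
- exact: (measurable_outside id_measurable).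
- have := measurable_outside id_measurable 0 (M - `|x0|).
  by congr measurable; apply/funext => x; rewrite /= subr0.
move=> x /= Mx; have := ler_normB x x0; lra.
Qed.

Let squeeze (e x x1 x2 y a1 a2 c1 c2 : R) : x1 <= x + e / 4 -> x - e / 4 <= x2 ->
  `|a1 - c1| <= e / 4 -> `|a2 - c2| <= e / 4 -> a1 <= x1 + e / 4 ->
  y <= c1 + e / 4 -> x2 <= a2 + e / 4 -> c2 <= y + e / 4 -> `|x - y| <= e.
Proof.
move=> ? ?; rewrite !ler_norml => /andP[? ?] /andP[? ?] *.
by apply/andP; split; lra.
Qed.

(** Tightness comes from the second moments by Chebyshev's inequality. Two smoothed steps bound the
    distribution function from either side, and continuity of the normal one at [x] closes the
    gap. *)
Lemma levy_continuity : cvg_in_distribution P W N01.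
Proof.
move=> x cx.
pose F y := fine (N01 [set z : R | z <= y]).
have rayE y : `]-oo, y]%classic = [set z : R | z <= y].
  by apply/seteqP; split => z /=; rewrite in_itv.
have FE y : N01 `]-oo, y]%classic = (F y)%:E.
  by rewrite rayE fineK//; apply: fin_num_measure; exact: (measurable_ray id_measurable).
have cF : F y @[y --> x] --> F x.
  have : N01 `]-oo, y]%classic @[y --> x] --> (F x)%:E by rewrite -FE; exact: cx.
  move=> /fine_cvg; apply: cvg_trans; apply: near_eq_cvg.
  by near=> y; rewrite /= FE.
have mr n y := measurable_ray (L2_measurable (LW n)) y.
rewrite [X in _ --> X](_ : _ = (F x)%:E); last exact: FE.
 apply/fine_cvgP; split.
  by near=> n; apply: fin_num_measure.
apply/cvgrPdist_le => e e0.
have [C C0 hC] := gaussian_tail R.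
have [de de0 hde] : exists2 de : R, 0 < de & forall y, `|x - y| <= 2 * de ->
    `|F x - F y| <= e / 4.
  have e4 : 0 < e / 4 by rewrite divr_gt0.
  move/cvgrPdist_le : cF => /(_ _ e4) /nbhs_ballP[r /= r0 hr].
  exists (r / 4); first by rewrite divr_gt0.
  by move=> y hy; apply: hr; rewrite /ball /=; apply: le_lt_trans hy _; lra.
(* [C + 1] covers both Chebyshev constants, 1 for [W n] and [C] for the normal law. *)
pose r := 1 + (C + 1) / (e / 8).
have e8 : 0 < e / 8 by rewrite divr_gt0.
have r1 : 1 <= r by rewrite lerDl divr_ge0 ?addr_ge0// ltW.
have r0 : 0 < r by exact: lt_le_trans r1.
have tail_le : (C + 1) / r ^+ 2 <= e / 8.
  apply: (@le_trans _ _ ((C + 1) / r)).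
    rewrite ler_wpM2l ?addr_ge0// lef_pV2 ?posrE ?exprn_gt0//.
    by rewrite expr2 ler_peMr// ltW.
  by rewrite ler_pdivrMr// mulrC -ler_pdivrMr// lerDr.
pose M := `|x| + de + r.
have M_de : de <= M by rewrite /M; have := normr_ge0 x; lra.
have key x0 : `|x - x0| <= de -> exists2 h, trig h & forall n,
    [/\ Ex N01 h <= F (x0 + de) + e / 4,
        F (x0 - de) <= Ex N01 h + e / 4,
        Ex P (fun t => h (W n t)) <= fine (P [set t | W n t <= x0 + de]) + e / 4 &
        fine (P [set t | W n t <= x0 - de]) <= Ex P (fun t => h (W n t)) + e / 4].
  move=> hx0; have [h th hh] := trig_step x0 de0 M_de e8; exists h => // n.
  have x0M : r <= M - `|x0|.
    have := ler_normB x (x - x0); have -> : x - (x - x0) = x0 by ring.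
    rewrite /M; lra.
  have x0M' : `|x0| < M by rewrite -subr_gt0; exact: lt_le_trans x0M.
  have rM : ((M - `|x0|) ^+ 2)^-1 <= (r ^+ 2)^-1.
    rewrite lef_pV2 ?posrE ?exprn_gt0 ?subr_gt0//.
    by rewrite ler_sqr ?nnegrE// ltW// subr_gt0.
  have ri : 0 <= (r ^+ 2)^-1 by rewrite invr_ge0 sqr_ge0.
  have t1 : fine (P [set t | M < `|W n t - x0|]) <= e / 8.
    apply: le_trans (W_tail n x0M') _; apply: le_trans rM _.
    by apply: le_trans tail_le; rewrite ler_peMl// lerDr.
  have t2 : fine (N01 [set z : R | M < `|z - x0|]) <= e / 8.
    apply: le_trans (normal_tail hC x0M') _.
    apply: le_trans (ler_wpM2l C0 rM) _; apply: le_trans tail_le.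
    by rewrite ler_wpM2r// lerDl.
  split.
  - have := smoothing_le N01 id_measurable th e8 hh; rewrite /F; lra.
  - have := smoothing_ge N01 id_measurable th e8 hh; rewrite /F; lra.
  - have := smoothing_le P (L2_measurable (LW n)) th e8 hh; lra.
  - have := smoothing_ge P (L2_measurable (LW n)) th e8 hh; lra.
(* Steps centred at [x + de] and [x - de]: the smoothing error [de] then leads back exactly to [x]
   on the side of [W n]. *)
have n1 : `|x - (x + de)| <= de by rewrite opprD addrA subrr add0r normrN gtr0_norm.
have n2 : `|x - (x - de)| <= de by rewrite opprB addrCA subrr addr0 gtr0_norm.
have [h1 th1 hh1] := key _ n1; have [h2 th2 hh2] := key _ n2.
have e4 : 0 < e / 4 by rewrite divr_gt0.
have F1 : F (x + de + de) <= F x + e / 4.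
  have : `|F x - F (x + de + de)| <= e / 4.
    by apply: hde; rewrite -normrN ger0_norm; lra.
  by rewrite ler_norml => /andP[? ?]; lra.
have F2 : F x - e / 4 <= F (x - de - de).
  have : `|F x - F (x - de - de)| <= e / 4.
    by apply: hde; rewrite ger0_norm; lra.
  by rewrite ler_norml => /andP[? ?]; lra.
near=> n.
have c1 : `|Ex N01 h1 - Ex P (fun t => h1 (W n t))| <= e / 4.
  by near: n; have /cvgrPdist_le := trig_cvg th1; exact.
have c2 : `|Ex N01 h2 - Ex P (fun t => h2 (W n t))| <= e / 4.
  by near: n; have /cvgrPdist_le := trig_cvg th2; exact.
have [a1 _ _ a4] := hh1 n; have [_ b2 b3 _] := hh2 n.
rewrite addrK in a4; rewrite subrK in b3.
exact: squeeze F1 F2 c1 c2 a1 a4 b2 b3.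
Unshelve. all: by end_near. Qed.

End levy.

(** * Arrays indexed by boxes *)

Section rho_covariance.
Context (disp : measure_display) (T : measurableType disp) (R : realType).
Context (P : probability T R).
Implicit Types f g : T -> R.
Local Notation E := (Ex P).

Lemma L2_lty f : L2 P f -> ('E_P[(fun t => (f t ^+ 2)%R)] < +oo)%E.
Proof.
move=> /L2_sqr /integrableP[_]; rewrite unlock.
have -> // : (\int[P]_x `|(EFin \o (fun t => f t ^+ 2)%R) x| =
  \int[P]_x (f x ^+ 2)%:E)%E.
by apply: eq_integral => t _; rewrite /= ger0_norm ?sqr_ge0.
Qed.

Lemma covarianceEx f g :
  fine (covariance P f g) = E (fun t => (f t - E f) * (g t - E g)).
Proof. by rewrite !unlock. Qed.

Lemma Ex_cov f g : L2 P f -> L2 P g ->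
  E (fun t => (f t - E f) * (g t - E g)) = E (fun t => f t * g t) - E f * E g.
Proof.
move=> Lf Lg; have sf := L2_summable Lf; have sg := L2_summable Lg.
have sfg := L2M Lf Lg.
have h1 := summableZ (- E g) sf; have h2 := summableZ (- E f) sg.
have h3 := summable_cst P (E f * E g).
transitivity (E (fun t => f t * g t + (- E g * f t + (- E f * g t + E f * E g)))).
  by apply: eq_Ex => t; ring.
rewrite (ExD sfg (summableD h1 (summableD h2 h3))) (ExD h1 (summableD h2 h3)).
rewrite (ExD h2 h3) (ExZ (- E g) sf) (ExZ (- E f) sg) Ex_cst; ring.
Qed.

Lemma variance_le f : L2 P f ->
  0 <= fine 'V_P[f] <= E (fun t => f t ^+ 2).
Proof.
move=> Lf; rewrite covarianceEx Ex_cov//.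
have e : E (fun t => f t * f t) = E (fun t => f t ^+ 2) by apply: eq_Ex => t.
rewrite e; apply/andP; split; last by rewrite gerBl -expr2 sqr_ge0.
rewrite -e -Ex_cov//; apply: Ex_ge0 => t; rewrite -expr2; exact: sqr_ge0.
Qed.

(** The covariance is at most [r] times the product of the standard deviations, and the
    arithmetic-geometric mean inequality gives half the sum of the variances. *)
Lemma Corr_cov_le f g (r : R) : L2 P f -> L2 P g -> 0 <= r -> `|Corr P f g| <= r ->
  `|E (fun t => f t * g t) - E f * E g| <=
    r / 2 * (E (fun t => f t ^+ 2) + E (fun t => g t ^+ 2)).
Proof.
move=> Lf Lg r0; rewrite /Corr covarianceEx Ex_cov//.
have /andP[u0 uf] := variance_le Lf; have /andP[v0 vg] := variance_le Lg.
set c := E (fun t => f t * g t) - _; set u := fine 'V_P[f] in u0 uf *.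
set v := fine 'V_P[g] in v0 vg *.
have rhs0 : 0 <= r / 2 * (E (fun t => f t ^+ 2) + E (fun t => g t ^+ 2)).
  apply: mulr_ge0; first by rewrite divr_ge0.
  by rewrite addr_ge0// (le_trans _ uf, le_trans _ vg).
have Lf' : L2 P (fun t => f t - E f).
  by apply: L2B => //; exact/bdd_L2/bdd_cst.
have Lg' : L2 P (fun t => g t - E g).
  by apply: L2B => //; exact/bdd_L2/bdd_cst.
(* The weight stays free: in the degenerate case it is made very large or very small to suppress the
   nonzero variance. *)
have cs s : 0 < s -> `|c| <= (s * u + s^-1 * v) / 2.
  move=> s0; rewrite /c -Ex_cov//; apply: le_trans (ler_norm_Ex (L2M Lf' Lg')) _.
  apply: le_trans (Ex_normM_le s0 Lf' Lg') _.
  by rewrite /u /v !covarianceEx.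
(* [Corr] is [0] by convention here, so it says nothing about [c]. *)
have deg : u = 0 \/ v = 0 -> `|c| <= 0.
  move=> uv; apply/ler_addgt0Pr => e e0; rewrite add0r.
  have small x : 0 <= x -> 0 < e / (x + 1) /\ e / (x + 1) * x / 2 <= e.
    move=> x0; have x1 : 0 < x + 1 by rewrite ltr_wpDl.
    have w0 : 0 < e / (x + 1) by exact: divr_gt0.
    have : e / (x + 1) * (x + 1) = e by rewrite divfK// gt_eqF.
    by split => //; nra.
  case: uv => [u_0|v_0].
    have [s0 h] := small _ v0; have si0 : 0 < (e / (v + 1))^-1 by rewrite invr_gt0.
    by apply: le_trans (cs _ si0) _; rewrite u_0 mulr0 add0r invrK.
  have [s0 h] := small _ u0.
  by apply: le_trans (cs _ s0) _; rewrite v_0 mulr0 addr0.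
have [u_0|u_gt] := eqVneq u 0.
  by move=> _; apply: le_trans rhs0; apply: deg; left.
have [v_0|v_gt] := eqVneq v 0.
  by move=> _; apply: le_trans rhs0; apply: deg; right.
have up : 0 < u by rewrite lt_def u_gt.
have vp : 0 < v by rewrite lt_def v_gt.
have su : 0 < Num.sqrt u by rewrite sqrtr_gt0.
have sv : 0 < Num.sqrt v by rewrite sqrtr_gt0.
rewrite normrM normfV (gtr0_norm (mulr_gt0 su sv)) ler_pdivrMr ?mulr_gt0// => h.
apply: le_trans h _; rewrite -mulrA ler_wpM2l// ler_pdivlMl//.
have := sqr_sqrtr u0; have := sqr_sqrtr v0.
by have := sqr_ge0 (Num.sqrt u - Num.sqrt v); nra.
Qed.

End rho_covariance.

(** * From the mixing coefficients to a field system *)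

Section box_system.
Context (disp : measure_display) (T : measurableType disp) (R : realType).
Context (P : probability T R) (d : nat).
Context (L : nat -> 'I_d -> nat) (X : nat -> lattice d -> {RV P >-> R}).
Hypothesis halpha : ereal_sup (range (fun n => alpha_array P (L n) (X n) m))
  @[m --> \oo] --> 0%E.
Hypothesis hrho : (ereal_sup (range (fun n => rho'_array P (L n) (X n) 1)) < 1)%E.

Definition box_seq n : seq (lattice d) :=
  finmap.enum_fset (fset_set (box (L n))).

Definition box_gen n (Q : set (lattice d)) : set (set T) :=
  \bigcup_(k in Q) g_sigma_algebra_preimage (zero_ext (L n) (X n) k).

Lemma mem_box_seq n k : (k \in box_seq n) = (k \in box (L n)).
Proof. by rewrite in_fset_set//; exact: finite_box. Qed.

Lemma measurable_zero_ext n k : measurable_fun setT (zero_ext (L n) (X n) k).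
Proof. by rewrite /zero_ext; case: ifP => _ //; exact: measurable_cst. Qed.

Lemma msr_L2real n Q f : L2 P f -> msr (box_gen n Q) f ->
  L2real P (sigma_field (zero_ext (L n) (X n)) Q) f.
Proof.
move=> Lf mf; split; last exact: L2_lty.
by move=> B mB; exact: msr_preimage.
Qed.

(** A class of coordinate values and its complement are disjoint sets of integers, hence at distance
    at least 1: they form an admissible pair for the coefficient at 1. *)
Lemma rho_bound : exists r : R, [/\ 0 <= r, r < 1 &
  forall n (u : 'I_d) (A : set int) (f g : T -> R), L2 P f -> L2 P g ->
    msr (box_gen n [set k | k \in box_seq n /\ A (k u)]) f ->
    msr (box_gen n [set k | k \in box_seq n /\ ~ A (k u)]) g ->
    `|Corr P f g| <= r].
Proof.
have rr1 := hrho; set rr := ereal_sup _ in rr1; exists (Num.max 0 (fine rr)); split.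
- by rewrite le_max lexx.
- rewrite gt_max ltr01/=.
  by move: rr1; case: (rr) => //= x; rewrite ?lte_fin// ltr01.
move=> n u A f g Lf Lg mf mg.
(* Two sites outside the box make [Q] and [S] nonempty whatever [A] is. *)
pose cst_pt (a : int) : lattice d := [ffun=> a].
pose A' : set int := [set a | (0 <= a /\ A a) \/ a = -1].
pose B' : set int := [set a | (0 <= a /\ ~ A a) \/ a = -2].
pose Q : set (lattice d) := [set k | k \in box_seq n /\ A (k u)] `|` [set cst_pt (-1)].
pose S : set (lattice d) := [set k | k \in box_seq n /\ ~ A (k u)] `|` [set cst_pt (-2)].
have pos k : k \in box_seq n -> 0 <= k u.
  by rewrite mem_box_seq inE => /(_ u)/andP[k1 _]; exact: le_trans k1.
have disj a b : A' a -> B' b -> a <> b.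
  by move=> [[a0 Aa]|->] [[b0 Bb]|->] // ab; subst => //.
have QA k : Q k -> A' (k u).
  by move=> [[kB Ak]|->]; [left; split => //; exact: pos|right; rewrite ffunE].
have SB k : S k -> B' (k u).
  by move=> [[kB Ak]|->]; [left; split => //; exact: pos|right; rewrite ffunE].
have fin (C : set int) : finite_set [set k | k \in box_seq n /\ C (k u)].
  apply: sub_finite_set (finite_box (L n)) => k [+ _].
  by rewrite mem_box_seq inE.
have : (`|Corr P f g|%:E <= rr)%E.
  apply: (@le_trans _ _ (rho'_array P (L n) (X n) 1)); last first.
    by apply: ereal_sup_ubound; exists n.
  apply: (@le_trans _ _ (rho_coef P (sigma_field (zero_ext (L n) (X n)) Q)
      (sigma_field (zero_ext (L n) (X n)) S))).
    apply: ereal_sup_ubound; exists f, g; split => //.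
    - apply: msr_L2real => //; apply: sub_msr mf.
      by apply: bigcup_subset => k; left.
    - apply: msr_L2real => //; apply: sub_msr mg.
      by apply: bigcup_subset => k; left.
  apply: ereal_sup_ubound; exists Q, S; split => //.
  - split; first by exists (cst_pt (-1)); right.
    by rewrite finite_setU; split; [exact: fin|exact: finite_set1].
  - split; first by exists (cst_pt (-2)); right.
    rewrite finite_setU; split; last exact: finite_set1.
    exact: (fin (~` A)).
  - apply/seteqP; split => // k [/QA h1 /SB h2]; exact: disj h1 h2 erefl.
  exists u, A', B'; split; last by [].
  split.
  - by exists (-1); right.
  - by exists (-2); right.
  - by apply/seteqP; split => // a [h1 h2]; exact: disj h1 h2 erefl.
  - move=> a b Aa Bb; have := disj _ _ Aa Bb; move=> ab.
    have : a - b != 0 by rewrite subr_eq0; apply/eqP.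
    by rewrite -normr_gt0.
move=> h; rewrite le_max -[X in _ || X]lee_fin fineK ?h ?orbT//.
have : (rr < +oo)%E by apply: lt_trans rr1 _; rewrite ltry.
by move: h; case: (rr).
Qed.

Lemma alpha_bound (e : R) : 0 < e -> exists2 m : nat, (0 < m)%N &
    forall n (u : 'I_d) (j : int) (E F : set T),
    <<s box_gen n [set k | k u <= j] >> E ->
    <<s box_gen n [set k | j + m%:Z <= k u] >> F ->
    `|fine (P (E `&` F)) - fine (P E) * fine (P F)| <= e.
Proof.
move=> e0; have [m m0 hm] : exists2 m, (0 < m)%N &
    (ereal_sup (range (fun n => alpha_array P (L n) (X n) m)) <= e%:E)%E.
  have [[N _ hN] hf] := (fine_cvgP _ _).1 halpha.
  move/cvgrPdist_le : hf => /(_ _ e0)[N' _ hN'].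
  (* A positive width makes the two half-spaces disjoint. *)
  exists (maxn 1 (maxn N N')); first by rewrite leq_max.
  have h1 := hN (maxn 1 (maxn N N')); have h2 := hN' (maxn 1 (maxn N N')).
  rewrite -(fineK (h1 _)) ?lee_fin; last by rewrite /= !leq_max leqnn orbT.
  have := h2 _; rewrite sub0r normrN => {}h2; apply: le_trans (ler_norm _) (h2 _).
  by rewrite /= !leq_max leqnn !orbT.
exists m => // n u j E F hE hF.
pose cst_pt (a : int) : lattice d := [ffun=> a].
rewrite -lee_fin; apply: le_trans hm.
apply: (@le_trans _ _ (alpha_array P (L n) (X n) m)); last first.
  by apply: ereal_sup_ubound; exists n.
pose Q : set (lattice d) := [set k | k u <= j].
pose S : set (lattice d) := [set k | j + m%:Z <= k u].
apply: (@le_trans _ _ (alpha_coef P (sigma_field (zero_ext (L n) (X n)) Q)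
    (sigma_field (zero_ext (L n) (X n)) S))); last first.
  apply: ereal_sup_ubound; exists Q, S; split => //.
  - by exists (cst_pt j); rewrite /Q/= ffunE.
  - by exists (cst_pt (j + m%:Z)); rewrite /S/= ffunE.
  - apply/seteqP; split => // k []; rewrite /Q /S /= => h1 h2.
    by have := le_trans h2 h1; rewrite gerDl lez_nat leqNgt m0.
  - by exists u, j; split.
have mE : measurable E.
  move: hE; apply: smallest_sub; first exact: sigma_algebra_measurable.
  move=> _ [k _ [B mB <-]]; exact: measurable_zero_ext.
have mF : measurable F.
  move: hF; apply: smallest_sub; first exact: sigma_algebra_measurable.
  move=> _ [k _ [B mB <-]]; exact: measurable_zero_ext.
apply: ereal_sup_ubound; exists E, F; split => //.
rewrite -[X in `|X - _|%E]fineK ?fin_num_measure//; last exact: measurableI.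
by rewrite -[X in (X * _)%E]fineK ?fin_num_measure// -[X in (_ * X)%E]fineK ?fin_num_measure.
Qed.

Lemma box_field_system : exists r,
  field_system P r box_seq (fun n => (\max_(u < d) L n u).+1) box_gen.
Proof.
have [r [r0 r1 hr]] := rho_bound; exists r; split => //.
- by move=> n; exact: finmap.fset_uniq.
- move=> n k; rewrite mem_box_seq inE => kL u; have /andP[k1 k2] := kL u.
  rewrite (le_trans _ k1)//= (le_lt_trans k2)// ltz_nat ltnS.
  exact: leq_bigmax.
- by move=> n Q _ [k _ [B mB <-]]; exact: measurable_zero_ext.
- by move=> n Q Q' QQ; exact: bigcup_subset.
- move=> n u A f g Lf Lg mf mg; apply: Corr_cov_le => //; exact: hr mf mg.
- exact: alpha_bound.
Qed.

End box_system.

(** * Truncation of the summands *)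

Section truncation.
Context (R : realType).

(** A discontinuous cut, unlike [clip]: the square of the part removed is then exactly the integrand
    of the Lindeberg sum. *)
Definition trunc (e x : R) : R := x * \1_[set y | `|y| <= e] x.

Lemma truncE e x : trunc e x = if `|x| <= e then x else 0.
Proof.
rewrite /trunc indicE; case: ifPn => h; first by rewrite mem_set// mulr1.
by rewrite memNset ?mulr0//; exact/negP.
Qed.

Lemma trunc_bound e x : 0 <= e -> `|trunc e x| <= e.
Proof. by move=> e0; rewrite truncE; case: ifPn => //; rewrite normr0. Qed.

Lemma trunc_sqr_le e x : trunc e x ^+ 2 <= x ^+ 2.
Proof. by rewrite truncE; case: ifP => //; rewrite expr0n sqr_ge0. Qed.

Lemma trunc_diff_sqr e x : (x - trunc e x) ^+ 2 = x ^+ 2 * (e < `|x|)%R%:R.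
Proof.
rewrite truncE ltNge; case: ifP => h; rewrite /= ?subrr ?expr0n ?mulr0//.
by rewrite subr0 mulr1.
Qed.

Lemma measurable_trunc e : measurable_fun setT (trunc e).
Proof.
apply: measurable_funM => //; apply: measurable_indic.
rewrite (_ : mkset _ = (fun x : R => `|x|) @^-1` `]-oo, e]); last first.
  by apply/seteqP; split => x /=; rewrite in_itv.
by rewrite -[X in measurable X]setTI; exact: normr_measurable.
Qed.

End truncation.

(** * The normalised and truncated array *)

Section normalized_array.
Context (disp : measure_display) (T : measurableType disp) (R : realType).
Context (P : probability T R) (d : nat).
Context (L : nat -> 'I_d -> nat) (X : nat -> lattice d -> {RV P >-> R}).
Hypothesis hmean : forall n k, box (L n) k -> ('E_P[X n k] = 0)%E.
Hypothesis hvar : forall n k, box (L n) k ->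
  ('E_P[(fun t => (X n k t ^+ 2)%R)] < +oo)%E.
Hypothesis hsigma : forall n, (0 < sigma2 P (L n) (X n))%E.
Local Notation E := (Ex P).
Local Notation sg := (fun n => sigma P (L n) (X n)).
Local Notation box_seq := (box_seq L).
Local Notation box_gen := (box_gen L X).

Lemma zero_ext_L2 n k : L2 P (zero_ext (L n) (X n) k).
Proof.
split; first exact: measurable_zero_ext.
rewrite /zero_ext; case: ifPn => [|_]; last first.
  by apply: eq_summable (summable_cst P 0) => t; rewrite expr0n.
rewrite inE => /hvar; rewrite unlock => h; apply/integrableP; split.
  by apply/measurable_EFinP; apply: measurable_funX.
apply: le_lt_trans h; rewrite le_eqVlt; apply/orP; left; apply/eqP.
by apply: eq_integral => t _; rewrite /= ger0_norm ?sqr_ge0.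
Qed.

Lemma zero_ext_centered n k : E (zero_ext (L n) (X n) k) = 0.
Proof.
rewrite /zero_ext; case: ifPn => [|_]; last exact: Ex_cst.
by rewrite inE => /hmean; rewrite unlock /Ex /Rintegral => ->.
Qed.

Lemma zero_ext_adapted n : adapted box_gen n (zero_ext (L n) (X n)).
Proof.
move=> k; apply: preimage_msr => B mB; apply: sub_sigma_algebra.
by exists k => //; exists B => //; rewrite setTI.
Qed.

Lemma box_sumE n t : box_sum P (L n) (X n) t =
  \sum_(k <- box_seq n) zero_ext (L n) (X n) k t.
Proof.
rewrite /box_sum fsbig_finite; last exact: finite_box.
rewrite big_seq [RHS]big_seq; apply: eq_bigr => k.
by rewrite /zero_ext -/(box_seq n) mem_box_seq => ->.
Qed.

Lemma box_sum_L2 n : L2 P (box_sum P (L n) (X n)).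
Proof.
rewrite (_ : box_sum _ _ _ =
    (fun t => \sum_(k <- box_seq n) zero_ext (L n) (X n) k t)); last first.
  by apply/funext => t; exact: box_sumE.
by apply: L2_sum => k _; exact: zero_ext_L2.
Qed.

Lemma sigma_sqr n : sg n ^+ 2 = E (fun t => box_sum P (L n) (X n) t ^+ 2).
Proof.
rewrite /sigma /sigma2 sqr_sqrtr; first by rewrite unlock.
by rewrite unlock; apply: Ex_ge0 => t; exact: sqr_ge0.
Qed.

Lemma sigma_gt0 n : 0 < sg n.
Proof.
rewrite sqrtr_gt0; have := hsigma n; rewrite /sigma2 unlock.
have := integrable_fin_num measurableT (L2_sqr (box_sum_L2 n)).
by case: (\int[P]_x _)%E => //= x _; rewrite lte_fin.
Qed.

Definition std n k t : R := (sg n)^-1 * zero_ext (L n) (X n) k t.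

Definition std_trunc e n k t : R :=
  trunc e (std n k t) - E (fun t => trunc e (std n k t)).

Lemma std_L2 n k : L2 P (std n k).
Proof. by apply: L2Z; exact: zero_ext_L2. Qed.

Lemma std_centered n : centered P (std n).
Proof.
by move=> k; rewrite ExZ ?zero_ext_centered ?mulr0//; exact/L2_summable/zero_ext_L2.
Qed.

Lemma std_adapted n : adapted box_gen n (std n).
Proof. by move=> k; apply: msrM; [exact: msr_cst|exact: zero_ext_adapted]. Qed.

Lemma fsum_std n t :
  fsum box_seq n (std n) xpredT t = (sg n)^-1 * box_sum P (L n) (X n) t.
Proof. by rewrite box_sumE mulr_sumr. Qed.

Lemma fsum_std_sqr n : E (fun t => fsum box_seq n (std n) xpredT t ^+ 2) = 1.
Proof.
under eq_Ex do rewrite fsum_std exprMn.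
rewrite ExZ; last exact/L2_sqr/box_sum_L2.
by rewrite -sigma_sqr -exprMn mulVf ?expr1n// gt_eqF// sigma_gt0.
Qed.

Lemma trunc_std_bdd e n k : 0 <= e -> bdd (fun t => trunc e (std n k t)).
Proof.
move=> e0; split; last by exists e => t; exact: trunc_bound.
apply: measurableT_comp; first exact: measurable_trunc.
exact: L2_measurable (std_L2 n k).
Qed.

Lemma std_trunc_bdd e n k : 0 <= e -> bdd (std_trunc e n k).
Proof. by move=> e0; apply: bddB; [exact: trunc_std_bdd|exact: bdd_cst]. Qed.

Lemma std_trunc_bounded e n : 0 <= e -> bounded_by (std_trunc e n) (2 * e).
Proof.
move=> e0 k t; apply: le_trans (ler_normB _ _) _.
rewrite mulr_natl mulr2n lerD ?trunc_bound//.
rewrite -[leRHS](Ex_cst P); apply: le_norm_Ex.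
- exact/bdd_summable/trunc_std_bdd.
- exact: summable_cst.
- by move=> u; exact: trunc_bound.
Qed.

Lemma std_trunc_centered e n : 0 <= e -> centered P (std_trunc e n).
Proof.
move=> e0 k; rewrite ExB ?Ex_cst ?subrr//; last exact: summable_cst.
exact/bdd_summable/trunc_std_bdd.
Qed.

Lemma std_trunc_adapted e n : adapted box_gen n (std_trunc e n).
Proof.
move=> k; apply: (@msrD _ _ _ _ _ (fun=> - _)); last exact: msr_cst.
exact: (@msr_comp _ _ _ _ (std n k) (trunc e) (measurable_trunc e) (@std_adapted n k)).
Qed.

Lemma variance_Ex_le f : L2 P f -> E (fun t => (f t - E f) ^+ 2) <= E (fun t => f t ^+ 2).
Proof.
move=> Lf; under eq_Ex do rewrite expr2.
rewrite Ex_cov//; under eq_Ex do rewrite -expr2.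
by rewrite gerBl -expr2 sqr_ge0.
Qed.

Lemma std_trunc_sqr_le e n k : 0 <= e ->
  E (fun t => std_trunc e n k t ^+ 2) <= E (fun t => std n k t ^+ 2).
Proof.
move=> e0; apply: le_trans (variance_Ex_le (bdd_L2 P (trunc_std_bdd n k e0))) _.
apply: le_Ex; [exact/bdd_summable/bddX/trunc_std_bdd|exact/L2_sqr/std_L2|].
by move=> t; exact: trunc_sqr_le.
Qed.

Lemma mass_std_trunc_le e n : 0 <= e ->
  mass P box_seq n (std_trunc e n) xpredT <= mass P box_seq n (std n) xpredT.
Proof. by move=> e0; apply: ler_sum => k _; exact: std_trunc_sqr_le. Qed.

Definition std_tail e n k t : R := std n k t - std_trunc e n k t.

Lemma std_tail_L2 e n k : 0 <= e -> L2 P (std_tail e n k).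
Proof.
by move=> e0; apply: L2B; [exact: std_L2|exact/bdd_L2/std_trunc_bdd].
Qed.

Lemma std_tail_centered e n : 0 <= e -> centered P (std_tail e n).
Proof.
move=> e0 k; rewrite ExB; last 2 first.
- exact/L2_summable/std_L2.
- exact/bdd_summable/std_trunc_bdd.
by rewrite std_trunc_centered// std_centered subrr.
Qed.

Lemma std_tail_adapted e n : adapted box_gen n (std_tail e n).
Proof.
move=> k; rewrite (_ : std_tail e n k =
    fun t => std n k t + -1 * std_trunc e n k t); last first.
  by apply/funext => t; rewrite mulN1r.
apply: msrD; first exact: std_adapted.
by apply: msrM; [exact: msr_cst|exact: std_trunc_adapted].
Qed.

(** As [std] has mean 0, the tail is the removed part minus its mean. Centring does not increase
    second moments, and those of the removed parts sum to the normalised Lindeberg expression. *)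
Lemma mass_std_tail_le e n : 0 <= e ->
  ((mass P box_seq n (std_tail e n) xpredT)%:E <=
   ((sg n) ^- 2)%:E * lindeberg_sum P (L n) (X n) e)%E.
Proof.
move=> e0; have s0 := sigma_gt0 n.
have term k : k \in box_seq n ->
    ('E_P[(fun t => X n k t ^+ 2 *
       \1_[set t | (e * sg n < `|X n k t|)%R] t)%R] =
     ((sg n) ^+ 2 * E (fun t => (std n k t - trunc e (std n k t)) ^+ 2))%:E)%E.
  move=> kB.
  have Lk : L2 P (fun t => std n k t - trunc e (std n k t)).
    by apply: L2B; [exact: std_L2|exact/bdd_L2/trunc_std_bdd].
  rewrite -ExZ; last exact: L2_sqr.
  rewrite unlock /Ex /Rintegral fineK; last first.
    exact: (integrable_fin_num measurableT (summableZ _ (L2_sqr Lk))).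
  apply: eq_integral => t _; rewrite trunc_diff_sqr /std /zero_ext.
  rewrite -mem_box_seq kB exprMn indicE.
  congr (_%:E); rewrite [in RHS]mulrA [in RHS]mulrA -exprMn divff ?gt_eqF//.
  rewrite expr1n mul1r; congr (_ * (nat_of_bool _)%:R).
  rewrite normrM gtr0_norm ?invr_gt0// [in RHS]mulrC ltr_pdivlMr//.
  by apply/idP/idP; rewrite inE.
rewrite /lindeberg_sum fsbig_finite; last exact: finite_box.
rewrite -/(box_seq n) (eq_big_seq _ term) sumEFin -EFinM lee_fin -mulr_sumr.
rewrite mulrA mulVf ?mul1r; last by rewrite expf_neq0// gt_eqF.
apply: ler_sum => k _.
have Lk : L2 P (fun t => std n k t - trunc e (std n k t)).
  by apply: L2B; [exact: std_L2|exact/bdd_L2/trunc_std_bdd].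
apply: le_trans (variance_Ex_le Lk); rewrite le_eqVlt; apply/orP; left; apply/eqP.
apply: eq_Ex => t; congr (_ ^+ 2); rewrite /std_tail /std_trunc ExB; last 2 first.
- exact/L2_summable/std_L2.
- exact/bdd_summable/trunc_std_bdd.
by rewrite std_centered; ring.
Qed.

Hypothesis halpha : ereal_sup (range (fun n => alpha_array P (L n) (X n) m))
  @[m --> \oo] --> 0%E.
Hypothesis hrho : (ereal_sup (range (fun n => rho'_array P (L n) (X n) 1)) < 1)%E.
Hypothesis hlindeberg : forall e : R, 0 < e ->
  ((((sigma P (L n) (X n)) ^- 2)%:E * lindeberg_sum P (L n) (X n) e)%E
     @[n --> \oo] --> 0%E).

Let sqrD_le (x y : R) : (x + y) ^+ 2 <= 2 * x ^+ 2 + 2 * y ^+ 2.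
Proof. by have := sqr_ge0 (x - y); nra. Qed.

(** The normalised sum has second moment 1, so the lower moment comparison bounds its mass by [D],
    which serves as the uniform mass bound in [field_clt]. The upper comparison makes the sum of the
    tails negligible by the Lindeberg condition. *)
Lemma std_gerr (tau e : R) : 0 < e ->
  \forall n \near \oo, gerr P tau (fsum box_seq n (std n) xpredT) e.
Proof.
move=> e0; have [r fs] := box_field_system halpha hrho.
have [D D1 hD] := field_second_moment fs.
have D0 : 0 < D by exact: lt_le_trans D1.
have e2 : 0 < e / 2 by rewrite divr_gt0.
have [e1 e10 he1] := field_clt fs tau (ltW D0) e2.
pose W := 2 + 2 * (D * D).
have W0 : 0 <= W by rewrite addr_ge0// mulr_ge0// mulr_ge0// ltW.
pose c := `|tau| + tau ^+ 2 * (1 + W) + 1.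
have c0 : 0 < c.
  by rewrite ltr_wpDl// addr_ge0// mulr_ge0 ?sqr_ge0// addr_ge0.
pose th := e / (2 * c).
have th0 : 0 < th by rewrite divr_gt0// mulr_gt0.
have hth : `|tau| * th + tau ^+ 2 * th * (1 + W) <= e / 2.
  have : th * c = e / 2 by rewrite /th; field; rewrite gt_eqF.
  by rewrite /c; lra.
(* Recentring can double the truncation level. *)
pose ep := e1 / 2; have ep0 : 0 < ep by rewrite divr_gt0.
have ep0' := ltW ep0.
have mass_std n : mass P box_seq n (std n) xpredT <= D.
  have [_] := hD n (std n) xpredT (@std_adapted n) (std_L2 n) (@std_centered n).
  by rewrite fsum_std_sqr mulr1.
have x0 : 0 < th ^+ 2 / D by rewrite divr_gt0// exprn_gt0.
have [hf hl] := (fine_cvgP _ _).1 (hlindeberg ep0).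
move/cvgrPdist_le : hl => /(_ _ x0) hl.
near=> n.
have tail : D * mass P box_seq n (std_tail ep n) xpredT <= th ^+ 2.
  rewrite mulrC -ler_pdivlMr// -lee_fin.
  apply: le_trans (mass_std_tail_le n ep0') _.
  have fn : ((sg n ^- 2)%:E * lindeberg_sum P (L n) (X n) ep)%E \is a fin_num.
    by near: n; exact: hf.
  rewrite -(fineK fn) lee_fin; apply: le_trans (ler_norm _) _.
  have : `|0 - fine ((sg n ^- 2)%:E * lindeberg_sum P (L n) (X n) ep)%E| <= th ^+ 2 / D.
    by near: n; exact: hl.
  by rewrite sub0r normrN.
pose Y := std_trunc ep n.
have bY : bounded_by Y e1.
  have -> : e1 = 2 * ep by rewrite /ep; field.
  exact: std_trunc_bounded.
have cY : centered P Y by exact: std_trunc_centered.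
have aY : adapted box_gen n Y by exact: std_trunc_adapted.
have mY : mass P box_seq n Y xpredT <= D.
  exact: le_trans (mass_std_trunc_le n ep0') (mass_std n).
have gY := he1 n Y aY cY bY mY.
have LY k : L2 P (Y k) by exact/bdd_L2/std_trunc_bdd.
have LS := fsum_L2 box_seq n xpredT (std_L2 n).
have LS' := fsum_L2 box_seq n xpredT LY.
have Ed : E (fun t => (fsum box_seq n (std n) xpredT t - fsum box_seq n Y xpredT t) ^+ 2)
    <= th ^+ 2.
  apply: le_trans tail.
  have [h _] := hD n (std_tail ep n) xpredT (@std_tail_adapted ep n)
    (fun k => @std_tail_L2 ep n k ep0') (std_tail_centered n ep0').
  apply: le_trans h; rewrite le_eqVlt; apply/orP; left; apply/eqP.
  by apply: eq_Ex => t; rewrite /fsum -sumrB.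
have Es : E (fun t => (fsum box_seq n (std n) xpredT t + fsum box_seq n Y xpredT t) ^+ 2)
    <= W.
  have s1 := summableZ 2 (L2_sqr LS); have s2 := summableZ 2 (L2_sqr LS').
  apply: (@le_trans _ _ (E (fun t => 2 * fsum box_seq n (std n) xpredT t ^+ 2 +
     2 * fsum box_seq n Y xpredT t ^+ 2))).
    apply: le_Ex; [exact/L2_sqr/L2D|exact: (summableD s1 s2)|].
    by move=> t; exact: sqrD_le.
  rewrite (ExD s1 s2) (ExZ _ (L2_sqr LS)) (ExZ _ (L2_sqr LS')) fsum_std_sqr mulr1.
  rewrite lerD2l ler_pM2l//.
  have [h _] := hD n Y xpredT aY LY cY; apply: le_trans h _.
  by rewrite ler_pM2l.
apply: gerr_le (gerr_perturb th0 LS LS' Ed Es gY).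
by rewrite [leRHS]splitr -addrA lerD2l.
Unshelve. all: by end_near. Qed.

Lemma std_cos_cvg (a b : R) :
  E (fun t => cos (a * ((sg n)^-1 * box_sum P (L n) (X n) t) + b)) @[n --> \oo]
    --> expR (- (a ^+ 2 / 2)) * cos b.
Proof.
apply/cvgrPdist_le => e e0; near=> n.
have : gerr P a (fsum box_seq n (std n) xpredT) e by near: n; exact: std_gerr.
move=> /(_ b); rewrite /gauss_factor fsum_std_sqr mulr1 distrC.
by under eq_Ex do rewrite fsum_std.
Unshelve. all: by end_near. Qed.

End normalized_array.

Theorem theorem1p1 (disp : measure_display) (T : measurableType disp)
    (R : realType) (P : probability T R)
    (d : nat) (hd : (0 < d)%N)
    (L : nat -> 'I_d -> nat) (hL : forall n u, (0 < L n u)%N)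
    (X : nat -> lattice d -> {RV P >-> R})
    (hmean : forall n k, box (L n) k -> ('E_P[X n k] = 0)%E)
    (hvar : forall n k, box (L n) k ->
       ('E_P[(fun t => (X n k t ^+ 2)%R)] < +oo)%E)
    (halpha : ereal_sup (range (fun n => alpha_array P (L n) (X n) m))
       @[m --> \oo] --> 0%E)
    (hrho : (ereal_sup (range (fun n => rho'_array P (L n) (X n) 1)) < 1)%E)
    (hsigma : forall n, (0 < sigma2 P (L n) (X n))%E)
    (hlindeberg : forall e : R, 0 < e ->
       ((((sigma P (L n) (X n)) ^- 2)%:E * lindeberg_sum P (L n) (X n) e)%E
          @[n --> \oo] --> 0%E)) :
  cvg_in_distribution P
    (fun n t => (sigma P (L n) (X n))^-1 * box_sum P (L n) (X n) t)
    (@normal_prob R 0 1).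
Proof.
apply: levy_continuity.
- by move=> n; apply: L2Z; exact: box_sum_L2.
- move=> n; have := fsum_std_sqr hvar hsigma n.
  by under eq_Ex do rewrite fsum_std; move=> ->.
- move=> a b; exact: std_cos_cvg hmean hvar hsigma halpha hrho hlindeberg a b.
Qed.
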